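(* Let $1<p<\infty$ and $q=p/(p-1)$. Let $(k_n)$ be a sequence in $H^q\setminus\{0\}$ with $k_n\to k$ in $H^q$, where $k\not\equiv 0$. Let $F_n$ be the $A^p$ extremal function for $k_n$ and $F$ the $A^p$ extremal function for $k$. Then $F_n$, $F\in H^p$ and $F_n\rightharpoonup F$ weakly in $H^p$. Moreover, if $k$ and all $k_n$ are polynomials, then $F_n\to F$ in the norm of $H^p$.
   Context: $\mathbb{D}$ is the open unit disc and $\sigma$ is normalized area measure on $\mathbb{D}$. For $1<p<\infty$, $A^p$ is the Bergman space of analytic $f$ on $\mathbb{D}$ with $\|f\|_{A^p}=(\int_{\mathbb{D}}|f|^p\,d\sigma)^{1/p}<\infty$, and $H^p$ is the Hardy space of analytic $f$ with $\|f\|_{H^p}=\sup_{0<r<1}(\frac1{2\pi}\int_0^{2\pi}|f(re^{i\theta})|^p d\theta)^{1/p}<\infty$ (note $H^q\subset A^q$). For $k\in A^q$, $k\not\equiv0$, the functional with kernel $k$ is $\phi(f)=\int_{\mathbb{D}} f\,\overline{k}\,d\sigma$ on $A^p$, with norm $\|\phi\|$ in $(A^p)^*$. The extremal function for $k$ is the unique $F\in A^p$ with $\|F\|_{A^p}=1$ and $\operatorname{Re}\phi(F)=\sup_{\|g\|_{A^p}=1}\operatorname{Re}\phi(g)=\|\phi\|$. *)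

(* Defs.v *)
From Stdlib Require Import Reals ClassicalEpsilon.
Open Scope R_scope.

Definition Cx := (R * R)%type.
Definition C0 : Cx := (0, 0).
Definition Cre (z : Cx) : R := fst z.
Definition Cim (z : Cx) : R := snd z.
Definition Cadd (z w : Cx) : Cx := (fst z + fst w, snd z + snd w).
Definition Copp (z : Cx) : Cx := (- fst z, - snd z).
Definition Csub (z w : Cx) : Cx := Cadd z (Copp w).
Definition Cmul (z w : Cx) : Cx :=
  (fst z * fst w - snd z * snd w, fst z * snd w + snd z * fst w).
Definition Cconj (z : Cx) : Cx := (fst z, - snd z).
Definition Cmod (z : Cx) : R := sqrt (fst z ^ 2 + snd z ^ 2).
Fixpoint Cpow (z : Cx) (n : nat) : Cx :=
  match n with O => (1, 0) | S m => Cmul z (Cpow z m) end.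
Fixpoint Csum (a : nat -> Cx) (n : nat) : Cx :=
  match n with O => a O | S m => Cadd (Csum a m) (a (S m)) end.

Definition pt (r t : R) : Cx := (r * cos t, r * sin t).

(* x^p for x >= 0 and real p > 0, with 0^p = 0 *)
Definition rpow (x p : R) : R :=
  if Req_EM_T x 0 then 0 else Rpower x p.

(* Riemann integral (the value, when f is Riemann integrable on [a,b]) *)
Definition Rint (f : R -> R) (a b : R) : R :=
  epsilon (inhabits 0)
    (fun v => exists pr : Riemann_integrable f a b, RiemannInt pr = v).
Definition sup (S : R -> Prop) : R := epsilon (inhabits 0) (fun v => is_lub S v).
Definition lim1 (h : R -> R) (v : R) : Prop :=
  forall eps, 0 < eps -> exists d, 0 < d /\
    forall rho, 1 - d < rho < 1 -> Rabs (h rho - v) < eps.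

Definition holo (f : Cx -> Cx) : Prop :=
  forall z, Cmod z < 1 -> exists L : Cx, forall eps, 0 < eps ->
    exists d, 0 < d /\ forall h : Cx, 0 < Cmod h < d -> Cmod (Cadd z h) < 1 ->
      Cmod (Csub (Csub (f (Cadd z h)) (f z)) (Cmul L h)) <= eps * Cmod h.

Definition not_zero (f : Cx -> Cx) : Prop := exists z, Cmod z < 1 /\ f z <> C0.

Definition is_poly (f : Cx -> Cx) : Prop :=
  exists (n : nat) (a : nat -> Cx),
    forall z, Cmod z < 1 -> f z = Csum (fun j => Cmul (a j) (Cpow z j)) n.

Definition Mp (p : R) (f : Cx -> Cx) (r : R) : R :=
  / (2 * PI) * Rint (fun t => rpow (Cmod (f (pt r t))) p) 0 (2 * PI).
Definition Hp (p : R) (f : Cx -> Cx) : Prop :=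
  holo f /\ exists M, forall r, 0 <= r < 1 -> Mp p f r <= M.
Definition Hp_norm (p : R) (f : Cx -> Cx) : R :=
  sup (fun x => exists r, 0 <= r < 1 /\ x = rpow (Mp p f r) (/ p)).

Definition area_partial (g : Cx -> R) (rho : R) : R :=
  / PI * Rint (fun r => r * Rint (fun t => g (pt r t)) 0 (2 * PI)) 0 rho.
Definition area_int (g : Cx -> R) : R :=
  epsilon (inhabits 0) (fun v => lim1 (area_partial g) v).

Definition Ap (p : R) (f : Cx -> Cx) : Prop :=
  holo f /\ exists v, lim1 (area_partial (fun z => rpow (Cmod (f z)) p)) v.
Definition Ap_norm (p : R) (f : Cx -> Cx) : R :=
  rpow (area_int (fun z => rpow (Cmod (f z)) p)) (/ p).

Definition phi (k f : Cx -> Cx) : Cx :=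
  (area_int (fun z => Cre (Cmul (f z) (Cconj (k z)))),
   area_int (fun z => Cim (Cmul (f z) (Cconj (k z))))).
Definition phi_norm (p : R) (k : Cx -> Cx) : R :=
  sup (fun x => exists g, Ap p g /\ Ap_norm p g = 1 /\ x = Cmod (phi k g)).

Definition is_extremal (p : R) (k F : Cx -> Cx) : Prop :=
  Ap p F /\ Ap_norm p F = 1 /\ Cre (phi k F) = phi_norm p k.

Definition Hp_linear (p : R) (L : (Cx -> Cx) -> Cx) : Prop :=
  forall (f g : Cx -> Cx) (a : Cx), Hp p f -> Hp p g ->
    L (fun z => Cadd (Cmul a (f z)) (g z)) = Cadd (Cmul a (L f)) (L g).
Definition Hp_bounded (p : R) (L : (Cx -> Cx) -> Cx) : Prop :=
  exists c, forall f, Hp p f -> Cmod (L f) <= c * Hp_norm p f.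
Definition weak_conv_Hp (p : R) (Fn : nat -> Cx -> Cx) (F : Cx -> Cx) : Prop :=
  forall L : (Cx -> Cx) -> Cx, Hp_linear p L -> Hp_bounded p L ->
    forall eps, 0 < eps -> exists N : nat, forall n, (n >= N)%nat ->
      Cmod (Csub (L (Fn n)) (L F)) < eps.

(* Main.v *)
(* Write [M(r, f)] for the mean of [|f|^p] on the circle of radius [r]. Testing the
   extremality of [F] against the dilations [F(t^2 z)] bounds the mass of [|F|^p] on the
   annulus [t^2 < |z| < 1] by a pairing of [F] with [k] on [t < |z| < 1]; Young's
   inequality absorbs that pairing, so the mass is [O(1 - t)], and as [M(r, F)] increases
   with [r] it is bounded: [F] lies in [H^p], with a bound depending only on [|k|_{H^q}]
   and on a lower bound for [|phi|]. Uniform convexity of [A^p] gives [F_n -> F] in [A^p],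
   hence locally uniformly. Weak convergence follows without any duality theory: if
   [Re L(u_n (F_n - F)) >= e] along a subsequence, almost norm-minimal elements of the
   midpoint hulls of its tails are almost Cauchy by uniform convexity, and tend to 0 locally
   uniformly, so their norms are small, whereas [L] keeps them away from 0.

   If [k] is a polynomial, letting [t -> 1] above gives
   [limsup |F_n|_{H^p}^p <= 1 + (p / (2 |phi|)) Q], where [Q] is the real part of [phi]
   applied to [z F'].  In the other direction, [F] and its rotation by [th] differ to second
   order in the sense of the convexity gap of [|.|^p], because the kernel is a polynomial; this
   makes the variation [F - i (F(e^{i th} z) - F(z))], which agrees with [F((1 + th) z)] to first
   order, admissible up to the boundary and yields [p Q / |phi| <= 2 |F|_{H^p}^p - 2]. So
   [limsup |F_n|_{H^p} <= |F|_{H^p}], and uniform convexity of [H^p] gives norm convergence. *)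

From Stdlib Require Import Reals ZArith Lra Psatz Lia ClassicalEpsilon FunctionalExtensionality.
From Coquelicot Require Import Coquelicot.
Require Import Defs.
Open Scope R_scope.

(** * Powers of nonnegative reals *)

(** All integrals are Riemann integrals and no boundary values are formed: H^p is handled through
    means over circles |z| = r < 1, which increase with r by Jensen's inequality for the Poisson
    kernel. The dilation has factor t^2 because the mean of f(x e^{is}) conj k(y e^{is}) depends
    only on x y: pairing F(t^2 z) with k on |z| = r is pairing F with k on |z| = t r, so the loss is
    a tail of the original pairing. Extremality is used through the affine bound Re phi(g) <= |phi|
    (1 + (|g|^p - 1)/p), Bernoulli's form of the norm inequality, which is exact to first order at
    F. The reverse estimate would follow from testing with F((1 + th) z), which is not defined on
    the whole disc. In the variation that replaces it, the error outside |z| < r is of order th (l +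
    m / l), with m the mass of |F|^p there and l a free weight; letting th -> 0, then r -> 1, then l
    -> 0 removes it. *)

Lemma rpow_pos (x p : R) : 0 < x -> rpow x p = exp (p * ln x).
Proof. intros; unfold rpow; destruct (Req_EM_T x 0); [lra | reflexivity]. Qed.

Lemma rpow_0 (p : R) : rpow 0 p = 0.
Proof. unfold rpow; destruct (Req_EM_T 0 0); lra. Qed.

Lemma rpow_ge0 (x p : R) : 0 <= rpow x p.
Proof.
unfold rpow; destruct (Req_EM_T x 0); [lra | apply Rlt_le, exp_pos].
Qed.

Lemma rpow_gt0 (x p : R) : 0 < x -> 0 < rpow x p.
Proof. intros; rewrite rpow_pos by lra; apply exp_pos. Qed.

Lemma rpow_one (p : R) : rpow 1 p = 1.
Proof. rewrite rpow_pos, ln_1, Rmult_0_r by lra; apply exp_0. Qed.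

Lemma rpow_mult (x y p : R) :
  0 <= x -> 0 <= y -> rpow (x * y) p = rpow x p * rpow y p.
Proof.
intros [hx | <-] [hy | <-]; rewrite ?Rmult_0_l, ?Rmult_0_r, ?rpow_0; try lra.
rewrite !rpow_pos, ln_mult, <- exp_plus by (try apply Rmult_lt_0_compat; lra).
f_equal; ring.
Qed.

Lemma rpow_plus (x p q : R) : 0 <= x -> rpow x (p + q) = rpow x p * rpow x q.
Proof.
intros [hx | <-]; rewrite ?rpow_0; try lra.
rewrite !rpow_pos, <- exp_plus by lra; f_equal; ring.
Qed.

Lemma rpow_comp (x p q : R) : 0 <= x -> rpow (rpow x p) q = rpow x (p * q).
Proof.
intros [hx | <-]; rewrite ?rpow_0; try lra.
rewrite (rpow_pos (rpow x p)) by now apply rpow_gt0.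
rewrite !rpow_pos, ln_exp by lra; f_equal; ring.
Qed.

Lemma rpow_1 (x : R) : 0 <= x -> rpow x 1 = x.
Proof.
intros [hx | <-]; rewrite ?rpow_0; try lra.
rewrite rpow_pos, Rmult_1_l, exp_ln; lra.
Qed.

Lemma rpow_2 (x : R) : 0 <= x -> rpow x 2 = x ^ 2.
Proof.
intros hx; replace 2 with (1 + 1) at 1 by ring.
rewrite rpow_plus, rpow_1 by lra; ring.
Qed.

Lemma rpow_inv (x p : R) : 0 < p -> 0 <= x -> rpow (rpow x p) (/ p) = x.
Proof.
intros hp hx; rewrite rpow_comp, Rinv_r, rpow_1; lra.
Qed.

Lemma rpow_inv' (x p : R) : 0 < p -> 0 <= x -> rpow (rpow x (/ p)) p = x.
Proof.
intros hp hx; rewrite rpow_comp, Rinv_l, rpow_1; lra.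
Qed.

Lemma rpow_lt (x y p : R) : 0 < p -> 0 <= x < y -> rpow x p < rpow y p.
Proof.
intros hp [[hx | <-] hxy]; [| rewrite rpow_0; now apply rpow_gt0].
rewrite !rpow_pos by lra; apply exp_increasing, Rmult_lt_compat_l; trivial.
now apply ln_increasing.
Qed.

Lemma rpow_le (x y p : R) : 0 < p -> 0 <= x <= y -> rpow x p <= rpow y p.
Proof.
intros hp [hx [hxy | <-]]; [| lra].
now apply Rlt_le, rpow_lt.
Qed.

(** By convexity the graph of exp lies above its tangent at m. The inequalities for powers below are
    derived from this one. *)
Lemma exp_tangent (m a : R) : exp m * (1 + (a - m)) <= exp a.
Proof.
replace a with (m + (a - m)) at 2 by ring.
rewrite exp_plus; apply Rmult_le_compat_l; [apply Rlt_le, exp_pos |].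
destruct (Req_dec (a - m) 0) as [-> | h]; [rewrite exp_0; lra |].
now apply Rlt_le, exp_ineq1.
Qed.

(** The tangent of exp at ln s, evaluated at p ln s, gives s (1 + (p-1) ln s) <= s^p; evaluated at 0
    it gives s ln s >= s - 1. *)
Lemma bernoulli (p s : R) : 1 <= p -> 0 <= s -> 1 + p * (s - 1) <= rpow s p.
Proof.
intros hp [hs | <-]; [| rewrite rpow_0; lra].
rewrite rpow_pos by lra.
assert (h1 := exp_tangent (ln s) (p * ln s)).
assert (h2 := exp_tangent (ln s) 0).
rewrite exp_0 in h2; rewrite exp_ln in h1, h2 by lra.
assert (h3 : (p - 1) * (s * (1 + (0 - ln s))) <= (p - 1) * 1)
  by (apply Rmult_le_compat_l; lra).
nra.
Qed.

(** The tangent of exp at a ln s is evaluated at ln s and at 0; with weights a and 1 - a the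
    logarithms cancel. *)
Lemma bernoulli_concave (a s : R) :
  0 < a <= 1 -> 0 <= s -> rpow s a <= 1 + a * (s - 1).
Proof.
intros ha [hs | <-]; [| rewrite rpow_0; lra].
rewrite rpow_pos by lra.
assert (h1 := exp_tangent (a * ln s) (ln s)).
assert (h2 := exp_tangent (a * ln s) 0).
rewrite exp_0 in h2; rewrite exp_ln in h1 by lra.
assert (h3 := Rmult_le_compat_l (1 - a) _ _ ltac:(lra) h2).
assert (h4 := Rmult_le_compat_l a _ _ ltac:(lra) h1).
nra.
Qed.

(** By homogeneity this is Bernoulli's inequality at s / x. At x = 0 the left side vanishes, also
    for p = 1, since [rpow 0 0] is 0. *)
Lemma rpow_tangent (p x s : R) : 1 <= p -> 0 <= x -> 0 <= s ->
  rpow x p + p * rpow x (p - 1) * (s - x) <= rpow s p.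
Proof.
intros hp [hx | <-] hs; [| rewrite !rpow_0; assert (h := rpow_ge0 s p); lra].
assert (h := bernoulli p (s / x) hp ltac:(apply Rmult_le_pos; [lra | apply Rlt_le, Rinv_0_lt_compat; lra])).
replace (rpow s p) with (rpow x p * rpow (s / x) p).
2: { rewrite <- rpow_mult; [f_equal; field; lra | lra |].
     apply Rmult_le_pos; [lra | apply Rlt_le, Rinv_0_lt_compat; lra]. }
replace (rpow x (p - 1)) with (rpow x p / x).
2: { replace (rpow x p) with (rpow x (p - 1 + 1)) by (f_equal; ring).
     rewrite rpow_plus, rpow_1 by lra; field; lra. }
replace (rpow x p + p * (rpow x p / x) * (s - x))
  with (rpow x p * (1 + p * (s / x - 1))) by (field; lra).
apply Rmult_le_compat_l; [apply rpow_ge0 | exact h].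
Qed.

Lemma rpow_diff_le (p x s : R) : 1 <= p -> 0 <= x -> 0 <= s ->
  rpow s p - rpow x p <= p * rpow s (p - 1) * (s - x).
Proof.
intros hp hx hs; assert (h := rpow_tangent p s x hp hs hx); nra.
Qed.

Lemma rpow_concave_tangent (a x s : R) : 0 < a <= 1 -> 0 < x -> 0 <= s ->
  rpow s a <= rpow x a + a * rpow x (a - 1) * (s - x).
Proof.
intros ha hx hs.
assert (hsx : 0 <= s / x) by (apply Rmult_le_pos; [lra | apply Rlt_le, Rinv_0_lt_compat; lra]).
assert (h := bernoulli_concave a (s / x) ha hsx).
replace (rpow s a) with (rpow x a * rpow (s / x) a)
  by (rewrite <- rpow_mult by lra; f_equal; field; lra).
replace (rpow x (a - 1)) with (rpow x a / x).
2: { replace (rpow x a) with (rpow x (a - 1 + 1)) by (f_equal; ring).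
     rewrite rpow_plus, rpow_1 by lra; field; lra. }
replace (rpow x a + a * (rpow x a / x) * (s - x))
  with (rpow x a * (1 + a * (s / x - 1))) by (field; lra).
apply Rmult_le_compat_l; [apply rpow_ge0 | exact h].
Qed.

(** If y <= d x^(p-1), the first term alone suffices. Otherwise x <= (y/d)^(1/(p-1)), and since q =
    1 + 1/(p-1) the second suffices with K = d^(-1/(p-1)). *)
Lemma rpow_young (p q : R) : 1 < p -> q = p / (p - 1) ->
  forall d, 0 < d -> exists K, 0 <= K /\ forall x y, 0 <= x -> 0 <= y ->
    x * y <= d * rpow x p + K * rpow y q.
Proof.
intros hp hq d hd; exists (rpow (/ d) (/ (p - 1))); split; [apply rpow_ge0 |].
assert (hd' := Rinv_0_lt_compat d hd).
intros x y hx hy.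
assert (hX := rpow_ge0 x p); assert (hY := rpow_ge0 y q).
assert (hK := rpow_ge0 (/ d) (/ (p - 1))).
destruct (Rle_or_lt y (d * rpow x (p - 1))) as [h | h].
- replace (rpow x p) with (rpow x (p - 1) * x).
  2: { rewrite <- (rpow_1 x) at 2 by lra; rewrite <- rpow_plus by lra; f_equal; ring. }
  assert (h1 := Rmult_le_compat_l x _ _ hx h).
  assert (h2 := Rmult_le_pos _ _ hK hY); lra.
- assert (hx' : x <= rpow (/ d) (/ (p - 1)) * rpow y (/ (p - 1))).
  { rewrite <- rpow_mult by lra.
    rewrite <- (rpow_inv x (p - 1)) by lra.
    apply rpow_le; [apply Rinv_0_lt_compat; lra | split; [apply rpow_ge0 |]].
    apply (Rmult_le_reg_l d); [lra |].
    rewrite <- Rmult_assoc, Rinv_r; lra. }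
  assert (h1 := Rmult_le_compat_r y _ _ hy hx').
  assert (h2 : rpow y q = rpow y (/ (p - 1)) * y).
  { subst q; rewrite <- (rpow_1 y) at 3 by lra; rewrite <- rpow_plus by lra.
    f_equal; field; lra. }
  rewrite h2.
  assert (h3 : 0 <= d * rpow x p) by (apply Rmult_le_pos; lra).
  lra.
Qed.

Lemma rpow_sum (p x y : R) : 0 < p -> 0 <= x -> 0 <= y ->
  rpow (x + y) p <= rpow 2 p * (rpow x p + rpow y p).
Proof.
intros hp hx hy.
assert (hX := rpow_ge0 x p); assert (hY := rpow_ge0 y p); assert (h2 := rpow_ge0 2 p).
destruct (Rle_or_lt x y).
- apply Rle_trans with (rpow (2 * y) p); [apply rpow_le; lra |].
  rewrite rpow_mult by lra; nra.
- apply Rle_trans with (rpow (2 * x) p); [apply rpow_le; lra |].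
  rewrite rpow_mult by lra; nra.
Qed.

(** * Convexity of powers and its quantitative gap *)

Lemma rpow_midpoint (p u v : R) : 1 <= p -> 0 <= u -> 0 <= v ->
  rpow ((u + v) / 2) p <= (rpow u p + rpow v p) / 2.
Proof.
intros hp hu hv.
assert (h1 := rpow_tangent p ((u + v) / 2) u hp ltac:(lra) hu).
assert (h2 := rpow_tangent p ((u + v) / 2) v hp ltac:(lra) hv).
nra.
Qed.

(** At a negative argument [rpow] takes the value 1, since [ln] is 0 there. Composing with [Rabs]
    removes the jump, so that the mean value theorem applies up to 0. *)
Lemma rpow_abs_continuity (p x : R) :
  0 < p -> continuity_pt (fun t => rpow (Rabs t) p) x.
Proof.
intros hp; destruct (Req_dec x 0) as [-> | hx].
- intros eps heps; exists (rpow eps (/ p)); split; [now apply rpow_gt0 |].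
  intros t [_ ht]; simpl in *; unfold R_dist in *.
  rewrite Rabs_R0, rpow_0, Rminus_0_r, Rabs_pos_eq by apply rpow_ge0.
  rewrite <- (rpow_inv' eps p) by lra.
  rewrite Rminus_0_r in ht.
  apply rpow_lt; [lra | split; [apply Rabs_pos | exact ht]].
- apply continuity_pt_ext_loc with (fun t => exp (p * ln (Rabs t))).
  + exists (mkposreal (Rabs x) (Rabs_pos_lt x hx)); intros t ht; simpl in *.
    symmetry; apply rpow_pos, Rabs_pos_lt.
    intros ->; unfold ball in ht; simpl in ht; unfold AbsRing_ball in ht; simpl in ht.
    unfold minus, plus, opp, abs in ht; simpl in ht.
    rewrite Rplus_0_l, Rabs_Ropp in ht; lra.
  + apply (continuity_pt_comp (fun t => p * ln (Rabs t)) exp).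
    * apply (continuity_pt_comp (fun t => ln (Rabs t)) (fun u => p * u)).
      -- apply (continuity_pt_comp Rabs ln); [apply Rcontinuity_abs |].
         apply derivable_continuous_pt; exists (/ Rabs x).
         now apply derivable_pt_lim_ln, Rabs_pos_lt.
      -- apply continuity_pt_scal, continuity_pt_id.
    * apply derivable_continuous_pt, derivable_pt_exp.
Qed.

Lemma rpow_abs_is_derive (p x : R) : 0 < x ->
  is_derive (fun t => rpow (Rabs t) p) x (p * rpow x (p - 1)).
Proof.
intros hx.
apply (is_derive_ext_loc (fun t => Rpower t p)).
- exists (mkposreal x hx); intros t ht; simpl in *.
  unfold ball in ht; simpl in ht; unfold AbsRing_ball in ht; simpl in ht.
  unfold minus, plus, opp, abs in ht; simpl in ht.
  assert (0 < t) by (apply Rabs_def2 in ht; lra).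
  rewrite Rabs_pos_eq, rpow_pos by lra; reflexivity.
- rewrite rpow_pos by lra; apply is_derive_Reals.
  now apply derivable_pt_lim_power.
Qed.

(** On (0,1] the second derivative p (p-1) t^(p-2) of t^p is at least p (p-1). Hence t^p - p (p-1)/2
    t^2 is increasing and convex there; this is the sign and the monotonicity of its derivative, up
    to the factor p. *)
Lemma rpow_minus_square_deriv (p s t : R) : 1 < p < 2 -> 0 < s <= t -> t <= 1 ->
  0 <= rpow s (p - 1) - (p - 1) * s <= rpow t (p - 1) - (p - 1) * t.
Proof.
intros hp hs ht; split.
- assert (h : rpow s 1 <= rpow s (p - 1)).
  { rewrite !rpow_pos by lra.
    assert (hl : ln s <= 0) by (rewrite <- ln_1; apply ln_le; lra).
    assert (hh : 1 * ln s <= (p - 1) * ln s) by nra.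
    destruct hh as [hh | ->]; [apply Rlt_le, exp_increasing, hh | lra]. }
  rewrite rpow_1 in h by lra; nra.
- assert (h := rpow_concave_tangent (p - 1) t s ltac:(lra) ltac:(lra) ltac:(lra)).
  assert (h1 : 1 <= rpow t (p - 1 - 1)).
  { rewrite rpow_pos by lra; apply Rle_trans with (exp 0); [rewrite exp_0; lra |].
    assert (hl : ln t <= 0) by (rewrite <- ln_1; apply ln_le; lra).
    assert (hh : 0 <= (p - 1 - 1) * ln t) by nra.
    destruct hh as [hh | <-]; [apply Rlt_le, exp_increasing, hh | lra]. }
  assert (h2 : (p - 1) * (t - s) <= (p - 1) * rpow t (p - 1 - 1) * (t - s)).
  { apply Rmult_le_compat_r; [lra |].
    rewrite <- (Rmult_1_r (p - 1)) at 1; apply Rmult_le_compat_l; lra. }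
  lra.
Qed.

Lemma rpow_minus_square_incr (p s t : R) : 1 < p < 2 -> 0 <= s <= t -> t <= 1 ->
  rpow s p - p * (p - 1) / 2 * s ^ 2 <= rpow t p - p * (p - 1) / 2 * t ^ 2.
Proof.
intros hp hs ht.
destruct (MVT_gen (fun x => rpow (Rabs x) p - p * (p - 1) / 2 * x ^ 2) s t
  (fun x => p * rpow x (p - 1) - p * (p - 1) * x)) as [c [hc hd]].
- rewrite Rmin_left, Rmax_right by lra; intros x hx.
  apply (is_derive_minus (K := R_AbsRing) (V := R_NormedModule)).
  + apply rpow_abs_is_derive; lra.
  + auto_derive; trivial; field.
- intros x _; apply continuity_pt_minus; [apply rpow_abs_continuity; lra |].
  apply continuity_pt_scal, derivable_continuous_pt, derivable_pt_pow.
- rewrite Rmin_left, Rmax_right in hc by lra.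
  rewrite !Rabs_pos_eq in hd by lra.
  enough (0 <= (p * rpow c (p - 1) - p * (p - 1) * c) * (t - s)) by lra.
  apply Rmult_le_pos; [| lra].
  destruct (Req_dec c 0) as [-> | hc0]; [rewrite rpow_0; lra |].
  assert (h := rpow_minus_square_deriv p c c hp ltac:(lra) ltac:(lra)).
  nra.
Qed.

(** The sum of the values at a + x and a - x has nonnegative derivative in x, because the derivative
    of the function is nondecreasing; the values at x = 0 and x = (v - u)/2 are compared. *)
Lemma rpow_minus_square_midpoint (p u v : R) : 1 < p < 2 -> 0 <= u <= v -> v <= 1 ->
  rpow ((u + v) / 2) p - p * (p - 1) / 2 * ((u + v) / 2) ^ 2 <=
  (rpow u p - p * (p - 1) / 2 * u ^ 2 + (rpow v p - p * (p - 1) / 2 * v ^ 2)) / 2.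
Proof.
intros hp hu hv.
set (a := (u + v) / 2); set (e := (v - u) / 2).
destruct (MVT_gen (fun x => rpow (Rabs (a + x)) p - p * (p - 1) / 2 * (a + x) ^ 2 +
    (rpow (Rabs (a - x)) p - p * (p - 1) / 2 * (a - x) ^ 2)) 0 e
  (fun x => (p * rpow (a + x) (p - 1) - p * (p - 1) * (a + x)) -
     (p * rpow (a - x) (p - 1) - p * (p - 1) * (a - x)))) as [c [hc hd]].
- rewrite Rmin_left, Rmax_right by (unfold e; lra); intros x hx.
  assert (h0 : forall y, 0 < y -> is_derive (fun t => rpow (Rabs t) p - p * (p - 1) / 2 * t ^ 2) y
                 (p * rpow y (p - 1) - p * (p - 1) * y)).
  { intros y hy; apply (is_derive_minus (K := R_AbsRing) (V := R_NormedModule)).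
    + apply rpow_abs_is_derive; lra.
    + auto_derive; trivial; field. }
  apply (is_derive_plus (K := R_AbsRing) (V := R_NormedModule)).
  + replace (p * rpow (a + x) (p - 1) - p * (p - 1) * (a + x)) with
      (scal 1 (p * rpow (a + x) (p - 1) - p * (p - 1) * (a + x)))
      by (unfold scal; simpl; unfold mult; simpl; ring).
    apply (is_derive_comp (fun t => rpow (Rabs t) p - p * (p - 1) / 2 * t ^ 2) (fun x => a + x)).
    * apply h0; unfold a, e in *; lra.
    * auto_derive; trivial.
  + replace (- (p * rpow (a - x) (p - 1) - p * (p - 1) * (a - x))) with
      (scal (-1) (p * rpow (a - x) (p - 1) - p * (p - 1) * (a - x)))
      by (unfold scal; simpl; unfold mult; simpl; ring).
    apply (is_derive_comp (fun t => rpow (Rabs t) p - p * (p - 1) / 2 * t ^ 2) (fun x => a - x)).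
    * apply h0; unfold a, e in *; lra.
    * auto_derive; trivial.
- intros x _.
  assert (h0 : forall y, continuity_pt (fun t => rpow (Rabs t) p - p * (p - 1) / 2 * t ^ 2) y).
  { intros y; apply continuity_pt_minus; [apply rpow_abs_continuity; lra |].
    apply continuity_pt_scal, derivable_continuous_pt, derivable_pt_pow. }
  apply continuity_pt_plus.
  + apply (continuity_pt_comp (fun x => a + x) (fun t => rpow (Rabs t) p - p * (p - 1) / 2 * t ^ 2)); [| apply h0].
    apply continuity_pt_plus; [apply continuity_pt_const; now intros ? ? | apply continuity_pt_id].
  + apply (continuity_pt_comp (fun x => a - x) (fun t => rpow (Rabs t) p - p * (p - 1) / 2 * t ^ 2)); [| apply h0].
    apply continuity_pt_minus; [apply continuity_pt_const; now intros ? ? | apply continuity_pt_id].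
- rewrite Rmin_left, Rmax_right in hc by (unfold e; lra).
  rewrite Rplus_0_r, Rminus_0_r in hd.
  replace (a + e) with v in hd by (unfold a, e; field).
  replace (a - e) with u in hd by (unfold a, e; field).
  rewrite !Rabs_pos_eq in hd by (unfold a; lra).
  assert (ha : u <= a - c) by (unfold a, e in *; lra).
  assert (ha' : a + c <= v) by (unfold a, e in *; lra).
  enough (0 <= ((p * rpow (a + c) (p - 1) - p * (p - 1) * (a + c)) -
     (p * rpow (a - c) (p - 1) - p * (p - 1) * (a - c))) * (e - 0)) by lra.
  apply Rmult_le_pos; [| unfold e; lra].
  destruct (Req_dec (a - c) 0) as [h0 | hc0].
  + rewrite h0, rpow_0.
    destruct (Req_dec (a + c) 0) as [h1 | hc1]; [rewrite h1, rpow_0; lra |].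
    assert (h := rpow_minus_square_deriv p (a + c) (a + c) hp ltac:(lra) ltac:(lra)).
    nra.
  + assert (h := rpow_minus_square_deriv p (a - c) (a + c) hp ltac:(lra) ltac:(lra)).
    nra.
Qed.

(* The numbers [u, v, m, d] stand for [|a|, |b|, |a+b|/2, |a-b|/2], which are
   tied by the parallelogram law. *)
Lemma rpow_gap_ge2 (p u v m d : R) : 2 <= p -> 0 <= u -> 0 <= v -> 0 <= m ->
  m ^ 2 + d ^ 2 = (u ^ 2 + v ^ 2) / 2 ->
  rpow (/ 2) (p / 2 - 1) * rpow (Rmax u v) (p - 2) * d ^ 2 <=
  (rpow u p + rpow v p) / 2 - rpow m p.
Proof.
intros hp hu hv hm hpar.
(* By the parallelogram law S = m^2 + d^2. Since p/2 >= 1, (m^2/S)^(p/2) <= m^2/S, so m^p <= S^(p/2)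
   - S^(p/2-1) d^2. Convexity of x^(p/2) compares S^(p/2) with the average, and S >= max(u,v)^2 / 2
   produces the constant. *)
set (S := (u ^ 2 + v ^ 2) / 2).
assert (hS : 0 <= S) by (unfold S; nra).
assert (hsq : forall x, 0 <= x -> rpow x p = rpow (x ^ 2) (p / 2)).
{ intros x hx; rewrite <- rpow_2, rpow_comp by lra; f_equal; field. }
destruct hS as [hS | hS].
2: { assert (u = 0) by (unfold S in hS; nra); assert (v = 0) by (unfold S in hS; nra).
     assert (m = 0) by (unfold S in hS; nra); subst.
     rewrite Rmax_left, !rpow_0 by lra; lra. }
assert (h1 : rpow m p <= rpow S (p / 2) - rpow S (p / 2 - 1) * d ^ 2).
{ rewrite (hsq m hm).
  assert (hx : 0 <= m ^ 2 / S) by (apply Rmult_le_pos; [apply pow2_ge_0 | apply Rlt_le, Rinv_0_lt_compat, hS]).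
  assert (hx1 : m ^ 2 / S <= 1).
  { apply (Rmult_le_reg_r S); [lra |]; unfold Rdiv.
    rewrite Rmult_assoc, Rinv_l by lra; unfold S; nra. }
  replace (rpow (m ^ 2) (p / 2)) with (rpow S (p / 2) * rpow (m ^ 2 / S) (p / 2)).
  2: { rewrite <- rpow_mult by lra; f_equal; field; lra. }
  assert (hle : rpow (m ^ 2 / S) (p / 2) <= m ^ 2 / S).
  { destruct hx as [hx | <-]; [| rewrite rpow_0; lra].
    replace (p / 2) with (1 + (p / 2 - 1)) by ring.
    rewrite rpow_plus, rpow_1 by lra.
    rewrite <- (Rmult_1_r (m ^ 2 / S)) at 3; apply Rmult_le_compat_l; [lra |].
    destruct (Req_dec p 2) as [-> | hp2].
    - replace (2 / 2 - 1) with 0 by field; rewrite rpow_pos, Rmult_0_l, exp_0 by lra; lra.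
    - apply Rle_trans with (rpow 1 (p / 2 - 1)); [apply rpow_le; lra | rewrite rpow_one; lra]. }
  replace (rpow S (p / 2)) with (rpow S (p / 2 - 1) * S) at 1 2.
  2: { rewrite <- (rpow_1 S) at 2 by lra; rewrite <- rpow_plus by lra; f_equal; ring. }
  assert (h := rpow_ge0 S (p / 2 - 1)).
  apply Rle_trans with (rpow S (p / 2 - 1) * S * (m ^ 2 / S)).
  - apply Rmult_le_compat_l; [apply Rmult_le_pos; lra | exact hle].
  - right; replace (d ^ 2) with (S - m ^ 2) by (unfold S; lra); field; lra. }
assert (h2 : rpow S (p / 2) <= (rpow u p + rpow v p) / 2).
{ rewrite (hsq u hu), (hsq v hv); unfold S; apply rpow_midpoint; [lra | apply pow2_ge_0 | apply pow2_ge_0]. }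
assert (h3 : rpow (/ 2) (p / 2 - 1) * rpow (Rmax u v) (p - 2) <= rpow S (p / 2 - 1)).
{ set (W := Rmax u v).
  assert (hW : 0 <= W) by (apply Rle_trans with u; [lra | apply Rmax_l]).
  replace (rpow W (p - 2)) with (rpow (W ^ 2) (p / 2 - 1)).
  2: { rewrite <- rpow_2, rpow_comp by lra; f_equal; field. }
  rewrite <- rpow_mult by (try apply pow2_ge_0; lra).
  destruct (Req_dec p 2) as [-> | hp2].
  - replace (2 / 2 - 1) with 0 by field.
    assert (hW0 : 0 < / 2 * W ^ 2).
    { unfold S in hS; assert (0 < W); [| nra].
      destruct (Req_dec u 0); [apply Rlt_le_trans with v; [nra | apply Rmax_r] | apply Rlt_le_trans with u; [lra | apply Rmax_l]]. }
    rewrite !rpow_pos, !Rmult_0_l by lra; lra.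
  - apply rpow_le; [lra |]; split; [assert (h := pow2_ge_0 W); lra |].
    unfold S, W; apply Rmax_case;
      assert (hu2 := pow2_ge_0 u); assert (hv2 := pow2_ge_0 v); lra. }
assert (h4 := Rmult_le_compat_r (d ^ 2) _ _ (pow2_ge_0 d) h3); lra.
Qed.

(** The function t^p - p (p-1)/2 t^2 increases from m to (u+v)/2 and is midpoint convex; the
    parallelogram law turns the leftover quadratic terms into d^2. *)
Lemma rpow_gap_lt2_unit (p u v m d : R) : 1 < p < 2 -> 0 <= u <= 1 -> 0 <= v <= 1 ->
  0 <= m -> m <= (u + v) / 2 -> m ^ 2 + d ^ 2 = (u ^ 2 + v ^ 2) / 2 ->
  p * (p - 1) / 2 * d ^ 2 <= (rpow u p + rpow v p) / 2 - rpow m p.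
Proof.
intros hp hu hv hm hmu hpar.
assert (h1 := rpow_minus_square_incr p m ((u + v) / 2) hp ltac:(lra) ltac:(lra)).
assert (h2 : rpow ((u + v) / 2) p - p * (p - 1) / 2 * ((u + v) / 2) ^ 2 <=
  (rpow u p - p * (p - 1) / 2 * u ^ 2 + (rpow v p - p * (p - 1) / 2 * v ^ 2)) / 2).
{ destruct (Rle_or_lt u v).
  - apply rpow_minus_square_midpoint; lra.
  - rewrite (Rplus_comm u v), (Rplus_comm (rpow u p - _)); apply rpow_minus_square_midpoint; lra. }
replace (d ^ 2) with ((u ^ 2 + v ^ 2) / 2 - m ^ 2) by lra.
nra.
Qed.

(** Both sides are homogeneous of degree p, so division by the larger of u and v reduces to the unit
    interval. When that maximum is 0 the weight is 0 by convention. *)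
Lemma rpow_gap_lt2 (p u v m d : R) : 1 < p < 2 -> 0 <= u -> 0 <= v ->
  0 <= m -> m <= (u + v) / 2 -> m ^ 2 + d ^ 2 = (u ^ 2 + v ^ 2) / 2 ->
  p * (p - 1) / 2 * rpow (Rmax u v) (p - 2) * d ^ 2 <=
  (rpow u p + rpow v p) / 2 - rpow m p.
Proof.
intros hp hu hv hm hmu hpar.
set (W := Rmax u v).
assert (hW : 0 <= W) by (apply Rle_trans with u; [lra | apply Rmax_l]).
assert (huW : u <= W) by apply Rmax_l.
assert (hvW : v <= W) by apply Rmax_r.
destruct hW as [hW | hW].
2: { assert (u = 0) by lra; assert (v = 0) by lra; assert (m = 0) by lra.
     subst u v m; rewrite <- hW, !rpow_0; lra. }
assert (hi := Rinv_0_lt_compat W hW).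
assert (hle : forall x, x <= W -> x / W <= 1).
{ intros x hx; apply (Rmult_le_reg_r W); [lra |]; unfold Rdiv; rewrite Rmult_assoc, Rinv_l; lra. }
assert (hge : forall x, 0 <= x -> 0 <= x / W) by (intros; apply Rmult_le_pos; lra).
assert (h := rpow_gap_lt2_unit p (u / W) (v / W) (m / W) (d / W) hp
  (conj (hge u hu) (hle u huW)) (conj (hge v hv) (hle v hvW)) (hge m hm)).
assert (hs : forall x, 0 <= x -> rpow x p = rpow W p * rpow (x / W) p).
{ intros x hx; rewrite <- rpow_mult by (try apply hge; lra); f_equal; field; lra. }
rewrite (hs u hu), (hs v hv), (hs m hm).
replace (rpow W (p - 2) * d ^ 2) with (rpow W p * (d / W) ^ 2).
2: { replace (rpow W p) with (rpow W (p - 2 + 2)) by (f_equal; ring).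
     rewrite rpow_plus, rpow_2 by lra; field; lra. }
rewrite Rmult_assoc.
replace (rpow W (p - 2) * d ^ 2) with (rpow W p * (d / W) ^ 2).
2: { replace (rpow W p) with (rpow W (p - 2 + 2)) by (f_equal; ring).
     rewrite rpow_plus, rpow_2 by lra; field; lra. }
assert (hh : p * (p - 1) / 2 * (d / W) ^ 2 <= (rpow (u / W) p + rpow (v / W) p) / 2 - rpow (m / W) p).
{ apply h.
  - replace ((u / W + v / W) / 2) with ((u + v) / 2 / W) by (field; lra).
    apply Rmult_le_compat_r; lra.
  - replace ((m / W) ^ 2 + (d / W) ^ 2) with ((m ^ 2 + d ^ 2) * (/ W) ^ 2) by (field; lra).
    rewrite hpar; field; lra. }
assert (hh' := Rmult_le_compat_l (rpow W p) _ _ (rpow_ge0 W p) hh); lra.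
Qed.

(** The second derivative of |.|^p has size |.|^(p-2), which is the weight here: growing with
    max(u,v) for p > 2, decreasing for p < 2. One form serves both ranges. *)
Lemma rpow_gap (p : R) : 1 < p -> exists c, 0 < c /\
  forall u v m d, 0 <= u -> 0 <= v -> 0 <= m -> m <= (u + v) / 2 ->
    m ^ 2 + d ^ 2 = (u ^ 2 + v ^ 2) / 2 ->
    c * rpow (Rmax u v) (p - 2) * d ^ 2 <= (rpow u p + rpow v p) / 2 - rpow m p.
Proof.
intros hp; destruct (Rle_or_lt 2 p) as [h | h].
- exists (rpow (/ 2) (p / 2 - 1)); split; [apply rpow_gt0; lra |].
  intros; now apply rpow_gap_ge2.
- exists (p * (p - 1) / 2); split; [nra |].
  intros; apply rpow_gap_lt2; lra.
Qed.

(** * Complex numbers, continuity and differentiability *)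

Definition Cone : Cx := (1, 0).
Definition Cinv (z : Cx) : Cx :=
  (fst z / (fst z ^ 2 + snd z ^ 2), - snd z / (fst z ^ 2 + snd z ^ 2)).

Lemma Cx_ring_theory : ring_theory C0 Cone Cadd Cmul Csub Copp eq.
Proof.
constructor; intros; unfold C0, Cone, Csub, Cadd, Cmul, Copp;
  try destruct x; try destruct y; try destruct z; simpl; try reflexivity; f_equal; ring.
Qed.

Lemma Cmod_nonzero (z : Cx) : z <> C0 -> 0 < fst z ^ 2 + snd z ^ 2.
Proof.
intros h; assert (h1 := pow2_ge_0 (fst z)); assert (h2 := pow2_ge_0 (snd z)).
destruct (Rle_lt_or_eq_dec 0 (fst z ^ 2 + snd z ^ 2) ltac:(lra)) as [h3 | h3]; trivial.
elim h; destruct z as [x y]; simpl in *; unfold C0; f_equal; nra.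
Qed.

Lemma Cx_field_theory :
  field_theory C0 Cone Cadd Cmul Csub Copp (fun z w => Cmul z (Cinv w)) Cinv eq.
Proof.
constructor; try reflexivity.
- exact Cx_ring_theory.
- intros h; injection h; lra.
- intros z hz; assert (h := Cmod_nonzero z hz); destruct z as [x y]; simpl in *.
  unfold Cmul, Cone, Cinv; simpl; f_equal; field; lra.
Qed.

Add Field Cx_field : Cx_field_theory.

Lemma Cmod_ge0 (z : Cx) : 0 <= Cmod z.
Proof. exact (Complex.Cmod_ge_0 z). Qed.

Lemma Cmod_tri (z w : Cx) : Cmod (Cadd z w) <= Cmod z + Cmod w.
Proof. exact (Complex.Cmod_triangle z w). Qed.

Lemma Cmod_mul (z w : Cx) : Cmod (Cmul z w) = Cmod z * Cmod w.
Proof. exact (Complex.Cmod_mult z w). Qed.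

Lemma Cmod_opp (z : Cx) : Cmod (Copp z) = Cmod z.
Proof. exact (Complex.Cmod_opp z). Qed.

Lemma Cmod_inv (z : Cx) : z <> C0 -> Cmod (Cinv z) = / Cmod z.
Proof. exact (Complex.Cmod_inv z). Qed.

Lemma Cmod_C0 : Cmod C0 = 0.
Proof. exact Complex.Cmod_0. Qed.

Lemma Cmod_eq0 (z : Cx) : Cmod z = 0 -> z = C0.
Proof. exact (Complex.Cmod_eq_0 z). Qed.

Lemma Cmod_gt0 (z : Cx) : z <> C0 -> 0 < Cmod z.
Proof.
intros h; destruct (Cmod_ge0 z) as [h1 | h1]; trivial.
elim h; now apply Cmod_eq0.
Qed.

Lemma Cmod_sq (z : Cx) : Cmod z ^ 2 = fst z ^ 2 + snd z ^ 2.
Proof.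
unfold Cmod; rewrite pow2_sqrt; trivial.
assert (h1 := pow2_ge_0 (fst z)); assert (h2 := pow2_ge_0 (snd z)); lra.
Qed.

Lemma Cmod_conj (z : Cx) : Cmod (Cconj z) = Cmod z.
Proof. unfold Cmod, Cconj; simpl; f_equal; ring. Qed.

Lemma Cmod_real (x : R) : Cmod (x, 0) = Rabs x.
Proof. exact (Complex.Cmod_R x). Qed.

Lemma Cre_le (z : Cx) : Rabs (fst z) <= Cmod z.
Proof.
apply Rsqr_incr_0_var; [| apply Cmod_ge0].
rewrite <- Rsqr_abs; unfold Rsqr.
assert (h := Cmod_sq z); assert (h2 := pow2_ge_0 (snd z)); lra.
Qed.

Lemma Cim_le (z : Cx) : Rabs (snd z) <= Cmod z.
Proof.
apply Rsqr_incr_0_var; [| apply Cmod_ge0].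
rewrite <- Rsqr_abs; unfold Rsqr.
assert (h := Cmod_sq z); assert (h2 := pow2_ge_0 (fst z)); lra.
Qed.

Lemma Cmod_le_abs (z : Cx) : Cmod z <= Rabs (fst z) + Rabs (snd z).
Proof.
assert (h1 := Rabs_pos (fst z)); assert (h2 := Rabs_pos (snd z)).
apply Rsqr_incr_0_var; [| lra].
unfold Rsqr; assert (h := Cmod_sq z).
rewrite <- (pow2_abs (fst z)), <- (pow2_abs (snd z)) in h; nra.
Qed.

Lemma Cmod_pt (r t : R) : Cmod (pt r t) = Rabs r.
Proof.
unfold Cmod, pt; simpl fst; simpl snd.
replace ((r * cos t) ^ 2 + (r * sin t) ^ 2) with (Rsqr r * (Rsqr (sin t) + Rsqr (cos t)))
  by (unfold Rsqr; ring).
rewrite sin2_cos2, Rmult_1_r; apply sqrt_Rsqr_abs.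
Qed.

Lemma Cmod_sub_sym (z w : Cx) : Cmod (Csub z w) = Cmod (Csub w z).
Proof. rewrite <- Cmod_opp; f_equal; ring. Qed.

Lemma Cmod_tri_sub (z w : Cx) : Cmod z <= Cmod w + Cmod (Csub z w).
Proof.
replace z with (Cadd w (Csub z w)) at 1 by ring; apply Cmod_tri.
Qed.

Lemma Cmod_sub_abs (z w : Cx) : Rabs (Cmod z - Cmod w) <= Cmod (Csub z w).
Proof.
assert (h1 := Cmod_tri_sub z w); assert (h2 := Cmod_tri_sub w z).
rewrite (Cmod_sub_sym w z) in h2; apply Rabs_le; lra.
Qed.

Lemma Cmod_sub_le (z w : Cx) : Cmod (Csub z w) <= Cmod z + Cmod w.
Proof. rewrite <- (Cmod_opp w); apply Cmod_tri. Qed.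

Lemma Cx_eta (z : Cx) : (fst z, snd z) = z.
Proof. now destruct z. Qed.

Lemma pt_mul (r s a b : R) : Cmul (pt r a) (pt s b) = pt (r * s) (a + b).
Proof.
unfold Cmul, pt; simpl; rewrite cos_plus, sin_plus; f_equal; ring.
Qed.

Lemma pt_conj (r t : R) : Cconj (pt r t) = pt r (- t).
Proof. unfold Cconj, pt; simpl; rewrite cos_neg, sin_neg; f_equal; ring. Qed.

Lemma pt_period (r t : R) : pt r (t + 2 * PI) = pt r t.
Proof.
unfold pt; rewrite cos_plus, sin_plus, cos_2PI, sin_2PI; f_equal; ring.
Qed.

Lemma pt_scal (r s t : R) : Cmul (s, 0) (pt r t) = pt (s * r) t.
Proof. unfold Cmul, pt; simpl; f_equal; ring. Qed.

Lemma Cmod_scal (s : R) (z : Cx) : Cmod (Cmul (s, 0) z) = Rabs s * Cmod z.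
Proof. now rewrite Cmod_mul, Cmod_real. Qed.

Lemma Cconj_mul (z w : Cx) : Cconj (Cmul z w) = Cmul (Cconj z) (Cconj w).
Proof. unfold Cconj, Cmul; simpl; f_equal; ring. Qed.

Lemma Cconj_add (z w : Cx) : Cconj (Cadd z w) = Cadd (Cconj z) (Cconj w).
Proof. unfold Cconj, Cadd; simpl; f_equal; ring. Qed.

Lemma Cconj_sub (z w : Cx) : Cconj (Csub z w) = Csub (Cconj z) (Cconj w).
Proof. unfold Cconj, Csub, Cadd, Copp; simpl; f_equal; ring. Qed.

Lemma Cconj_conj (z : Cx) : Cconj (Cconj z) = z.
Proof. destruct z; unfold Cconj; simpl; f_equal; ring. Qed.

Lemma trig_lipschitz (a b : R) : Rabs (cos a - cos b) <= Rabs (a - b) /\ Rabs (sin a - sin b) <= Rabs (a - b).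
Proof.
split.
- destruct (MVT_gen cos b a (fun x => - sin x)) as [c [_ h]].
  + intros; auto_derive; trivial; ring.
  + intros; apply continuity_cos.
  + rewrite h, Rabs_mult, Rabs_Ropp.
    rewrite <- (Rmult_1_l (Rabs (a - b))) at 2; apply Rmult_le_compat_r; [apply Rabs_pos |].
    apply Rabs_le, SIN_bound.
- destruct (MVT_gen sin b a cos) as [c [_ h]].
  + intros; auto_derive; trivial; ring.
  + intros; apply continuity_sin.
  + rewrite h, Rabs_mult.
    rewrite <- (Rmult_1_l (Rabs (a - b))) at 2; apply Rmult_le_compat_r; [apply Rabs_pos |].
    apply Rabs_le, COS_bound.
Qed.

Lemma pt_lipschitz (r s a b : R) :
  Cmod (Csub (pt r a) (pt s b)) <= 2 * Rabs (r - s) + 2 * Rabs s * Rabs (a - b).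
Proof.
apply Rle_trans with (1 := Cmod_le_abs _); unfold pt, Csub, Cadd, Copp; simpl.
destruct (trig_lipschitz a b) as [h1 h2].
replace (r * cos a + - (s * cos b)) with ((r - s) * cos a + s * (cos a - cos b)) by ring.
replace (r * sin a + - (s * sin b)) with ((r - s) * sin a + s * (sin a - sin b)) by ring.
assert (hc : Rabs (cos a) <= 1) by apply Rabs_le, COS_bound.
assert (hs : Rabs (sin a) <= 1) by apply Rabs_le, SIN_bound.
assert (t1 := Rabs_triang ((r - s) * cos a) (s * (cos a - cos b))).
assert (t2 := Rabs_triang ((r - s) * sin a) (s * (sin a - sin b))).
rewrite !Rabs_mult in t1, t2.
assert (u1 := Rmult_le_compat_l _ _ _ (Rabs_pos (r - s)) hc).
assert (u2 := Rmult_le_compat_l _ _ _ (Rabs_pos (r - s)) hs).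
assert (u3 := Rmult_le_compat_l _ _ _ (Rabs_pos s) h1).
assert (u4 := Rmult_le_compat_l _ _ _ (Rabs_pos s) h2).
lra.
Qed.

(** * Continuity on the plane *)

Definition rcont (g : Cx -> R) (z : Cx) : Prop :=
  forall eps, 0 < eps -> exists d, 0 < d /\
    forall w, Cmod (Csub w z) < d -> Rabs (g w - g z) < eps.

Definition ccont (f : Cx -> Cx) (z : Cx) : Prop :=
  rcont (fun w => fst (f w)) z /\ rcont (fun w => snd (f w)) z.

Lemma rcont_const (c : R) (z : Cx) : rcont (fun _ => c) z.
Proof.
intros eps heps; exists 1; split; [lra |]; intros; rewrite Rminus_diag, Rabs_R0; lra.
Qed.

Lemma rcont_comp (h : R -> R) (g : Cx -> R) (z : Cx) :
  rcont g z -> continuity_pt h (g z) -> rcont (fun w => h (g w)) z.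
Proof.
intros hg hh eps heps.
destruct (hh eps heps) as [d [hd H]].
destruct (hg d hd) as [e [he G]].
exists e; split; trivial; intros w hw.
destruct (Req_dec (g z) (g w)) as [-> | hne].
- rewrite Rminus_diag, Rabs_R0; lra.
- apply (H (g w)); split; [split; trivial; exact I |]; now apply G.
Qed.

Lemma rcont_plus (f g : Cx -> R) (z : Cx) :
  rcont f z -> rcont g z -> rcont (fun w => f w + g w) z.
Proof.
intros hf hg eps heps.
destruct (hf (eps / 2) ltac:(lra)) as [d [hd H]].
destruct (hg (eps / 2) ltac:(lra)) as [e [he G]].
exists (Rmin d e); split; [now apply Rmin_pos |]; intros w hw.
assert (h1 := H w (Rlt_le_trans _ _ _ hw (Rmin_l _ _))).
assert (h2 := G w (Rlt_le_trans _ _ _ hw (Rmin_r _ _))).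
replace (f w + g w - (f z + g z)) with ((f w - f z) + (g w - g z)) by ring.
assert (h3 := Rabs_triang (f w - f z) (g w - g z)); lra.
Qed.

Lemma rcont_scal (c : R) (g : Cx -> R) (z : Cx) : rcont g z -> rcont (fun w => c * g w) z.
Proof.
intros hg; apply (rcont_comp (fun x => c * x)); trivial.
apply continuity_pt_scal, continuity_pt_id.
Qed.

Lemma rcont_opp (g : Cx -> R) (z : Cx) : rcont g z -> rcont (fun w => - g w) z.
Proof.
intros hg; apply (rcont_comp (fun x => - x)); trivial.
apply continuity_pt_opp, continuity_pt_id.
Qed.

Lemma rcont_minus (f g : Cx -> R) (z : Cx) :
  rcont f z -> rcont g z -> rcont (fun w => f w - g w) z.
Proof. intros; apply rcont_plus, rcont_opp; trivial. Qed.

Lemma rcont_square (g : Cx -> R) (z : Cx) : rcont g z -> rcont (fun w => g w ^ 2) z.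
Proof.
intros hg; apply (rcont_comp (fun x => x ^ 2)); trivial.
apply derivable_continuous_pt, derivable_pt_pow.
Qed.

Lemma rcont_ext (f g : Cx -> R) (z : Cx) : (forall w, f w = g w) -> rcont f z -> rcont g z.
Proof. intros h hf eps heps; destruct (hf eps heps) as [d [hd H]]; exists d; split; trivial; intros w hw; rewrite <- !h; auto. Qed.

Lemma rcont_mult (f g : Cx -> R) (z : Cx) :
  rcont f z -> rcont g z -> rcont (fun w => f w * g w) z.
Proof.
intros hf hg.
(* Polarization: a product is a difference of squares, and squares are compositions with a function
   of one real variable. *)
apply rcont_ext with (fun w => / 4 * ((f w + g w) ^ 2 - (f w - g w) ^ 2)); [intros; field |].
apply rcont_scal, rcont_minus; apply rcont_square; [apply rcont_plus | apply rcont_minus]; trivial.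
Qed.

Lemma rcont_inv (g : Cx -> R) (z : Cx) : rcont g z -> g z <> 0 -> rcont (fun w => / g w) z.
Proof.
intros hg h; apply (rcont_comp Rinv); trivial.
apply (continuity_pt_inv (fun x => x)); [apply continuity_pt_id | trivial].
Qed.

Lemma ccont_iff (f : Cx -> Cx) (z : Cx) :
  ccont f z <-> (forall eps, 0 < eps -> exists d, 0 < d /\
    forall w, Cmod (Csub w z) < d -> Cmod (Csub (f w) (f z)) < eps).
Proof.
split.
- intros [h1 h2] eps heps.
  destruct (h1 (eps / 2) ltac:(lra)) as [d [hd H]].
  destruct (h2 (eps / 2) ltac:(lra)) as [e [he G]].
  exists (Rmin d e); split; [now apply Rmin_pos |]; intros w hw.
  assert (k1 := H w (Rlt_le_trans _ _ _ hw (Rmin_l _ _))).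
  assert (k2 := G w (Rlt_le_trans _ _ _ hw (Rmin_r _ _))).
  assert (k3 := Cmod_le_abs (Csub (f w) (f z))); unfold Csub, Cadd, Copp in *; simpl in *.
  unfold Rminus in *; lra.
- intros h; split; intros eps heps; destruct (h eps heps) as [d [hd H]];
    exists d; split; trivial; intros w hw; assert (k := H w hw).
  + assert (k1 := Cre_le (Csub (f w) (f z))); unfold Csub, Cadd, Copp in *; simpl in *; unfold Rminus; lra.
  + assert (k1 := Cim_le (Csub (f w) (f z))); unfold Csub, Cadd, Copp in *; simpl in *; unfold Rminus; lra.
Qed.

Lemma ccont_const (c z : Cx) : ccont (fun _ => c) z.
Proof. split; apply rcont_const. Qed.

Lemma ccont_id (z : Cx) : ccont (fun w => w) z.
Proof. apply ccont_iff; intros eps heps; exists eps; split; trivial. Qed.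

Lemma ccont_add (f g : Cx -> Cx) (z : Cx) :
  ccont f z -> ccont g z -> ccont (fun w => Cadd (f w) (g w)) z.
Proof. intros [h1 h2] [h3 h4]; split; simpl; now apply rcont_plus. Qed.

Lemma ccont_opp (f : Cx -> Cx) (z : Cx) : ccont f z -> ccont (fun w => Copp (f w)) z.
Proof. intros [h1 h2]; split; simpl; now apply rcont_opp. Qed.

Lemma ccont_sub (f g : Cx -> Cx) (z : Cx) :
  ccont f z -> ccont g z -> ccont (fun w => Csub (f w) (g w)) z.
Proof. intros; apply ccont_add, ccont_opp; trivial. Qed.

Lemma ccont_mul (f g : Cx -> Cx) (z : Cx) :
  ccont f z -> ccont g z -> ccont (fun w => Cmul (f w) (g w)) z.
Proof.
intros [h1 h2] [h3 h4]; split; simpl;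
  [apply rcont_minus | apply rcont_plus]; now apply rcont_mult.
Qed.

Lemma ccont_conj (f : Cx -> Cx) (z : Cx) : ccont f z -> ccont (fun w => Cconj (f w)) z.
Proof. intros [h1 h2]; split; simpl; [exact h1 | now apply rcont_opp]. Qed.

Lemma ccont_inv (f : Cx -> Cx) (z : Cx) :
  ccont f z -> f z <> C0 -> ccont (fun w => Cinv (f w)) z.
Proof.
intros [h1 h2] h; apply Cmod_nonzero in h.
assert (h3 : rcont (fun w => / (fst (f w) ^ 2 + snd (f w) ^ 2)) z).
{ apply rcont_inv; [apply rcont_plus; now apply rcont_square | lra]. }
split; simpl; apply rcont_mult; trivial; now apply rcont_opp.
Qed.

Lemma ccont_comp (f g : Cx -> Cx) (z : Cx) :
  ccont g z -> ccont f (g z) -> ccont (fun w => f (g w)) z.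
Proof.
rewrite !ccont_iff; intros hg hf eps heps.
destruct (hf eps heps) as [d [hd H]]; destruct (hg d hd) as [e [he G]].
exists e; split; auto.
Qed.

Lemma rcont_ccomp (f : Cx -> R) (g : Cx -> Cx) (z : Cx) :
  ccont g z -> rcont f (g z) -> rcont (fun w => f (g w)) z.
Proof.
rewrite !ccont_iff; intros hg hf eps heps.
destruct (hf eps heps) as [d [hd H]]; destruct (hg d hd) as [e [he G]].
exists e; split; auto.
Qed.

Lemma rcont_mod (f : Cx -> Cx) (z : Cx) : ccont f z -> rcont (fun w => Cmod (f w)) z.
Proof.
rewrite ccont_iff; intros h eps heps; destruct (h eps heps) as [d [hd H]].
exists d; split; trivial; intros w hw.
apply Rle_lt_trans with (1 := Cmod_sub_abs _ _); auto.
Qed.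

Lemma rcont_mod_rpow (p : R) (f : Cx -> Cx) (z : Cx) :
  0 < p -> ccont f z -> rcont (fun w => rpow (Cmod (f w)) p) z.
Proof.
intros hp h.
apply rcont_ext with (fun w => rpow (Rabs (Cmod (f w))) p).
- intros w; now rewrite Rabs_pos_eq by apply Cmod_ge0.
- apply (rcont_comp (fun x => rpow (Rabs x) p)); [now apply rcont_mod | now apply rpow_abs_continuity].
Qed.

Lemma rcont_polar (g : Cx -> R) (r t : R) :
  rcont g (pt r t) -> continuity_2d_pt (fun r t => g (pt r t)) r t.
Proof.
intros h eps; destruct (h eps (cond_pos eps)) as [d [hd H]].
assert (hr := Rabs_pos r).
assert (he : 0 < d / (4 + 4 * Rabs r)) by (apply Rdiv_lt_0_compat; lra).
exists (mkposreal _ he); intros u v hu hv; simpl in *; apply H.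
apply Rle_lt_trans with (1 := pt_lipschitz _ _ _ _).
apply Rle_lt_trans with (2 * (d / (4 + 4 * Rabs r)) + 2 * Rabs r * (d / (4 + 4 * Rabs r))).
- apply Rplus_le_compat; [lra |]; apply Rmult_le_compat_l; lra.
- replace (2 * (d / (4 + 4 * Rabs r)) + 2 * Rabs r * (d / (4 + 4 * Rabs r))) with (d / 2) by (field; lra); lra.
Qed.

Lemma rcont_polar_angle (g : Cx -> R) (r t : R) :
  rcont g (pt r t) -> continuous (fun t => g (pt r t)) t.
Proof.
intros h; apply continuity_pt_filterlim; intros eps heps.
destruct (rcont_polar g r t h (mkposreal eps heps)) as [d H]; simpl in H.
exists d; split; [apply cond_pos |]; intros x [_ hx]; apply H; trivial.
rewrite Rminus_diag, Rabs_R0; apply cond_pos.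
Qed.

Lemma rcont_polar_radius (g : Cx -> R) (r t : R) :
  rcont g (pt r t) -> continuous (fun r => g (pt r t)) r.
Proof.
intros h; apply continuity_pt_filterlim; intros eps heps.
destruct (rcont_polar g r t h (mkposreal eps heps)) as [d H]; simpl in H.
exists d; split; [apply cond_pos |]; intros x [_ hx]; apply H; trivial.
rewrite Rminus_diag, Rabs_R0; apply cond_pos.
Qed.

(* Complex differentiability in Caratheodory's form: [q] is the difference
   quotient, so that the rules of calculus reduce to continuity. *)
Definition cdiff (f : Cx -> Cx) (z : Cx) : Prop :=
  exists q d, 0 < d /\ ccont q z /\
    forall w, Cmod (Csub w z) < d -> f w = Cadd (f z) (Cmul (q w) (Csub w z)).

Lemma Csub_diag (z : Cx) : Csub z z = C0.
Proof. ring. Qed.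

Lemma cdiff_ccont (f : Cx -> Cx) (z : Cx) : cdiff f z -> ccont f z.
Proof.
intros [q [d [hd [hq H]]]].
assert (h : ccont (fun w => Cadd (f z) (Cmul (q w) (Csub w z))) z).
{ apply ccont_add; [apply ccont_const |].
  apply ccont_mul; trivial; apply ccont_sub; [apply ccont_id | apply ccont_const]. }
rewrite ccont_iff in *; intros eps heps; destruct (h eps heps) as [e [he G]].
exists (Rmin d e); split; [now apply Rmin_pos |]; intros w hw.
rewrite (H w (Rlt_le_trans _ _ _ hw (Rmin_l _ _))).
assert (k := G w (Rlt_le_trans _ _ _ hw (Rmin_r _ _))); simpl in k.
now replace (Cadd (f z) (Cmul (q z) (Csub z z))) with (f z) in k by ring.
Qed.

Lemma cdiff_const (c z : Cx) : cdiff (fun _ => c) z.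
Proof.
exists (fun _ => C0), 1; split; [lra |]; split; [apply ccont_const | intros; ring].
Qed.

Lemma cdiff_id (z : Cx) : cdiff (fun w => w) z.
Proof.
exists (fun _ => Cone), 1; split; [lra |]; split; [apply ccont_const | intros; ring].
Qed.

Lemma cdiff_add (f g : Cx -> Cx) (z : Cx) :
  cdiff f z -> cdiff g z -> cdiff (fun w => Cadd (f w) (g w)) z.
Proof.
intros [q [d [hd [hq H]]]] [q' [e [he [hq' G]]]].
exists (fun w => Cadd (q w) (q' w)), (Rmin d e); split; [now apply Rmin_pos |].
split; [now apply ccont_add |]; intros w hw.
rewrite (H w (Rlt_le_trans _ _ _ hw (Rmin_l _ _))), (G w (Rlt_le_trans _ _ _ hw (Rmin_r _ _))); ring.
Qed.

Lemma cdiff_mul (f g : Cx -> Cx) (z : Cx) :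
  cdiff f z -> cdiff g z -> cdiff (fun w => Cmul (f w) (g w)) z.
Proof.
intros hf hg; assert (hc := cdiff_ccont _ _ hg); revert hf hg.
intros [q [d [hd [hq H]]]] [q' [e [he [hq' G]]]].
exists (fun w => Cadd (Cmul (q w) (g w)) (Cmul (f z) (q' w))), (Rmin d e); split; [now apply Rmin_pos |].
split.
- apply ccont_add; apply ccont_mul; trivial; apply ccont_const.
- intros w hw.
  rewrite (H w (Rlt_le_trans _ _ _ hw (Rmin_l _ _))), (G w (Rlt_le_trans _ _ _ hw (Rmin_r _ _))); ring.
Qed.

Lemma cdiff_opp (f : Cx -> Cx) (z : Cx) : cdiff f z -> cdiff (fun w => Copp (f w)) z.
Proof.
intros [q [d [hd [hq H]]]]; exists (fun w => Copp (q w)), d; split; trivial; split.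
- now apply ccont_opp.
- intros w hw; rewrite (H w hw); ring.
Qed.

Lemma cdiff_sub (f g : Cx -> Cx) (z : Cx) :
  cdiff f z -> cdiff g z -> cdiff (fun w => Csub (f w) (g w)) z.
Proof. intros; apply cdiff_add, cdiff_opp; trivial. Qed.

Lemma cdiff_comp (f g : Cx -> Cx) (z : Cx) :
  cdiff g z -> cdiff f (g z) -> cdiff (fun w => f (g w)) z.
Proof.
intros hg hf; assert (hc := cdiff_ccont _ _ hg); revert hg hf.
intros [q [d [hd [hq H]]]] [q' [e [he [hq' G]]]].
destruct (proj1 (ccont_iff _ _) hc e he) as [e' [he' K]].
exists (fun w => Cmul (q' (g w)) (q w)), (Rmin d e'); split; [now apply Rmin_pos |].
split.
- apply ccont_mul; trivial; now apply ccont_comp.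
- intros w hw.
  rewrite (G (g w) (K w (Rlt_le_trans _ _ _ hw (Rmin_r _ _)))).
  rewrite (H w (Rlt_le_trans _ _ _ hw (Rmin_l _ _))) at 2; ring.
Qed.

Lemma Cinv_cdiff (z : Cx) : z <> C0 -> cdiff Cinv z.
Proof.
intros hz; assert (hm := Cmod_gt0 z hz).
exists (fun w => Copp (Cinv (Cmul w z))), (Cmod z); split; trivial; split.
- apply ccont_opp, ccont_inv.
  + apply ccont_mul; [apply ccont_id | apply ccont_const].
  + intros h; apply (f_equal Cmod) in h; rewrite Cmod_mul, Cmod_C0 in h; nra.
- intros w hw; field; split; trivial.
  intros ->; rewrite Cmod_sub_sym in hw; replace (Csub z C0) with z in hw by ring; lra.
Qed.

Lemma cdiff_inv (f : Cx -> Cx) (z : Cx) :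
  cdiff f z -> f z <> C0 -> cdiff (fun w => Cinv (f w)) z.
Proof. intros; apply (cdiff_comp Cinv); trivial; now apply Cinv_cdiff. Qed.

(** Kernels enter conjugated: conj k(w) is not holomorphic, but its reflection conj k(conj w) is. *)
Lemma cdiff_reflect (f : Cx -> Cx) (z : Cx) :
  cdiff f (Cconj z) -> cdiff (fun w => Cconj (f (Cconj w))) z.
Proof.
intros [q [d [hd [hq H]]]]; exists (fun w => Cconj (q (Cconj w))), d; split; trivial; split.
- apply ccont_conj, (ccont_comp q Cconj); trivial; apply ccont_conj, ccont_id.
- intros w hw; rewrite (H (Cconj w)).
  + rewrite Cconj_add, Cconj_mul, Cconj_sub, !Cconj_conj; reflexivity.
  + rewrite <- Cconj_sub, Cmod_conj; trivial.
Qed.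

Lemma cdiff_ext_loc (f g : Cx -> Cx) (z : Cx) (e : R) : 0 < e ->
  (forall w, Cmod (Csub w z) < e -> f w = g w) -> cdiff f z -> cdiff g z.
Proof.
intros he h [q [d [hd [hq H]]]]; exists q, (Rmin d e).
split; [now apply Rmin_pos |]; split; trivial; intros w hw.
rewrite <- !h; [apply H, (Rlt_le_trans _ _ _ hw (Rmin_l _ _)) | | apply (Rlt_le_trans _ _ _ hw (Rmin_r _ _))].
now rewrite Csub_diag, Cmod_C0.
Qed.

Definition quotient (f : Cx -> Cx) (a L w : Cx) : Cx :=
  if excluded_middle_informative (w = a) then L
  else Cmul (Csub (f w) (f a)) (Cinv (Csub w a)).

Lemma quotient_ne (f : Cx -> Cx) (a L w : Cx) : w <> a ->
  quotient f a L w = Cmul (Csub (f w) (f a)) (Cinv (Csub w a)).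
Proof. intros h; unfold quotient; now destruct excluded_middle_informative. Qed.

Lemma Csub_ne (z w : Cx) : z <> w -> Csub z w <> C0.
Proof.
intros h h'; apply h; replace z with (Cadd w (Csub z w)) by ring; rewrite h'; ring.
Qed.

Lemma quotient_mul (f : Cx -> Cx) (a L w : Cx) :
  Cmul (quotient f a L w) (Csub w a) = Csub (f w) (f a).
Proof.
unfold quotient; destruct excluded_middle_informative as [-> | h]; [ring |].
field; now apply Csub_ne.
Qed.

Lemma cdiff_quotient (f : Cx -> Cx) (a : Cx) : cdiff f a -> exists L, ccont (quotient f a L) a.
Proof.
intros [q [d [hd [hq H]]]]; exists (q a).
rewrite ccont_iff in *; intros eps heps; destruct (hq eps heps) as [e [he G]].
exists (Rmin d e); split; [now apply Rmin_pos |]; intros w hw.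
replace (quotient f a (q a) w) with (q w).
- replace (quotient f a (q a) a) with (q a); [apply G, (Rlt_le_trans _ _ _ hw (Rmin_r _ _)) |].
  unfold quotient; now destruct excluded_middle_informative.
- unfold quotient; destruct excluded_middle_informative as [-> | h]; trivial.
  rewrite (H w (Rlt_le_trans _ _ _ hw (Rmin_l _ _))); field; now apply Csub_ne.
Qed.

Lemma cdiff_quotient_off (f : Cx -> Cx) (a L z : Cx) :
  z <> a -> cdiff f z -> cdiff (quotient f a L) z.
Proof.
intros hz hf.
apply cdiff_ext_loc with (fun w => Cmul (Csub (f w) (f a)) (Cinv (Csub w a))) (Cmod (Csub z a)).
- now apply Cmod_gt0, Csub_ne.
- intros w hw; rewrite quotient_ne; trivial.
  intros ->; rewrite Cmod_sub_sym in hw; lra.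
- apply cdiff_mul; [apply cdiff_sub; [trivial | apply cdiff_const] |].
  apply cdiff_inv; [apply cdiff_sub; [apply cdiff_id | apply cdiff_const] | now apply Csub_ne].
Qed.

Lemma cdiff_linear_approx (f : Cx -> Cx) (z : Cx) : cdiff f z -> exists L, forall eps, 0 < eps ->
  exists d, 0 < d /\ forall w, Cmod (Csub w z) < d ->
    Cmod (Csub (Csub (f w) (f z)) (Cmul L (Csub w z))) <= eps * Cmod (Csub w z).
Proof.
intros [q [d [hd [hq H]]]]; exists (q z); intros eps heps.
rewrite ccont_iff in hq; destruct (hq eps heps) as [e [he G]].
exists (Rmin d e); split; [now apply Rmin_pos |]; intros w hw.
rewrite (H w (Rlt_le_trans _ _ _ hw (Rmin_l _ _))).
replace (Csub (Csub (Cadd (f z) (Cmul (q w) (Csub w z))) (f z)) (Cmul (q z) (Csub w z)))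
  with (Cmul (Csub (q w) (q z)) (Csub w z)) by ring.
rewrite Cmod_mul; apply Rmult_le_compat_r; [apply Cmod_ge0 |].
apply Rlt_le, G, (Rlt_le_trans _ _ _ hw (Rmin_r _ _)).
Qed.

Lemma holo_cdiff (f : Cx -> Cx) : holo f <-> (forall z, Cmod z < 1 -> cdiff f z).
Proof.
split.
- intros h z hz; destruct (h z hz) as [L H].
  exists (quotient f z L), 1; split; [lra |]; split.
  + apply ccont_iff; intros eps heps.
    destruct (H (eps / 2) ltac:(lra)) as [d [hd G]].
    exists (Rmin d (1 - Cmod z)); split; [apply Rmin_pos; lra |]; intros w hw.
    assert (hz' : quotient f z L z = L) by (unfold quotient; now destruct excluded_middle_informative).
    rewrite hz'.
    destruct (excluded_middle_informative (w = z)) as [-> | hne].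
    * rewrite hz', Csub_diag, Cmod_C0; trivial.
    * assert (hp := Cmod_gt0 _ (Csub_ne _ _ hne)).
      assert (G' := G (Csub w z)); replace (Cadd z (Csub w z)) with w in G' by ring.
      assert (hw1 := Rlt_le_trans _ _ _ hw (Rmin_l _ _)).
      assert (hw2 := Rlt_le_trans _ _ _ hw (Rmin_r _ _)).
      assert (hw3 := Cmod_tri_sub w z).
      specialize (G' ltac:(lra) ltac:(lra)).
      rewrite <- (quotient_mul f z L w) in G'.
      replace (Csub (Cmul (quotient f z L w) (Csub w z)) (Cmul L (Csub w z))) with
        (Cmul (Csub (quotient f z L w) L) (Csub w z)) in G' by ring.
      rewrite Cmod_mul in G'; apply Rmult_le_reg_r in G'; lra.
  + intros w _; rewrite quotient_mul; ring.
- intros h z hz; destruct (cdiff_linear_approx f z (h z hz)) as [L H].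
  exists L; intros eps heps; destruct (H eps heps) as [d [hd G]]; exists d; split; trivial.
  intros k hk _; assert (G' := G (Cadd z k)).
  replace (Csub (Cadd z k) z) with k in G' by ring; apply G'; lra.
Qed.

(** * Goursat's theorem on polar rectangles *)

Lemma ex_RInt_cont (f : R -> R) (a b : R) : a <= b ->
  (forall x, a <= x <= b -> continuous f x) -> ex_RInt f a b.
Proof.
intros hab h; apply (ex_RInt_continuous (V := R_CompleteNormedModule)).
rewrite Rmin_left, Rmax_right by lra; exact h.
Qed.

Lemma RInt_add (f g : R -> R) (a b : R) : ex_RInt f a b -> ex_RInt g a b ->
  RInt (fun x => f x + g x) a b = RInt f a b + RInt g a b.
Proof. exact (RInt_plus (V := R_CompleteNormedModule) f g a b). Qed.

Lemma RInt_sub (f g : R -> R) (a b : R) : ex_RInt f a b -> ex_RInt g a b ->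
  RInt (fun x => f x - g x) a b = RInt f a b - RInt g a b.
Proof. exact (RInt_minus (V := R_CompleteNormedModule) f g a b). Qed.

Lemma RInt_cmul (f : R -> R) (c a b : R) : ex_RInt f a b ->
  RInt (fun x => c * f x) a b = c * RInt f a b.
Proof. exact (RInt_scal (V := R_CompleteNormedModule) f a b c). Qed.

Lemma RInt_cst (a b c : R) : RInt (fun _ => c) a b = (b - a) * c.
Proof. exact (RInt_const (V := R_CompleteNormedModule) a b c). Qed.

Lemma ex_RInt_add (f g : R -> R) (a b : R) : ex_RInt f a b -> ex_RInt g a b ->
  ex_RInt (fun x => f x + g x) a b.
Proof. exact (ex_RInt_plus (V := R_CompleteNormedModule) f g a b). Qed.

Lemma ex_RInt_sub (f g : R -> R) (a b : R) : ex_RInt f a b -> ex_RInt g a b ->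
  ex_RInt (fun x => f x - g x) a b.
Proof. exact (ex_RInt_minus (V := R_CompleteNormedModule) f g a b). Qed.

Lemma RInt_split (f : R -> R) (a b c : R) : ex_RInt f a b -> ex_RInt f b c ->
  RInt f a c = RInt f a b + RInt f b c.
Proof. intros h1 h2; symmetry; exact (RInt_Chasles f a b c h1 h2). Qed.

Lemma RInt_near (f g : R -> R) (a b M : R) : a <= b ->
  ex_RInt f a b -> ex_RInt g a b -> (forall x, a <= x <= b -> Rabs (f x - g x) <= M) ->
  Rabs (RInt f a b - RInt g a b) <= (b - a) * M.
Proof.
intros hab hf hg h; rewrite <- RInt_sub by trivial.
apply abs_RInt_le_const; trivial; now apply ex_RInt_sub.
Qed.

(* The real part of the integral of [G(w) dw/w = G (dr/r + i dt)] along the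
   boundary of the polar rectangle [a <= r <= b, c <= t <= d]. *)
Definition polar_loop (G : Cx -> Cx) (a b c d : R) : R :=
  RInt (fun r => (fst (G (pt r c)) - fst (G (pt r d))) / r) a b
  - RInt (fun t => snd (G (pt b t)) - snd (G (pt a t))) c d.

Lemma continuous_inv_id (x : R) : 0 < x -> continuous (fun r => / r) x.
Proof.
intros hx; apply continuity_pt_filterlim.
apply (continuity_pt_inv (fun x => x)); [apply continuity_pt_id | lra].
Qed.

Lemma continuous_sub (f g : R -> R) (x : R) :
  continuous f x -> continuous g x -> continuous (fun t => f t - g t) x.
Proof. exact (continuous_minus (V := R_NormedModule) f g x). Qed.

Lemma continuous_mul (f g : R -> R) (x : R) :
  continuous f x -> continuous g x -> continuous (fun t => f t * g t) x.
Proof. exact (continuous_mult (K := R_AbsRing) f g x). Qed.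

Section Goursat.
Variables (G : Cx -> Cx) (a0 b0 c0 d0 : R).
Hypothesis ha0 : 0 < a0.
Hypothesis hG : forall r t, a0 <= r <= b0 -> c0 <= t <= d0 -> cdiff G (pt r t).

Let hGc (r t : R) : a0 <= r <= b0 -> c0 <= t <= d0 -> ccont G (pt r t).
Proof. intros; now apply cdiff_ccont, hG. Qed.

Lemma radial_ex_RInt (c d a b : R) : a0 <= a <= b -> b <= b0 -> c0 <= c <= d0 -> c0 <= d <= d0 ->
  ex_RInt (fun r => (fst (G (pt r c)) - fst (G (pt r d))) / r) a b.
Proof.
intros; apply ex_RInt_cont; [lra |]; intros x hx.
apply continuous_mul; [| apply continuous_inv_id; lra].
apply continuous_sub.
- apply (rcont_polar_radius (fun w => fst (G w)) x c), hGc; lra.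
- apply (rcont_polar_radius (fun w => fst (G w)) x d), hGc; lra.
Qed.

Lemma angular_ex_RInt (a b c d : R) : a0 <= a <= b0 -> a0 <= b <= b0 -> c0 <= c <= d -> d <= d0 ->
  ex_RInt (fun t => snd (G (pt b t)) - snd (G (pt a t))) c d.
Proof.
intros; apply ex_RInt_cont; [lra |]; intros x hx.
apply continuous_sub.
- apply (rcont_polar_angle (fun w => snd (G w)) b x), hGc; lra.
- apply (rcont_polar_angle (fun w => snd (G w)) a x), hGc; lra.
Qed.

Lemma polar_loop_split_radius (a m b c d : R) :
  a0 <= a <= m -> m <= b <= b0 -> c0 <= c <= d -> d <= d0 ->
  polar_loop G a b c d = polar_loop G a m c d + polar_loop G m b c d.
Proof.
intros; unfold polar_loop.
rewrite (RInt_split _ a m b) by (apply radial_ex_RInt; lra).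
rewrite (RInt_ext (fun t => snd (G (pt b t)) - snd (G (pt a t)))
  (fun t => (snd (G (pt m t)) - snd (G (pt a t))) + (snd (G (pt b t)) - snd (G (pt m t))))).
- rewrite RInt_add by (apply angular_ex_RInt; lra); ring.
- intros; simpl; ring.
Qed.

Lemma polar_loop_split_angle (a b c n d : R) :
  a0 <= a <= b -> b <= b0 -> c0 <= c <= n -> n <= d <= d0 ->
  polar_loop G a b c d = polar_loop G a b c n + polar_loop G a b n d.
Proof.
intros; unfold polar_loop.
rewrite (RInt_split _ c n d) by (apply angular_ex_RInt; lra).
rewrite (RInt_ext (fun r => (fst (G (pt r c)) - fst (G (pt r d))) / r)
  (fun r => (fst (G (pt r c)) - fst (G (pt r n))) / r + (fst (G (pt r n)) - fst (G (pt r d))) / r)).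
- rewrite RInt_add by (apply radial_ex_RInt; lra); ring.
- intros; simpl; unfold Rdiv; ring.
Qed.

(** The affine part of G contributes the same number (b - a) k to the radial and to the angular
    integral, by exact integration, and cancels. What remains is the approximation error times the
    length of the boundary. *)
Lemma polar_loop_small (a b c d x y eps : R) (L : Cx) :
  a0 <= a <= b -> b <= b0 -> c0 <= c <= d -> d <= d0 -> a <= x <= b -> c <= y <= d -> 0 < eps ->
  (forall r t, a <= r <= b -> c <= t <= d ->
    Cmod (Csub (Csub (G (pt r t)) (G (pt x y))) (Cmul L (Csub (pt r t) (pt x y))))
      <= eps * Cmod (Csub (pt r t) (pt x y))) ->
  Rabs (polar_loop G a b c d) <=
    eps * (2 * (b - a) + 2 * b0 * (d - c)) * (2 * (b - a) / a0 + 2 * (d - c)).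
Proof.
intros hab hb hcd hd hx hy heps hlin.
set (s := eps * (2 * (b - a) + 2 * b0 * (d - c))).
set (e := fun r t => Csub (Csub (G (pt r t)) (G (pt x y))) (Cmul L (Csub (pt r t) (pt x y)))).
assert (he : forall r t, a <= r <= b -> c <= t <= d -> Cmod (e r t) <= s).
{ intros r t hr ht; apply Rle_trans with (1 := hlin r t hr ht).
  apply Rmult_le_compat_l; [lra |].
  apply Rle_trans with (1 := pt_lipschitz r x t y).
  assert (h1 : Rabs (r - x) <= b - a) by (apply Rabs_le; lra).
  assert (h2 : Rabs (t - y) <= d - c) by (apply Rabs_le; lra).
  rewrite (Rabs_pos_eq x) by lra.
  assert (h3 : x * Rabs (t - y) <= b0 * (d - c)).
  { apply Rmult_le_compat; try lra; apply Rabs_pos. }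
  lra. }
assert (hG1 : forall r t, fst (G (pt r t)) = fst (G (pt x y)) + (fst L * (r * cos t - x * cos y) - snd L * (r * sin t - x * sin y)) + fst (e r t)).
{ intros; unfold e, Csub, Cadd, Cmul, Copp, pt; simpl; ring. }
assert (hG2 : forall r t, snd (G (pt r t)) = snd (G (pt x y)) + (fst L * (r * sin t - x * sin y) + snd L * (r * cos t - x * cos y)) + snd (e r t)).
{ intros; unfold e, Csub, Cadd, Cmul, Copp, pt; simpl; ring. }
set (k := fst L * (cos c - cos d) - snd L * (sin c - sin d)).
assert (h1 : Rabs (RInt (fun r => (fst (G (pt r c)) - fst (G (pt r d))) / r) a b - RInt (fun _ => k) a b)
   <= (b - a) * (2 * s / a0)).
{ apply RInt_near; [lra | apply radial_ex_RInt; lra | apply ex_RInt_const |].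
  intros r hr; rewrite (hG1 r c), (hG1 r d).
  replace (_ / r - k) with ((fst (e r c) - fst (e r d)) / r) by (unfold k; field; lra).
  assert (k1 := Rle_trans _ _ _ (Cre_le (e r c)) (he r c hr ltac:(lra))).
  assert (k2 := Rle_trans _ _ _ (Cre_le (e r d)) (he r d hr ltac:(lra))).
  unfold Rdiv; rewrite Rabs_mult, (Rabs_pos_eq (/ r)) by (apply Rlt_le, Rinv_0_lt_compat; lra).
  apply Rmult_le_compat; [apply Rabs_pos | apply Rlt_le, Rinv_0_lt_compat; lra | | apply Rinv_le_contravar; lra].
  unfold Rminus; apply Rle_trans with (1 := Rabs_triang _ _); rewrite Rabs_Ropp; lra. }
rewrite RInt_cst in h1.
assert (hder : is_RInt (fun t => (b - a) * (fst L * sin t + snd L * cos t)) c d ((b - a) * k)).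
{ assert (h0 := is_RInt_derive (V := R_CompleteNormedModule)
    (fun t => (b - a) * (snd L * sin t - fst L * cos t)) (fun t => (b - a) * (fst L * sin t + snd L * cos t)) c d).
  replace ((b - a) * k) with (minus ((b - a) * (snd L * sin d - fst L * cos d)) ((b - a) * (snd L * sin c - fst L * cos c)))
    by (unfold minus, plus, opp, k; simpl; ring).
  apply h0.
  - intros; auto_derive; trivial; ring.
  - intros; apply continuity_pt_filterlim; apply continuity_pt_scal, continuity_pt_plus;
      apply continuity_pt_scal; [apply continuity_sin | apply continuity_cos]. }
assert (h2 : Rabs (RInt (fun t => snd (G (pt b t)) - snd (G (pt a t))) c d -
    RInt (fun t => (b - a) * (fst L * sin t + snd L * cos t)) c d) <= (d - c) * (2 * s)).
{ apply RInt_near; [lra | apply angular_ex_RInt; lra | eexists; exact hder |].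
  intros t ht; rewrite (hG2 b t), (hG2 a t).
  replace (_ - _) with (snd (e b t) - snd (e a t)) by ring.
  assert (k1 := Rle_trans _ _ _ (Cim_le (e b t)) (he b t ltac:(lra) ht)).
  assert (k2 := Rle_trans _ _ _ (Cim_le (e a t)) (he a t ltac:(lra) ht)).
  unfold Rminus; apply Rle_trans with (1 := Rabs_triang _ _); rewrite Rabs_Ropp; lra. }
rewrite (is_RInt_unique _ _ _ _ hder) in h2.
unfold polar_loop.
replace (_ - _) with
  ((RInt (fun r => (fst (G (pt r c)) - fst (G (pt r d))) / r) a b - (b - a) * k) -
   (RInt (fun t => snd (G (pt b t)) - snd (G (pt a t))) c d - (b - a) * k)) by ring.
apply Rle_trans with ((b - a) * (2 * s / a0) + (d - c) * (2 * s)).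
- unfold Rminus; apply Rle_trans with (1 := Rabs_triang _ _); rewrite Rabs_Ropp.
  unfold Rminus in h1, h2; lra.
- right; field; lra.
Qed.

Let al (n : nat) := (b0 - a0) / 2 ^ n.
Let be (n : nat) := (d0 - c0) / 2 ^ n.

(** The corner [s] stands for a dyadic subrectangle of depth n, with sides [al n] and [be n].
    Bisection keeps at least a quarter of the loop integral, whence the power of 4. *)
Let bad (eta : R) (n : nat) (s : R * R) : Prop :=
  a0 <= fst s /\ fst s + al n <= b0 /\ c0 <= snd s /\ snd s + be n <= d0 /\
  eta / 4 ^ n <= Rabs (polar_loop G (fst s) (fst s + al n) (snd s) (snd s + be n)).

Let inside (n : nat) (s s' : R * R) : Prop :=
  fst s <= fst s' /\ fst s' + al (S n) <= fst s + al n /\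
  snd s <= snd s' /\ snd s' + be (S n) <= snd s + be n.

(** The loop is the sum of the loops of the four quarters, so by the triangle inequality one of them
    carries at least a quarter of the modulus. *)
Lemma goursat_step (eta : R) (n : nat) (s : R * R) : a0 <= b0 -> c0 <= d0 ->
  bad eta n s -> exists s', bad eta (S n) s' /\ inside n s s'.
Proof.
intros hab hcd [h1 [h2 [h3 [h4 h5]]]]; destruct s as [x y]; simpl fst in *; simpl snd in *.
assert (h2n : 0 < 2 ^ n) by (apply pow_lt; lra).
assert (h4n : 0 < 4 ^ n) by (apply pow_lt; lra).
assert (ha : al n = al (S n) + al (S n)) by (unfold al; simpl; field; lra).
assert (hb : be n = be (S n) + be (S n)) by (unfold be; simpl; field; lra).
assert (ha1 : 0 <= al (S n)).
{ unfold al; apply Rmult_le_pos; [lra | apply Rlt_le, Rinv_0_lt_compat; simpl; lra]. }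
assert (hb1 : 0 <= be (S n)).
{ unfold be; apply Rmult_le_pos; [lra | apply Rlt_le, Rinv_0_lt_compat; simpl; lra]. }
set (a := al (S n)) in *; set (b := be (S n)) in *.
assert (he : eta / 4 ^ S n = eta / 4 ^ n / 4) by (simpl; field; lra).
rewrite (polar_loop_split_radius x (x + a) (x + al n)) in h5 by lra.
rewrite (polar_loop_split_angle x (x + a) y (y + b) (y + be n)) in h5 by lra.
rewrite (polar_loop_split_angle (x + a) (x + al n) y (y + b) (y + be n)) in h5 by lra.
replace (x + al n) with (x + a + a) in h5 by lra.
replace (y + be n) with (y + b + b) in h5 by lra.
assert (t1 := Rabs_triang (polar_loop G x (x + a) y (y + b)) (polar_loop G x (x + a) (y + b) (y + b + b))).
assert (t2 := Rabs_triang (polar_loop G (x + a) (x + a + a) y (y + b)) (polar_loop G (x + a) (x + a + a) (y + b) (y + b + b))).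
assert (t3 := Rabs_triang (polar_loop G x (x + a) y (y + b) + polar_loop G x (x + a) (y + b) (y + b + b))
  (polar_loop G (x + a) (x + a + a) y (y + b) + polar_loop G (x + a) (x + a + a) (y + b) (y + b + b))).
unfold bad, inside; rewrite he; fold a b; simpl fst; simpl snd.
destruct (Rle_or_lt (eta / 4 ^ n / 4) (Rabs (polar_loop G x (x + a) y (y + b)))) as [k1 | k1];
  [exists (x, y); simpl; repeat split; lra |].
destruct (Rle_or_lt (eta / 4 ^ n / 4) (Rabs (polar_loop G x (x + a) (y + b) (y + b + b)))) as [k2 | k2];
  [exists (x, y + b); simpl; repeat split; lra |].
destruct (Rle_or_lt (eta / 4 ^ n / 4) (Rabs (polar_loop G (x + a) (x + a + a) y (y + b)))) as [k3 | k3];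
  [exists (x + a, y); simpl; repeat split; lra |].
exists (x + a, y + b); simpl; repeat split; lra.
Qed.

Lemma nested_point (x l : nat -> R) :
  (forall n, x n <= x (S n)) -> (forall n, x (S n) + l (S n) <= x n + l n) -> (forall n, 0 <= l n) ->
  exists X, forall n, x n <= X <= x n + l n.
Proof.
intros h1 h2 h3.
assert (hm : forall n k, x n <= x (n + k)%nat /\ x (n + k)%nat + l (n + k)%nat <= x n + l n).
{ intros n; induction k; [rewrite Nat.add_0_r; lra |].
  rewrite Nat.add_succ_r; specialize (h1 (n + k)%nat); specialize (h2 (n + k)%nat); lra. }
destruct (completeness (fun y => exists n, y = x n)) as [X [hX1 hX2]].
- exists (x O + l O); intros y [n ->]; destruct (hm O n); specialize (h3 n); simpl in *; lra.
- exists (x O); now exists O.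
- exists X; intros n; split; [apply hX1; now exists n |].
  apply hX2; intros y [m ->].
  destruct (Nat.le_ge_cases n m) as [h | h].
  + destruct (hm n (m - n)%nat) as [_ k]; replace (n + (m - n))%nat with m in k by lia.
    specialize (h3 m); lra.
  + destruct (hm m (n - m)%nat) as [k _]; replace (m + (n - m))%nat with n in k by lia.
    specialize (h3 n); lra.
Qed.

(** A nonzero loop would leave nested rectangles with loops at least eta / 4^n. At their common
    point the linear approximation makes these loops o(4^-n). *)
Lemma polar_goursat : a0 <= b0 -> c0 <= d0 -> polar_loop G a0 b0 c0 d0 = 0.
Proof.
intros hab hcd.
destruct (Req_dec (polar_loop G a0 b0 c0 d0) 0) as [h0 | h0]; trivial; exfalso.
set (eta := Rabs (polar_loop G a0 b0 c0 d0)).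
assert (heta : 0 < eta) by now apply Rabs_pos_lt.
set (next := fun n s => epsilon (inhabits s) (fun s' => bad eta (S n) s' /\ inside n s s')).
set (sq := nat_rect (fun _ => (R * R)%type) (a0, c0) (fun n s => next n s)).
assert (hbad : forall n, bad eta n (sq n)).
{ induction n.
  - unfold bad, al, be; simpl; unfold Rdiv; rewrite Rinv_1, !Rmult_1_r.
    repeat split; try lra.
    replace (a0 + (b0 - a0)) with b0 by ring; replace (c0 + (d0 - c0)) with d0 by ring.
    unfold eta; lra.
  - apply (epsilon_spec (inhabits (sq n)) (fun s' => bad eta (S n) s' /\ inside n (sq n) s')).
    now apply goursat_step. }
assert (hin : forall n, inside n (sq n) (sq (S n))).
{ intros n; apply (epsilon_spec (inhabits (sq n)) (fun s' => bad eta (S n) s' /\ inside n (sq n) s')).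
  now apply goursat_step. }
assert (h2n : forall n, 0 < 2 ^ n) by (intros; apply pow_lt; lra).
assert (hal : forall n, 0 <= al n).
{ intros n; unfold al; apply Rmult_le_pos; [lra | apply Rlt_le, Rinv_0_lt_compat, h2n]. }
assert (hbe : forall n, 0 <= be n).
{ intros n; unfold be; apply Rmult_le_pos; [lra | apply Rlt_le, Rinv_0_lt_compat, h2n]. }
destruct (nested_point (fun n => fst (sq n)) al) as [X hX]; trivial; try (intros n; apply (hin n)).
destruct (nested_point (fun n => snd (sq n)) be) as [Y hY]; trivial; try (intros n; apply (hin n)).
assert (hX0 := hX O); assert (hY0 := hY O); unfold al, be in hX0, hY0; simpl in hX0, hY0.
unfold Rdiv in hX0, hY0; rewrite Rinv_1, Rmult_1_r in hX0, hY0.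
destruct (cdiff_linear_approx G (pt X Y)) as [L hL]; [apply hG; lra |].
(* The factor multiplying eps in [polar_loop_small] for the full rectangle. At depth n both of its
   brackets shrink by 2^n, so the bound becomes eps K / 4^n. *)
set (K := (2 * (b0 - a0) + 2 * b0 * (d0 - c0)) * (2 * (b0 - a0) / a0 + 2 * (d0 - c0))).
assert (hK : 0 <= K).
{ unfold K; apply Rmult_le_pos.
  - assert (0 <= b0 * (d0 - c0)) by (apply Rmult_le_pos; lra); lra.
  - assert (0 <= 2 * (b0 - a0) / a0) by (apply Rmult_le_pos; [lra | apply Rlt_le, Rinv_0_lt_compat; lra]); lra. }
(* With this accuracy the loop at depth n is strictly below eta / 4^n. *)
destruct (hL (eta / (2 * (K + 1)))) as [d [hd hD]]; [apply Rdiv_lt_0_compat; lra |].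
assert (hs : 0 <= 2 * (b0 - a0) + 2 * b0 * (d0 - c0)).
{ assert (0 <= b0 * (d0 - c0)) by (apply Rmult_le_pos; lra); lra. }
destruct (pow_lt_1_zero (/ 2) ltac:(rewrite Rabs_pos_eq; lra) (d / (2 * (b0 - a0) + 2 * b0 * (d0 - c0) + 1))
  ltac:(apply Rdiv_lt_0_compat; lra)) as [n hn].
specialize (hn n (le_n n)); rewrite Rabs_pos_eq in hn by (apply pow_le; lra).
destruct (hbad n) as [k1 [k2 [k3 [k4 k5]]]].
specialize (hX n); specialize (hY n); specialize (hal n); specialize (hbe n).
set (x := fst (sq n)) in *; set (y := snd (sq n)) in *.
assert (hsm : 2 * al n + 2 * b0 * be n < d).
{ replace (2 * al n + 2 * b0 * be n) with ((/ 2) ^ n * (2 * (b0 - a0) + 2 * b0 * (d0 - c0))).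
  2: { unfold al, be; rewrite pow_inv; field; apply Rgt_not_eq, h2n. }
  apply Rle_lt_trans with ((/ 2) ^ n * (2 * (b0 - a0) + 2 * b0 * (d0 - c0) + 1)).
  - apply Rmult_le_compat_l; [apply pow_le |]; lra.
  - apply (Rmult_lt_compat_r (2 * (b0 - a0) + 2 * b0 * (d0 - c0) + 1)) in hn; [| lra].
    replace (d / (2 * (b0 - a0) + 2 * b0 * (d0 - c0) + 1) * (2 * (b0 - a0) + 2 * b0 * (d0 - c0) + 1))
      with d in hn by (field; lra); lra. }
assert (hfin := polar_loop_small x (x + al n) y (y + be n) X Y (eta / (2 * (K + 1))) L
  ltac:(lra) k2 ltac:(lra) k4 hX hY ltac:(apply Rdiv_lt_0_compat; lra)).
assert (hfin' : Rabs (polar_loop G x (x + al n) y (y + be n)) <= eta / (2 * (K + 1)) * K / 4 ^ n).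
{ apply Rle_trans with (1 := hfin ltac:(
    intros r t hr ht; apply hD; apply Rle_lt_trans with (1 := pt_lipschitz r X t Y);
    apply Rle_lt_trans with (2 := hsm); rewrite (Rabs_pos_eq X) by lra;
    assert (Rabs (r - X) <= al n) by (apply Rabs_le; lra);
    assert (X * Rabs (t - Y) <= b0 * be n)
      by (apply Rmult_le_compat; try lra; [apply Rabs_pos | apply Rabs_le; lra]); lra)).
  right; replace (4 ^ n) with (2 ^ n * 2 ^ n) by (rewrite <- Rpow_mult_distr; f_equal; ring).
  assert (h2 := h2n n); generalize (eta / (2 * (K + 1))); intros u; unfold K, al, be.
  replace (x + (b0 - a0) / 2 ^ n - x) with ((b0 - a0) / 2 ^ n) by ring.
  replace (y + (d0 - c0) / 2 ^ n - y) with ((d0 - c0) / 2 ^ n) by ring.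
  field; lra. }
assert (h4n : 0 < 4 ^ n) by (apply pow_lt; lra).
assert (hlt : eta / (2 * (K + 1)) * K < eta).
{ apply (Rmult_lt_reg_r (2 * (K + 1))); [lra |].
  replace (eta / (2 * (K + 1)) * K * (2 * (K + 1))) with (eta * K) by (field; lra).
  nra. }
apply (Rmult_lt_compat_r (/ 4 ^ n)) in hlt; [| now apply Rinv_0_lt_compat].
unfold Rdiv in *; lra.
Qed.
End Goursat.

(** * Circle means of holomorphic functions do not depend on the radius *)

Definition mean (g : Cx -> R) (r : R) : R := / (2 * PI) * RInt (fun t => g (pt r t)) 0 (2 * PI).

Lemma two_PI_pos : 0 < 2 * PI.
Proof. assert (h := PI_RGT_0); lra. Qed.

Lemma circle_ex_RInt (g : Cx -> R) (r a b : R) : a <= b ->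
  (forall t, rcont g (pt r t)) -> ex_RInt (fun t => g (pt r t)) a b.
Proof. intros hab h; apply ex_RInt_cont; trivial; intros; apply rcont_polar_angle, h. Qed.

(** Goursat on the annulus cut along a ray: by periodicity the two radial edges cancel, and the two
    circles remain. Because the form is G dw/w, no power of the radius appears. *)
Lemma mean_snd_const (G : Cx -> Cx) (a b : R) : 0 < a <= b ->
  (forall r t, a <= r <= b -> cdiff G (pt r t)) ->
  mean (fun w => snd (G w)) a = mean (fun w => snd (G w)) b.
Proof.
intros hab hG.
assert (h := polar_goursat G a b 0 (2 * PI) ltac:(lra) ltac:(intros; apply hG; trivial) ltac:(lra)
  (Rlt_le _ _ two_PI_pos)).
unfold polar_loop in h.
assert (hc : forall r, a <= r <= b -> ex_RInt (fun t => snd (G (pt r t))) 0 (2 * PI)).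
{ intros r hr; apply (circle_ex_RInt (fun w => snd (G w))); [apply Rlt_le, two_PI_pos |].
  intros t; apply cdiff_ccont; now apply hG. }
rewrite (RInt_ext (fun r => (fst (G (pt r 0)) - fst (G (pt r (2 * PI)))) / r) (fun _ => 0)) in h.
- rewrite RInt_cst, RInt_sub in h by (apply hc; lra).
  unfold mean; f_equal; lra.
- intros; simpl; replace (2 * PI) with (0 + 2 * PI) by ring; rewrite pt_period; unfold Rdiv; ring.
Qed.

Lemma mean_fst_const (G : Cx -> Cx) (a b : R) : 0 < a <= b ->
  (forall r t, a <= r <= b -> cdiff G (pt r t)) ->
  mean (fun w => fst (G w)) a = mean (fun w => fst (G w)) b.
Proof.
intros hab hG.
assert (h := mean_snd_const (fun w => Cmul (0, 1) (G w)) a b hab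
  ltac:(intros; apply cdiff_mul; [apply cdiff_const | now apply hG])).
assert (hext : forall w, snd (Cmul (0, 1) (G w)) = fst (G w)) by (intros; simpl; ring).
unfold mean in *; rewrite (RInt_ext (fun t => fst (G (pt a t))) (fun t => snd (Cmul (0, 1) (G (pt a t))))).
- rewrite h; f_equal; apply RInt_ext; intros; apply hext.
- intros; symmetry; apply hext.
Qed.

(** * Circle means and Cauchy's formula *)

(* Coquelicot types equations between integrals in the carrier of a normed module,
   where [ring] finds no ring structure. *)
Ltac eq_in_R := match goal with |- @eq _ ?a ?b => change (@eq R a b) end.

Definition circ (g : Cx -> R) (r : R) : Prop := forall t, rcont g (pt r t).

Lemma mean_ext (f g : Cx -> R) (r : R) : (forall t, f (pt r t) = g (pt r t)) -> mean f r = mean g r.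
Proof. intros h; unfold mean; f_equal; apply RInt_ext; intros; apply h. Qed.

Lemma circ_ex_RInt (g : Cx -> R) (r : R) : circ g r -> ex_RInt (fun t => g (pt r t)) 0 (2 * PI).
Proof. intros h; apply circle_ex_RInt; [apply Rlt_le, two_PI_pos | exact h]. Qed.

Lemma mean_add (f g : Cx -> R) (r : R) : circ f r -> circ g r ->
  mean (fun w => f w + g w) r = mean f r + mean g r.
Proof.
intros hf hg; unfold mean; rewrite RInt_add by (now apply circ_ex_RInt); ring.
Qed.

Lemma mean_sub (f g : Cx -> R) (r : R) : circ f r -> circ g r ->
  mean (fun w => f w - g w) r = mean f r - mean g r.
Proof.
intros hf hg; unfold mean; rewrite RInt_sub by (now apply circ_ex_RInt); ring.
Qed.

Lemma mean_cmul (c : R) (g : Cx -> R) (r : R) : circ g r ->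
  mean (fun w => c * g w) r = c * mean g r.
Proof.
intros hg; unfold mean; rewrite (RInt_cmul (fun t => g (pt r t))) by (now apply circ_ex_RInt); ring.
Qed.

Lemma mean_const (c r : R) : mean (fun _ => c) r = c.
Proof. unfold mean; rewrite RInt_cst; assert (h := two_PI_pos); field; lra. Qed.

Lemma mean_le (f g : Cx -> R) (r : R) : circ f r -> circ g r ->
  (forall t, f (pt r t) <= g (pt r t)) -> mean f r <= mean g r.
Proof.
intros hf hg h; unfold mean; assert (hp := two_PI_pos).
apply Rmult_le_compat_l; [apply Rlt_le, Rinv_0_lt_compat, hp |].
apply RInt_le; [lra | now apply circ_ex_RInt | now apply circ_ex_RInt | intros; apply h].
Qed.

Lemma circ_const (c r : R) : circ (fun _ => c) r.
Proof. intros t; apply rcont_const. Qed.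

Lemma circ_add (f g : Cx -> R) (r : R) : circ f r -> circ g r -> circ (fun w => f w + g w) r.
Proof. intros hf hg t; now apply rcont_plus. Qed.

Lemma circ_cmul (c : R) (g : Cx -> R) (r : R) : circ g r -> circ (fun w => c * g w) r.
Proof. intros hg t; now apply rcont_scal. Qed.

Lemma circ_mult (f g : Cx -> R) (r : R) : circ f r -> circ g r -> circ (fun w => f w * g w) r.
Proof. intros hf hg t; now apply rcont_mult. Qed.

Lemma mean_ge0 (g : Cx -> R) (r : R) : circ g r -> (forall t, 0 <= g (pt r t)) -> 0 <= mean g r.
Proof.
intros hg h; rewrite <- (mean_const 0 r); apply mean_le; trivial; apply circ_const.
Qed.

Lemma mean_rot (g : Cx -> R) (r th : R) : circ g r ->
  mean (fun w => g (Cmul (pt 1 th) w)) r = mean g r.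
Proof.
intros hg; unfold mean; f_equal.
set (h := fun t => g (pt r t)).
assert (hi : forall a b, ex_RInt h a b).
{ intros a b; apply (ex_RInt_continuous (V := R_CompleteNormedModule)).
  intros x _; apply rcont_polar_angle, hg. }
assert (hs : forall v a b, RInt (fun t => h (t + v)) a b = RInt h (a + v) (b + v)).
{ intros v a b.
  assert (k := RInt_comp_lin (V := R_CompleteNormedModule) h 1 v a b (hi _ _)).
  rewrite !Rmult_1_l in k; rewrite <- k; apply RInt_ext; intros x _.
  unfold scal; simpl; unfold mult; simpl; now rewrite !Rmult_1_l. }
rewrite (RInt_ext _ (fun t => h (t + th))).
- rewrite hs.
  rewrite (RInt_split h (0 + th) (2 * PI) (2 * PI + th)), (RInt_split h 0 (0 + th) (2 * PI)) by apply hi.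
  assert (k : RInt h (2 * PI) (2 * PI + th) = RInt h 0 (0 + th)).
  { replace (2 * PI) with (0 + 2 * PI) at 1 by ring; rewrite (Rplus_comm (2 * PI) th).
    rewrite <- hs, Rplus_0_l; apply RInt_ext; intros x _; unfold h; now rewrite pt_period. }
  rewrite k; eq_in_R; ring.
- intros x _; unfold h; rewrite pt_mul; f_equal; f_equal; ring.
Qed.

Lemma RInt_param_continuity (f : R -> R -> R) (c d x0 e : R) : c <= d -> 0 < e ->
  (forall x y, Rabs (x - x0) < e -> c <= y <= d -> continuity_2d_pt f x y) ->
  continuity_pt (fun x => RInt (f x) c d) x0.
Proof.
intros hcd he hf eps heps.
assert (heps' : 0 < eps / (2 * (d - c + 1))) by (apply Rdiv_lt_0_compat; lra).
destruct (uniform_continuity_2d_1d' f c d x0) with (eps := mkposreal _ heps') as [dl hdl].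
{ intros y hy; apply hf; trivial; rewrite Rminus_diag, Rabs_R0; trivial. }
assert (hex : forall x, Rabs (x - x0) < e -> ex_RInt (f x) c d).
{ intros x hx; apply ex_RInt_cont; trivial; intros y hy; apply continuity_pt_filterlim; intros e1 he1.
  destruct (hf x y hx hy (mkposreal e1 he1)) as [d1 hd1]; simpl in hd1.
  exists d1; split; [apply cond_pos |]; intros z [_ hz]; apply hd1; trivial.
  rewrite Rminus_diag, Rabs_R0; apply cond_pos. }
exists (Rmin e dl); split; [apply Rmin_pos; trivial; apply cond_pos |].
intros x [_ hx]; simpl in *; unfold R_dist in *.
assert (hx1 := Rlt_le_trans _ _ _ hx (Rmin_l _ _)).
assert (hx2 := Rlt_le_trans _ _ _ hx (Rmin_r _ _)).
apply Rle_lt_trans with ((d - c) * (eps / (2 * (d - c + 1)))).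
- apply RInt_near; trivial; [now apply hex | apply hex; rewrite Rminus_diag, Rabs_R0; trivial |].
  intros y hy; apply Rlt_le, hdl; trivial; try (rewrite Rminus_diag, Rabs_R0; apply cond_pos).
  + assert (hp := cond_pos dl); lra.
  + apply Rabs_def2 in hx2; lra.
- apply (Rmult_lt_reg_r (2 * (d - c + 1))); [lra |].
  replace ((d - c) * (eps / (2 * (d - c + 1))) * (2 * (d - c + 1))) with ((d - c) * eps) by (field; lra).
  nra.
Qed.

Lemma mean_continuity (g : Cx -> R) (r0 e : R) : 0 < e ->
  (forall r, Rabs (r - r0) < e -> circ g r) -> continuity_pt (mean g) r0.
Proof.
intros he h; unfold mean; apply (continuity_pt_scal (fun r => RInt (fun t => g (pt r t)) 0 (2 * PI))).
apply (RInt_param_continuity (fun r t => g (pt r t)) 0 (2 * PI) r0 e); trivial.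
- apply Rlt_le, two_PI_pos.
- intros x y hx _; apply rcont_polar, h, hx.
Qed.

(** Both sides vanish for b = a and have the same derivative in b, the right one by differentiation
    under the integral sign. *)
Lemma fubini (f : R -> R -> R) (a b c d : R) : a <= b -> c <= d ->
  (forall x y, continuity_2d_pt f x y) ->
  RInt (fun x => RInt (fun y => f x y) c d) a b = RInt (fun y => RInt (fun x => f x y) a b) c d.
Proof.
intros hab hcd hf.
assert (hfx : forall x y, continuous (fun x => f x y) x).
{ intros x y; apply continuity_pt_filterlim; intros e he.
  destruct (hf x y (mkposreal e he)) as [d1 hd1]; simpl in hd1.
  exists d1; split; [apply cond_pos |]; intros z [_ hz]; apply hd1; trivial.
  rewrite Rminus_diag, Rabs_R0; apply cond_pos. }
assert (hi : forall y x1 x2, ex_RInt (fun x => f x y) x1 x2).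
{ intros; apply (ex_RInt_continuous (V := R_CompleteNormedModule)); intros; apply hfx. }
assert (hsw : forall x y, continuity_2d_pt (fun u v => f v u) x y).
{ intros x y e; destruct (hf y x e) as [dl h]; exists dl; intros; now apply h. }
assert (hin1 : forall x, continuous (fun x => RInt (fun y => f x y) c d) x).
{ intros x; apply continuity_pt_filterlim, (RInt_param_continuity f c d x 1); trivial; lra. }
assert (hin2 : forall u y, a <= u -> continuous (fun y => RInt (fun x => f x y) a u) y).
{ intros u y hu; apply continuity_pt_filterlim, (RInt_param_continuity (fun y x => f x y) a u y 1); trivial; lra. }
destruct (Req_dec a b) as [<- | hne].
{ rewrite (RInt_point (V := R_CompleteNormedModule)).
  rewrite (RInt_ext _ (fun _ => 0)); [rewrite RInt_cst; unfold zero; simpl; ring |].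
  intros; apply (RInt_point (V := R_CompleteNormedModule)). }
assert (hex2 : forall u, ex_RInt (fun y => RInt (fun x => f x y) a u) c d).
{ intros u; destruct (Rle_or_lt a u) as [hu | hu].
  - apply ex_RInt_cont; trivial; intros; now apply hin2.
  - apply (ex_RInt_ext (V := R_NormedModule) (fun y => - RInt (fun x => f x y) u a)).
    + intros y _; exact (opp_RInt_swap (V := R_CompleteNormedModule) (fun x => f x y) u a (hi y u a)).
    + apply (ex_RInt_opp (V := R_NormedModule)).
      apply ex_RInt_cont; trivial; intros y _.
      apply continuity_pt_filterlim, (RInt_param_continuity (fun y x => f x y) u a y 1); trivial; lra. }
set (D := fun u => RInt (fun x => RInt (fun y => f x y) c d) a u - RInt (fun y => RInt (fun x => f x y) a u) c d).
enough (h : D a = D b).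
{ unfold D in h; rewrite (RInt_point (V := R_CompleteNormedModule)) in h.
  rewrite (RInt_ext (fun y => RInt (fun x => f x y) a a) (fun _ => 0)) in h.
  - rewrite RInt_cst in h; unfold zero in h; simpl in h; lra.
  - intros; apply (RInt_point (V := R_CompleteNormedModule)). }
apply (eq_is_derive (V := R_NormedModule) D a b); [| lra]; intros u _.
assert (hd : forall y u, is_derive (fun v => RInt (fun x => f x y) a v) u (f u y)).
{ intros y v; apply (is_derive_RInt (V := R_CompleteNormedModule) (fun x => f x y) _ a).
  - exists (mkposreal 1 Rlt_0_1); intros w _; apply RInt_correct, hi.
  - apply hfx. }
change (is_derive D u 0); replace 0 with (minus (RInt (fun y => f u y) c d) (RInt (fun y => Derive (fun v => RInt (fun x => f x y) a v) u) c d)).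
2: { rewrite (RInt_ext (fun y => Derive (fun v => RInt (fun x => f x y) a v) u) (fun y => f u y)).
     - unfold minus, plus, opp, zero; simpl; ring.
     - intros y _; apply is_derive_unique, hd. }
apply (is_derive_minus (K := R_AbsRing) (V := R_NormedModule)).
- apply (is_derive_RInt (V := R_CompleteNormedModule) (fun x => RInt (fun y => f x y) c d) _ a).
  + exists (mkposreal 1 Rlt_0_1); intros w _; apply RInt_correct.
    apply (ex_RInt_continuous (V := R_CompleteNormedModule)); intros; apply hin1.
  + apply hin1.
- apply (is_derive_RInt_param (fun v y => RInt (fun x => f x y) a v)).
  + exists (mkposreal 1 Rlt_0_1); intros w _ y _; eexists; apply hd.
  + intros y _; apply continuity_2d_pt_ext with f; trivial.
    intros x1 y1; symmetry; apply is_derive_unique, hd.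
  + exists (mkposreal 1 Rlt_0_1); intros w _; apply hex2.
Qed.

Definition cmean (G : Cx -> Cx) (r : R) : Cx :=
  (mean (fun w => fst (G w)) r, mean (fun w => snd (G w)) r).

Definition ccirc (G : Cx -> Cx) (r : R) : Prop := forall t, ccont G (pt r t).

Lemma ccirc_fst (G : Cx -> Cx) (r : R) : ccirc G r -> circ (fun w => fst (G w)) r.
Proof. intros h t; apply h. Qed.

Lemma ccirc_snd (G : Cx -> Cx) (r : R) : ccirc G r -> circ (fun w => snd (G w)) r.
Proof. intros h t; apply h. Qed.

Lemma cmean_ext (f g : Cx -> Cx) (r : R) : (forall t, f (pt r t) = g (pt r t)) -> cmean f r = cmean g r.
Proof. intros h; unfold cmean; f_equal; apply mean_ext; intros; now rewrite h. Qed.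

Lemma cmean_add (f g : Cx -> Cx) (r : R) : ccirc f r -> ccirc g r ->
  cmean (fun w => Cadd (f w) (g w)) r = Cadd (cmean f r) (cmean g r).
Proof.
intros hf hg; unfold cmean, Cadd; simpl; f_equal; apply mean_add; intros t; first [apply hf | apply hg].
Qed.

Lemma cmean_mul (c : Cx) (g : Cx -> Cx) (r : R) : ccirc g r ->
  cmean (fun w => Cmul c (g w)) r = Cmul c (cmean g r).
Proof.
intros hg; assert (h1 := ccirc_fst _ _ hg); assert (h2 := ccirc_snd _ _ hg).
unfold cmean, Cmul; simpl; f_equal.
- rewrite (mean_sub (fun w => fst c * fst (g w)) (fun w => snd c * snd (g w)))
    by (now apply circ_cmul).
  now rewrite !mean_cmul.
- rewrite (mean_add (fun w => fst c * snd (g w)) (fun w => snd c * fst (g w)))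
    by (now apply circ_cmul).
  now rewrite !mean_cmul.
Qed.

Lemma cmean_sub (f g : Cx -> Cx) (r : R) : ccirc f r -> ccirc g r ->
  cmean (fun w => Csub (f w) (g w)) r = Csub (cmean f r) (cmean g r).
Proof.
intros hf hg; replace (Csub (cmean f r) (cmean g r)) with (Cadd (cmean f r) (Cmul (-1, 0) (cmean g r))).
2: { unfold Csub, Cadd, Cmul, Copp; simpl; f_equal; ring. }
rewrite <- cmean_mul, <- cmean_add; trivial.
- apply cmean_ext; intros t; unfold Csub, Cadd, Cmul, Copp; simpl; f_equal; ring.
- intros t; apply ccont_mul; [apply ccont_const | apply hg].
Qed.

Lemma cmean_const (c : Cx) (r : R) : cmean (fun _ => c) r = c.
Proof. unfold cmean; rewrite !mean_const; apply Cx_eta. Qed.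

(** For z the mean of G, |z|^2 is the mean of Re(conj z G), hence at most |z| B. *)
Lemma cmean_bound (G : Cx -> Cx) (r B : R) : ccirc G r -> (forall t, Cmod (G (pt r t)) <= B) ->
  Cmod (cmean G r) <= B.
Proof.
intros hG h; set (z := cmean G r).
assert (h1 := ccirc_fst _ _ hG); assert (h2 := ccirc_snd _ _ hG).
assert (hB : 0 <= B) by (apply Rle_trans with (2 := h 0); apply Cmod_ge0).
assert (hz : Cmod z ^ 2 <= Cmod z * B).
{ rewrite Cmod_sq.
  replace (fst z ^ 2 + snd z ^ 2) with (mean (fun w => fst z * fst (G w) + snd z * snd (G w)) r).
  2: { rewrite (mean_add (fun w => fst z * fst (G w)) (fun w => snd z * snd (G w))) by (now apply circ_cmul).
       rewrite !mean_cmul by trivial; unfold z, cmean; simpl; ring. }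
  rewrite <- (mean_const (Cmod z * B) r).
  apply mean_le; [apply circ_add; now apply circ_cmul | apply circ_const |].
  intros t; set (w := G (pt r t)).
  apply Rle_trans with (Cmod z * Cmod w); [| apply Rmult_le_compat_l; [apply Cmod_ge0 | apply h]].
  rewrite <- (Cmod_conj z), <- Cmod_mul.
  replace (fst z * fst w + snd z * snd w) with (fst (Cmul (Cconj z) w)) by (simpl; ring).
  apply Rle_trans with (1 := Rle_abs _); apply Cre_le. }
assert (hz0 := Cmod_ge0 z); nra.
Qed.

Lemma cmean_const_annulus (G : Cx -> Cx) (a b : R) : 0 < a <= b ->
  (forall r t, a <= r <= b -> cdiff G (pt r t)) -> cmean G a = cmean G b.
Proof.
intros; unfold cmean; f_equal; [apply mean_fst_const | apply mean_snd_const]; trivial.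
Qed.

Lemma continuity_limit_right (h : R -> R) (x c e : R) : 0 < e -> continuity_pt h x ->
  (forall y, x < y < x + e -> h y = c) -> h x = c.
Proof.
intros he hc H; apply cond_eq; intros eps heps.
destruct (hc eps heps) as [d [hd G]]; simpl in G; unfold R_dist in G.
set (y := x + Rmin d e / 2).
assert (hm : 0 < Rmin d e) by (now apply Rmin_pos).
assert (h1 := Rmin_l d e); assert (h2 := Rmin_r d e).
rewrite Rabs_minus_sym, <- (H y) by (unfold y; lra); apply G; split.
- split; [exact I | unfold y; lra].
- unfold y; apply Rabs_def1; lra.
Qed.

Lemma continuity_limit_left (h : R -> R) (x c e : R) : 0 < e -> continuity_pt h x ->
  (forall y, x - e < y < x -> h y = c) -> h x = c.
Proof.
intros he hc H; apply cond_eq; intros eps heps.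
destruct (hc eps heps) as [d [hd G]]; simpl in G; unfold R_dist in G.
set (y := x - Rmin d e / 2).
assert (hm : 0 < Rmin d e) by (now apply Rmin_pos).
assert (h1 := Rmin_l d e); assert (h2 := Rmin_r d e).
rewrite Rabs_minus_sym, <- (H y) by (unfold y; lra); apply G; split.
- split; [exact I | unfold y; lra].
- unfold y; apply Rabs_def1; lra.
Qed.

Lemma pt_0 (t : R) : pt 0 t = C0.
Proof. unfold pt, C0; f_equal; ring. Qed.

Lemma cmean_0 (G : Cx -> Cx) : cmean G 0 = G C0.
Proof.
rewrite <- (cmean_const (G C0) 0); apply cmean_ext; intros t; now rewrite pt_0.
Qed.

Lemma cmean_continuity (G : Cx -> Cx) (r0 e : R) : 0 < e ->
  (forall r, Rabs (r - r0) < e -> ccirc G r) ->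
  continuity_pt (fun r => fst (cmean G r)) r0 /\ continuity_pt (fun r => snd (cmean G r)) r0.
Proof.
intros he h; split; simpl.
- apply (mean_continuity (fun w => fst (G w)) r0 e he); intros; now apply ccirc_fst, h.
- apply (mean_continuity (fun w => snd (G w)) r0 e he); intros; now apply ccirc_snd, h.
Qed.

(* If [G] is continuous on [|w| < R] and differentiable off the circle [|w| = s],
   its mean does not jump across that circle. *)
Lemma cmean_const_across (G : Cx -> Cx) (s R0 : R) : 0 <= s < R0 ->
  (forall w, Cmod w <= R0 -> ccont G w) ->
  (forall w, 0 < Cmod w <= R0 -> Cmod w <> s -> cdiff G w) ->
  cmean G R0 = G C0.
Proof.
intros hs hc hd.
assert (hcc : forall r, Rabs r <= R0 -> ccirc G r) by (intros r hr t; apply hc; now rewrite Cmod_pt).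
assert (hcont : forall r, 0 <= r < R0 -> continuity_pt (fun r => fst (cmean G r)) r /\ continuity_pt (fun r => snd (cmean G r)) r).
{ intros r hr; apply (cmean_continuity G r (R0 - r)); [lra |].
  intros x hx; apply hcc; apply Rabs_def2 in hx; apply Rabs_le; lra. }
assert (hright : forall r, 0 <= r < R0 -> s <= r -> cmean G r = cmean G R0).
{ intros r hr hsr; destruct (hcont r hr) as [k1 k2].
  assert (k : forall y, r < y < r + (R0 - r) -> cmean G y = cmean G R0).
  { intros y hy; apply cmean_const_annulus; [lra |]; intros x t hx; apply hd; rewrite Cmod_pt, Rabs_pos_eq; lra. }
  rewrite <- (Cx_eta (cmean G r)), <- (Cx_eta (cmean G R0)); f_equal.
  - apply (continuity_limit_right (fun r => fst (cmean G r)) r _ (R0 - r)); [lra | trivial |]; intros; now rewrite k.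
  - apply (continuity_limit_right (fun r => snd (cmean G r)) r _ (R0 - r)); [lra | trivial |]; intros; now rewrite k. }
rewrite <- cmean_0, <- (hright s) by lra.
destruct (Req_dec s 0) as [-> | hs0]; trivial.
assert (hleft : forall r, 0 < r < s -> cmean G r = cmean G 0).
{ intros r hr; destruct (hcont 0 ltac:(lra)) as [k1 k2].
  assert (k : forall y, 0 < y < 0 + r -> cmean G y = cmean G r).
  { intros y hy; apply cmean_const_annulus; [lra |]; intros x t hx; apply hd; rewrite Cmod_pt, Rabs_pos_eq; lra. }
  symmetry; rewrite <- (Cx_eta (cmean G r)), <- (Cx_eta (cmean G 0)); f_equal.
  - apply (continuity_limit_right (fun r => fst (cmean G r)) 0 _ r); [lra | trivial |]; intros; now rewrite k.
  - apply (continuity_limit_right (fun r => snd (cmean G r)) 0 _ r); [lra | trivial |]; intros; now rewrite k. }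
destruct (hcont s ltac:(lra)) as [k1 k2].
rewrite <- (Cx_eta (cmean G s)), <- (Cx_eta (cmean G 0)); f_equal.
- apply (continuity_limit_left (fun r => fst (cmean G r)) s _ s); [lra | trivial |]; intros y hy; rewrite hleft; trivial; lra.
- apply (continuity_limit_left (fun r => snd (cmean G r)) s _ s); [lra | trivial |]; intros y hy; rewrite hleft; trivial; lra.
Qed.

Lemma Cmod_lt_ne (z w : Cx) : Cmod z < Cmod w -> w <> z.
Proof. intros h ->; lra. Qed.

(** The Cauchy kernel relative to dw/w, the form underlying the circle mean; hence the factor w. *)
Definition cauchy_kernel (a w : Cx) : Cx := Cmul w (Cinv (Csub w a)).

Lemma cauchy_kernel_cdiff (a w : Cx) : w <> a -> cdiff (cauchy_kernel a) w.
Proof.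
intros h; apply cdiff_mul; [apply cdiff_id |].
apply cdiff_inv; [apply cdiff_sub; [apply cdiff_id | apply cdiff_const] | now apply Csub_ne].
Qed.

Lemma Cmod_sub_ge (w a : Cx) : Cmod w - Cmod a <= Cmod (Csub w a).
Proof. assert (h := Cmod_tri_sub w a); lra. Qed.

(** The mean is independent of the radius r >= R0, and on |w| = r the kernel differs from 1 by at
    most |a| / (r - |a|), which tends to 0. *)
Lemma cauchy_kernel_mean (a : Cx) (R0 : R) : Cmod a < R0 -> cmean (cauchy_kernel a) R0 = Cone.
Proof.
intros ha; assert (ha0 := Cmod_ge0 a).
assert (hne : forall r t, R0 <= r -> pt r t <> a).
{ intros r t hr; apply Cmod_lt_ne; rewrite Cmod_pt, Rabs_pos_eq; lra. }
assert (hd : forall r t, R0 <= r -> cdiff (cauchy_kernel a) (pt r t)).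
{ intros r t hr; now apply cauchy_kernel_cdiff, hne. }
assert (hb : forall r, R0 <= r -> Cmod (Csub (cmean (cauchy_kernel a) R0) Cone) <= Cmod a / (r - Cmod a)).
{ intros r hr.
  rewrite (cmean_const_annulus _ R0 r) by (try lra; intros; apply hd; lra).
  rewrite <- (cmean_const Cone r), <- cmean_sub.
  - apply cmean_bound.
    + intros t; apply ccont_sub; [apply cdiff_ccont, hd, hr | apply ccont_const].
    + intros t; unfold cauchy_kernel.
      replace (Csub (Cmul (pt r t) (Cinv (Csub (pt r t) a))) Cone) with (Cmul a (Cinv (Csub (pt r t) a)))
        by (field; now apply Csub_ne, hne).
      rewrite Cmod_mul, Cmod_inv by (now apply Csub_ne, hne).
      apply Rmult_le_compat_l; trivial; apply Rinv_le_contravar; [lra |].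
      assert (k := Cmod_sub_ge (pt r t) a); rewrite Cmod_pt, Rabs_pos_eq in k; lra.
  - intros t; apply cdiff_ccont, hd, hr.
  - intros t; apply ccont_const. }
assert (h0 : Cmod (Csub (cmean (cauchy_kernel a) R0) Cone) = 0).
{ set (x := Cmod (Csub (cmean (cauchy_kernel a) R0) Cone)) in *.
  assert (hx : 0 <= x) by apply Cmod_ge0.
  destruct hx as [hx | hx]; [| now symmetry].
  (* At this radius the bound reads x (R0 - |a|) + |a| <= |a|, which is false for x > 0. *)
  specialize (hb (R0 + Cmod a / x) ltac:(assert (0 <= Cmod a / x) by (apply Rmult_le_pos; [lra | apply Rlt_le, Rinv_0_lt_compat; lra]); lra)).
  apply (Rmult_le_compat_r (R0 + Cmod a / x - Cmod a)) in hb.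
  - unfold Rdiv in hb at 2; rewrite Rmult_assoc, Rinv_l in hb.
    + replace (x * (R0 + Cmod a / x - Cmod a)) with (x * (R0 - Cmod a) + Cmod a) in hb by (field; lra).
      nra.
    + assert (0 <= Cmod a / x) by (apply Rmult_le_pos; [lra | apply Rlt_le, Rinv_0_lt_compat; lra]); lra.
  - assert (0 <= Cmod a / x) by (apply Rmult_le_pos; [lra | apply Rlt_le, Rinv_0_lt_compat; lra]); lra. }
apply Cmod_eq0 in h0.
replace (cmean (cauchy_kernel a) R0) with (Cadd (Csub (cmean (cauchy_kernel a) R0) Cone) Cone) by ring.
rewrite h0; ring.
Qed.

(** The function w (f(w) - f(a)) / (w - a), completed at a, is continuous everywhere and
    differentiable except perhaps at a, so its mean is its value 0 at the origin. *)
Lemma cauchy_formula (f : Cx -> Cx) (a : Cx) (R0 : R) : Cmod a < R0 ->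
  (forall w, Cmod w <= R0 -> cdiff f w) ->
  cmean (fun w => Cmul (f w) (cauchy_kernel a w)) R0 = f a.
Proof.
intros ha hf; assert (ha0 := Cmod_ge0 a).
destruct (cdiff_quotient f a) as [L hL]; [apply hf; lra |].
set (Q := fun w => Cmul (quotient f a L w) w).
assert (hQ : cmean Q R0 = C0).
{ rewrite (cmean_const_across Q (Cmod a)); [unfold Q; ring | lra | |].
  - intros w hw; apply ccont_mul; [| apply ccont_id].
    destruct (excluded_middle_informative (w = a)) as [-> | h]; trivial.
    apply cdiff_ccont, cdiff_quotient_off; auto.
  - intros w hw hwa; apply cdiff_mul; [| apply cdiff_id].
    apply cdiff_quotient_off; [now intros -> | apply hf; lra]. }
assert (hne : forall t, pt R0 t <> a).
{ intros t; apply Cmod_lt_ne; rewrite Cmod_pt, Rabs_pos_eq; lra. }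
assert (hk : ccirc (cauchy_kernel a) R0) by (intros t; apply cdiff_ccont, cauchy_kernel_cdiff, hne).
assert (hfc : ccirc f R0) by (intros t; apply cdiff_ccont, hf; rewrite Cmod_pt, Rabs_pos_eq; lra).
rewrite (cmean_ext Q (fun w => Csub (Cmul (f w) (cauchy_kernel a w)) (Cmul (f a) (cauchy_kernel a w)))) in hQ.
- rewrite cmean_sub, cmean_mul, cauchy_kernel_mean in hQ; trivial.
  + replace (cmean (fun w => Cmul (f w) (cauchy_kernel a w)) R0) with
      (Cadd (Csub (cmean (fun w => Cmul (f w) (cauchy_kernel a w)) R0) (Cmul (f a) Cone)) (f a)) by ring.
    rewrite hQ; ring.
  + intros t; apply ccont_mul; [apply hfc | apply hk].
  + intros t; apply ccont_mul; [apply ccont_const | apply hk].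
- intros t; unfold Q, cauchy_kernel; rewrite quotient_ne by apply hne; ring.
Qed.

(** * Poisson's formula and monotonicity of means *)

Definition poisson_kernel (R0 : R) (a w : Cx) : R :=
  (R0 ^ 2 - Cmod a ^ 2) * / Cmod (Csub w a) ^ 2.

Lemma Cmul_conj (z : Cx) : Cmul z (Cconj z) = (Cmod z ^ 2, 0).
Proof. rewrite Cmod_sq; unfold Cmul, Cconj; simpl; f_equal; ring. Qed.

Lemma Csub_0_r (z : Cx) : Csub z C0 = z.
Proof. ring. Qed.

Lemma Creal_ne (x : R) : x <> 0 -> ((x, 0) : Cx) <> C0.
Proof. intros h h'; injection h'; auto. Qed.

Lemma Cinv_real (x : R) : Cinv (x, 0) = (/ x, 0).
Proof.
unfold Cinv; simpl; f_equal; [| unfold Rdiv; ring].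
destruct (Req_dec x 0) as [-> | h]; [| field; trivial].
rewrite Rinv_0; unfold Rdiv; ring.
Qed.

(* On [|w| = R0] the Poisson kernel is the Cauchy kernel times the factor
   [(R0^2-|a|^2)/(R0^2-conj(a) w)], which equals 1 at [w = a] and is holomorphic. *)
Lemma poisson_formula (f : Cx -> Cx) (a : Cx) (R0 : R) : Cmod a < R0 ->
  (forall w, Cmod w <= R0 -> cdiff f w) ->
  cmean (fun w => Cmul (poisson_kernel R0 a w, 0) (f w)) R0 = f a.
Proof.
intros ha hf; assert (ha0 := Cmod_ge0 a).
set (den := fun w => Csub ((R0 ^ 2, 0) : Cx) (Cmul (Cconj a) w)).
assert (hden : forall w, Cmod w <= R0 -> den w <> C0).
{ intros w hw h; unfold den in h.
  assert (k : Cmod ((R0 ^ 2, 0) : Cx) <= Cmod a * Cmod w).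
  { rewrite <- (Cmod_conj a), <- Cmod_mul.
    replace (Cmul (Cconj a) w) with (Csub (R0 ^ 2, 0) (Csub ((R0 ^ 2, 0) : Cx) (Cmul (Cconj a) w))) by ring.
    rewrite h, Csub_0_r; lra. }
  rewrite Cmod_real, Rabs_pos_eq in k by apply pow2_ge_0.
  assert (k2 : Cmod a * Cmod w <= Cmod a * R0) by (apply Rmult_le_compat_l; trivial); nra. }
set (u := fun w => Cmul (f w) (Cmul ((R0 ^ 2 - Cmod a ^ 2, 0) : Cx) (Cinv (den w)))).
assert (hu : u a = f a).
{ unfold u; replace (den a) with ((R0 ^ 2 - Cmod a ^ 2, 0) : Cx).
  - field; apply Creal_ne; nra.
  - unfold den; replace (Cmul (Cconj a) a) with (Cmul a (Cconj a)) by ring; rewrite Cmul_conj.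
    unfold Csub, Cadd, Copp; simpl; f_equal; ring. }
rewrite <- hu, <- (cauchy_formula u a R0 ha).
- apply cmean_ext; intros t; set (w := pt R0 t).
  assert (hw : Cmod w = R0) by (unfold w; rewrite Cmod_pt, Rabs_pos_eq; lra).
  assert (hwa : w <> a) by (apply Cmod_lt_ne; lra).
  assert (hw0 : w <> C0) by (intros h; rewrite h, Cmod_C0 in hw; lra).
  assert (hsub := Csub_ne _ _ hwa).
  assert (hcs : Cconj (Csub w a) <> C0).
  { intros h; apply (f_equal Cmod) in h; rewrite Cmod_conj, Cmod_C0 in h; now apply Cmod_eq0 in h. }
  assert (hd : den w = Cmul w (Cconj (Csub w a))).
  { unfold den; rewrite Cconj_sub; replace (Cmul w (Csub (Cconj w) (Cconj a))) with
      (Csub (Cmul w (Cconj w)) (Cmul (Cconj a) w)) by ring.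
    now rewrite Cmul_conj, hw. }
  unfold u, cauchy_kernel, poisson_kernel; rewrite hd.
  assert (hk : ((/ Cmod (Csub w a) ^ 2, 0) : Cx) = Cinv (Cmul (Csub w a) (Cconj (Csub w a)))).
  { now rewrite Cmul_conj, Cinv_real. }
  replace (((R0 ^ 2 - Cmod a ^ 2) * / Cmod (Csub w a) ^ 2, 0) : Cx) with
    (Cmul ((R0 ^ 2 - Cmod a ^ 2, 0) : Cx) ((/ Cmod (Csub w a) ^ 2, 0) : Cx))
    by (unfold Cmul; simpl; f_equal; ring).
  rewrite hk; field; repeat split; trivial.
- intros w hw; apply cdiff_mul; [now apply hf |]; apply cdiff_mul; [apply cdiff_const |].
  apply cdiff_inv; [| now apply hden].
  apply cdiff_sub; [apply cdiff_const |]; apply cdiff_mul; [apply cdiff_const | apply cdiff_id].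
Qed.

Lemma poisson_kernel_rcont (R0 : R) (a w : Cx) : w <> a -> rcont (poisson_kernel R0 a) w.
Proof.
intros h; unfold poisson_kernel; apply rcont_scal, rcont_inv.
- apply rcont_square, (rcont_mod (fun w => Csub w a)), ccont_sub; [apply ccont_id | apply ccont_const].
- apply pow_nonzero; intros h'; apply (Csub_ne _ _ h), Cmod_eq0, h'.
Qed.

Lemma poisson_kernel_ge0 (R0 : R) (a w : Cx) : Cmod a < R0 -> w <> a -> 0 <= poisson_kernel R0 a w.
Proof.
intros h hw; unfold poisson_kernel; assert (h0 := Cmod_ge0 a); assert (h1 := Cmod_gt0 _ (Csub_ne _ _ hw)).
apply Rmult_le_pos; [nra | apply Rlt_le, Rinv_0_lt_compat, pow_lt, h1].
Qed.

Lemma poisson_kernel_circ (R0 : R) (a : Cx) : Cmod a < R0 -> circ (poisson_kernel R0 a) R0.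
Proof.
intros ha t; apply poisson_kernel_rcont, Cmod_lt_ne; rewrite Cmod_pt.
assert (h := Cmod_ge0 a); rewrite Rabs_pos_eq; lra.
Qed.

Lemma poisson_kernel_mean (R0 : R) (a : Cx) : Cmod a < R0 -> mean (poisson_kernel R0 a) R0 = 1.
Proof.
intros ha; assert (h := poisson_formula (fun _ => Cone) a R0 ha ltac:(intros; apply cdiff_const)).
apply (f_equal fst) in h; simpl in h; rewrite <- h.
apply mean_ext; intros; ring.
Qed.

(** The vector u is the gradient p |a|^(p-2) a of the convex function |.|^p, and 0 at a = 0. *)
Lemma rpow_Cmod_support (p : R) (a : Cx) : 1 <= p -> exists u : Cx, forall b,
  rpow (Cmod a) p + (fst u * (fst b - fst a) + snd u * (snd b - snd a)) <= rpow (Cmod b) p.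
Proof.
intros hp; destruct (excluded_middle_informative (a = C0)) as [-> | h].
- exists C0; intros b; rewrite Cmod_C0, rpow_0; simpl; assert (k := rpow_ge0 (Cmod b) p); lra.
- assert (ha := Cmod_gt0 a h).
  set (s := p * rpow (Cmod a) (p - 1) / Cmod a).
  assert (hs : 0 <= s).
  { unfold s; apply Rmult_le_pos; [| apply Rlt_le, Rinv_0_lt_compat, ha].
    apply Rmult_le_pos; [lra | apply rpow_ge0]. }
  exists (s * fst a, s * snd a); intros b; simpl.
  apply Rle_trans with (2 := rpow_tangent p (Cmod a) (Cmod b) hp (Cmod_ge0 a) (Cmod_ge0 b)).
  apply Rplus_le_compat_l.
  replace (p * rpow (Cmod a) (p - 1) * (Cmod b - Cmod a)) with (s * (Cmod a * Cmod b - Cmod a ^ 2))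
    by (unfold s; field; lra).
  replace (s * fst a * (fst b - fst a) + s * snd a * (snd b - snd a)) with
    (s * (fst (Cmul (Cconj a) b) - (fst a ^ 2 + snd a ^ 2))) by (simpl; ring).
  rewrite <- Cmod_sq; apply Rmult_le_compat_l; trivial; apply Rplus_le_compat_r.
  apply Rle_trans with (1 := Rle_abs _); apply Rle_trans with (1 := Cre_le _).
  rewrite Cmod_mul, Cmod_conj; lra.
Qed.

(** Jensen's inequality: the supporting affine function of |.|^p at f(a) is averaged against the
    Poisson kernel, which has mean 1 and reproduces the real and imaginary parts of f at a. *)
Lemma poisson_jensen (p : R) (f : Cx -> Cx) (a : Cx) (R0 : R) : 1 <= p -> Cmod a < R0 ->
  (forall w, Cmod w <= R0 -> cdiff f w) ->
  rpow (Cmod (f a)) p <= mean (fun w => poisson_kernel R0 a w * rpow (Cmod (f w)) p) R0.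
Proof.
intros hp ha hf; assert (ha0 := Cmod_ge0 a).
destruct (rpow_Cmod_support p (f a) hp) as [u hu].
assert (hP := poisson_kernel_circ R0 a ha).
assert (hfc : ccirc f R0) by (intros t; apply cdiff_ccont, hf; rewrite Cmod_pt, Rabs_pos_eq; lra).
assert (h1 := ccirc_fst _ _ hfc); assert (h2 := ccirc_snd _ _ hfc).
assert (hform := poisson_formula f a R0 ha hf).
assert (k1 := f_equal fst hform); assert (k2 := f_equal snd hform); simpl in k1, k2.
set (c := rpow (Cmod (f a)) p - fst u * fst (f a) - snd u * snd (f a)).
replace (rpow (Cmod (f a)) p) with
  (mean (fun w => c * poisson_kernel R0 a w + (fst u * (poisson_kernel R0 a w * fst (f w)) +
     snd u * (poisson_kernel R0 a w * snd (f w)))) R0).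
- apply mean_le.
  + apply circ_add; [now apply circ_cmul |].
    apply circ_add; apply circ_cmul, circ_mult; trivial.
  + apply circ_mult; trivial; intros t; apply rcont_mod_rpow; [lra | apply hfc].
  + intros t; set (w := pt R0 t).
    assert (hw : w <> a) by (apply Cmod_lt_ne; unfold w; rewrite Cmod_pt, Rabs_pos_eq; lra).
    replace (_ + _) with (poisson_kernel R0 a w * (c + (fst u * fst (f w) + snd u * snd (f w)))) by ring.
    apply Rmult_le_compat_l; [now apply poisson_kernel_ge0 |].
    assert (k := hu (f w)); unfold c; lra.
- rewrite (mean_add (fun w => c * poisson_kernel R0 a w)
    (fun w => fst u * (poisson_kernel R0 a w * fst (f w)) + snd u * (poisson_kernel R0 a w * snd (f w)))).
  + rewrite (mean_add (fun w => fst u * (poisson_kernel R0 a w * fst (f w)))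
      (fun w => snd u * (poisson_kernel R0 a w * snd (f w)))) by (now apply circ_cmul, circ_mult).
    rewrite (mean_cmul c), (mean_cmul (fst u) (fun w => poisson_kernel R0 a w * fst (f w))),
      (mean_cmul (snd u) (fun w => poisson_kernel R0 a w * snd (f w))), poisson_kernel_mean
      by (trivial; now apply circ_mult).
    rewrite (mean_ext (fun w => poisson_kernel R0 a w * fst (f w))
      (fun w => poisson_kernel R0 a w * fst (f w) - 0 * snd (f w))) by (intros; ring).
    rewrite (mean_ext (fun w => poisson_kernel R0 a w * snd (f w))
      (fun w => poisson_kernel R0 a w * snd (f w) + 0 * fst (f w))) by (intros; ring).
    rewrite k1, k2; unfold c; ring.
  + now apply circ_cmul.
  + apply circ_add; now apply circ_cmul, circ_mult.
Qed.

Lemma pt_dist_sq (R0 r s t : R) : Cmod (Csub (pt R0 t) (pt r s)) ^ 2 =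
  R0 ^ 2 + r ^ 2 - 2 * R0 * r * (cos s * cos t + sin s * sin t).
Proof.
rewrite Cmod_sq; assert (hs := sin2_cos2 s); assert (ht := sin2_cos2 t); unfold Rsqr in hs, ht.
unfold Csub, Cadd, Copp, pt; simpl.
replace (R0 * (R0 * 1) + r * (r * 1)) with
  (R0 * R0 * (sin t * sin t + cos t * cos t) + r * r * (sin s * sin s + cos s * cos s)) by (rewrite hs, ht; ring).
ring.
Qed.

(** The distance from R0 e^{it} to r e^{is} depends only on the cosine of t - s. Hence the kernel
    also has mean 1 over the angle of its inner point. *)
Lemma poisson_kernel_sym (R0 r s t : R) :
  poisson_kernel R0 (pt r s) (pt R0 t) = poisson_kernel R0 (pt r t) (pt R0 s).
Proof. unfold poisson_kernel; rewrite !Cmod_pt, !pt_dist_sq; do 3 f_equal; ring. Qed.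

(** The Jensen bound is averaged over |z| = r and the integrals are exchanged; by the symmetry of
    the kernel the inner integral is then 1. *)
Lemma mean_monotone (p : R) (f : Cx -> Cx) (r R0 : R) : 1 <= p -> 0 <= r <= R0 ->
  (forall w, Cmod w <= R0 -> cdiff f w) ->
  mean (fun w => rpow (Cmod (f w)) p) r <= mean (fun w => rpow (Cmod (f w)) p) R0.
Proof.
intros hp hr hf; destruct (Req_dec r R0) as [-> | hne]; [lra |].
assert (hpi := two_PI_pos).
assert (hfr : forall t, ccont f (pt r t)) by (intros t; apply cdiff_ccont, hf; rewrite Cmod_pt, Rabs_pos_eq; lra).
assert (hfR : forall t, ccont f (pt R0 t)) by (intros t; apply cdiff_ccont, hf; rewrite Cmod_pt, Rabs_pos_eq; lra).
set (F := fun s t => poisson_kernel R0 (pt r s) (pt R0 t) * rpow (Cmod (f (pt R0 t))) p).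
assert (hF2 : forall s t, continuity_2d_pt F s t).
{ intros s t; apply continuity_2d_pt_mult.
  - unfold poisson_kernel.
    apply continuity_2d_pt_ext with (fun s t => (R0 ^ 2 - r ^ 2) * / (R0 ^ 2 + r ^ 2 - 2 * R0 * r * (cos s * cos t + sin s * sin t))).
    + intros x y; now rewrite Cmod_pt, pt_dist_sq, pow2_abs.
    + assert (hc : forall h : R -> R, continuity h -> forall x y, continuity_2d_pt (fun s _ => h s) x y).
      { intros h hh x y; apply (continuity_1d_2d_pt_comp h (fun s _ => s)); [apply hh | apply continuity_2d_pt_id1]. }
      assert (hc' : forall h : R -> R, continuity h -> forall x y, continuity_2d_pt (fun _ t => h t) x y).
      { intros h hh x y; apply (continuity_1d_2d_pt_comp h (fun _ s => s)); [apply hh | apply continuity_2d_pt_id2]. }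
      apply continuity_2d_pt_mult; [apply continuity_2d_pt_const |].
      apply continuity_2d_pt_inv.
      * apply continuity_2d_pt_minus; [apply continuity_2d_pt_const |].
        apply continuity_2d_pt_mult; [apply continuity_2d_pt_const |].
        apply continuity_2d_pt_plus; apply continuity_2d_pt_mult;
          try apply hc; try apply hc'; first [apply continuity_cos | apply continuity_sin].
      * rewrite <- cos_minus; assert (k := COS_bound (s - t)).
        assert (0 <= 2 * R0 * r) by nra.
        nra.
  - apply (continuity_1d_2d_pt_comp (fun t => rpow (Cmod (f (pt R0 t))) p) (fun _ t => t)); [| apply continuity_2d_pt_id2].
    apply continuity_pt_filterlim, (rcont_polar_angle (fun w => rpow (Cmod (f w)) p)), rcont_mod_rpow; [lra | apply hfR]. }
unfold mean; apply Rmult_le_compat_l; [apply Rlt_le, Rinv_0_lt_compat, hpi |].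
apply Rle_trans with (RInt (fun s => / (2 * PI) * RInt (fun t => F s t) 0 (2 * PI)) 0 (2 * PI)).
- apply RInt_le; [lra | | |].
  + apply (circ_ex_RInt (fun w => rpow (Cmod (f w)) p)); intros t; apply rcont_mod_rpow; [lra | apply hfr].
  + apply ex_RInt_cont; [lra |]; intros x _; apply continuity_pt_filterlim, continuity_pt_scal.
    apply (RInt_param_continuity F 0 (2 * PI) x 1); trivial; lra.
  + intros s _; apply (poisson_jensen p f (pt r s) R0); trivial; rewrite Cmod_pt, Rabs_pos_eq; lra.
- rewrite RInt_cmul.
  + rewrite fubini by (trivial; lra).
    rewrite <- RInt_cmul.
    * right; apply RInt_ext; intros t _.
      rewrite (RInt_ext (fun s => F s t) (fun s => rpow (Cmod (f (pt R0 t))) p * poisson_kernel R0 (pt r t) (pt R0 s))).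
      -- rewrite RInt_cmul.
         ++ assert (hm := poisson_kernel_mean R0 (pt r t) ltac:(rewrite Cmod_pt, Rabs_pos_eq; lra)).
            unfold mean in hm.
            transitivity (rpow (Cmod (f (pt R0 t))) p * (/ (2 * PI) * RInt (fun s => poisson_kernel R0 (pt r t) (pt R0 s)) 0 (2 * PI))).
            ** eq_in_R; ring.
            ** rewrite hm; eq_in_R; ring.
         ++ apply circ_ex_RInt, poisson_kernel_circ; rewrite Cmod_pt, Rabs_pos_eq; lra.
      -- intros s _; unfold F; rewrite poisson_kernel_sym; eq_in_R; ring.
    * apply ex_RInt_cont; [lra |]; intros x _; apply continuity_pt_filterlim.
      apply (RInt_param_continuity (fun t s => F s t) 0 (2 * PI) x 1); try lra.
      intros y z _ _ e; destruct (hF2 z y e) as [dl h]; exists dl; intros; now apply h.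
  + apply ex_RInt_cont; [lra |]; intros x _; apply continuity_pt_filterlim.
    apply (RInt_param_continuity F 0 (2 * PI) x 1); trivial; lra.
Qed.

Lemma circle_bounded (g : Cx -> R) (r : R) : circ g r -> exists B, 0 <= B /\ forall t, Rabs (g (pt r t)) <= B.
Proof.
intros hg.
destruct (continuity_ab_maj (fun t => Rabs (g (pt r t))) 0 (2 * PI) (Rlt_le _ _ two_PI_pos)) as [M [hM _]].
{ intros t _; apply (continuity_pt_comp (fun t => g (pt r t)) Rabs); [| apply Rcontinuity_abs].
  apply continuity_pt_filterlim, rcont_polar_angle, hg. }
exists (Rabs (g (pt r M))); split; [apply Rabs_pos |].
intros t.
destruct (base_Int_part (t / (2 * PI))) as [h1 h2].
set (z := Int_part (t / (2 * PI))) in *.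
assert (hp := two_PI_pos).
assert (ht : t = t / (2 * PI) * (2 * PI)) by (field; lra).
assert (hz : g (pt r t) = g (pt r (t - 2 * IZR z * PI))).
{ f_equal; destruct (Z.le_gt_cases 0 z) as [hz | hz].
  - rewrite <- (Z2Nat.id z hz), <- INR_IZR_INZ.
    replace t with (t - 2 * INR (Z.to_nat z) * PI + 2 * INR (Z.to_nat z) * PI) at 1 by ring.
    unfold pt; now rewrite cos_period, sin_period.
  - replace (IZR z) with (- INR (Z.to_nat (- z))).
    + replace (t - 2 * - INR (Z.to_nat (- z)) * PI) with (t + 2 * INR (Z.to_nat (- z)) * PI) by ring.
      unfold pt; now rewrite cos_period, sin_period.
    + rewrite INR_IZR_INZ, Z2Nat.id by lia; rewrite opp_IZR; ring. }
rewrite hz; apply (hM (t - 2 * IZR z * PI)).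
assert (IZR z * (2 * PI) <= t) by (rewrite ht; apply Rmult_le_compat_r; lra).
assert (t <= (IZR z + 1) * (2 * PI)) by (rewrite ht; apply Rmult_le_compat_r; lra).
lra.
Qed.

(** * Uniform Taylor estimates on smaller discs *)

Definition taylor_bound (f : Cx -> Cx) (rho C : R) : Prop :=
  0 <= C /\ forall z, Cmod z <= rho -> Cmod (f z) <= C /\
    exists L, Cmod L <= C /\ forall h, Cmod (Cadd z h) <= rho ->
      Cmod (Csub (Csub (f (Cadd z h)) (f z)) (Cmul L h)) <= C * Cmod h ^ 2.

(** Cauchy's formula on a circle halfway between rho and 1. Value, derivative and quadratic
    remainder contain one, two and three factors of the type 1/(w - z), each at most e; the
    remainder is h^2 times the mean of f(w) w / ((w - z)^2 (w - z - h)). *)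
Lemma holo_taylor_bound (f : Cx -> Cx) (rho : R) : holo f -> 0 <= rho < 1 -> exists C, taylor_bound f rho C.
Proof.
rewrite holo_cdiff; intros hf hr.
set (R0 := (1 + rho) / 2); assert (hR : rho < R0 < 1) by (unfold R0; lra).
assert (hfc : forall w, Cmod w <= R0 -> cdiff f w) by (intros; apply hf; lra).
assert (hcc : ccirc f R0) by (intros t; apply cdiff_ccont, hfc; rewrite Cmod_pt, Rabs_pos_eq; lra).
destruct (circle_bounded (fun w => Cmod (f w)) R0) as [B [hB0 hB]].
{ intros t; apply rcont_mod, hcc. }
assert (hB' : forall t, Cmod (f (pt R0 t)) <= B).
{ intros t; apply Rle_trans with (2 := hB t); apply Rle_abs. }
set (e := / (R0 - rho)).
assert (he : 0 < e) by (unfold e; apply Rinv_0_lt_compat; lra).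
assert (hden : forall z t, Cmod z <= rho -> Csub (pt R0 t) z <> C0 /\ Cmod (Cinv (Csub (pt R0 t) z)) <= e).
{ intros z t hz.
  assert (k := Cmod_sub_ge (pt R0 t) z); rewrite Cmod_pt, Rabs_pos_eq in k by lra.
  assert (k1 : Csub (pt R0 t) z <> C0) by (intros h; rewrite h, Cmod_C0 in k; lra).
  split; trivial; rewrite Cmod_inv by trivial; unfold e; apply Rinv_le_contravar; lra. }
assert (hck : forall z, Cmod z <= rho -> ccirc (fun w => Cinv (Csub w z)) R0).
{ intros z hz t; apply ccont_inv; [apply ccont_sub; [apply ccont_id | apply ccont_const] | now apply hden]. }
assert (hid : ccirc (fun w => w) R0) by (intros t; apply ccont_id).
assert (hmodw : forall t, Cmod (pt R0 t) <= 1) by (intros t; rewrite Cmod_pt, Rabs_pos_eq; lra).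
assert (hcm : forall f g, ccirc f R0 -> ccirc g R0 -> ccirc (fun w => Cmul (f w) (g w)) R0)
  by (intros f1 g1 h1 h2 t; now apply ccont_mul).
assert (hb2 : forall x y X Y, 0 <= X -> Cmod x <= X -> Cmod y <= Y -> Cmod (Cmul x y) <= X * Y).
{ intros x y X Y hX hx hy; rewrite Cmod_mul; apply Rmult_le_compat; trivial; apply Cmod_ge0. }
set (C := B * e + B * e ^ 2 + B * e ^ 3).
assert (hC1 : 0 <= B * e) by (apply Rmult_le_pos; lra).
assert (hC2 : 0 <= B * e ^ 2) by (apply Rmult_le_pos; [lra | apply pow_le; lra]).
assert (hC3 : 0 <= B * e ^ 3) by (apply Rmult_le_pos; [lra | apply pow_le; lra]).
assert (hcf : forall z, Cmod z <= rho -> f z = cmean (fun w => Cmul (Cmul (f w) w) (Cinv (Csub w z))) R0).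
{ intros z hz; rewrite <- (cauchy_formula f z R0) by (trivial; lra).
  apply cmean_ext; intros t; unfold cauchy_kernel; ring. }
exists C; split; [unfold C; lra |]; intros z hz.
assert (hcz := hck z hz); split.
- rewrite hcf by trivial; apply Rle_trans with (B * 1 * e); [| unfold C; lra].
  apply cmean_bound; [now repeat apply hcm |]; intros t.
  apply hb2; [lra | apply hb2; trivial | now apply hden].
- exists (cmean (fun w => Cmul (Cmul (Cmul (f w) w) (Cinv (Csub w z))) (Cinv (Csub w z))) R0).
  split.
  + apply Rle_trans with (B * 1 * e * e); [| unfold C; lra].
    apply cmean_bound; [now repeat apply hcm |]; intros t.
    apply hb2; [lra | apply hb2; [lra | apply hb2; trivial | now apply hden] | now apply hden].
  + intros h hzh; assert (hczh := hck _ hzh).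
    rewrite (hcf (Cadd z h) hzh), (hcf z hz), <- cmean_sub by (now repeat apply hcm).
    replace (Cmul (cmean (fun w => Cmul (Cmul (Cmul (f w) w) (Cinv (Csub w z))) (Cinv (Csub w z))) R0) h) with
      (Cmul h (cmean (fun w => Cmul (Cmul (Cmul (f w) w) (Cinv (Csub w z))) (Cinv (Csub w z))) R0)) by ring.
    rewrite <- cmean_mul by (now repeat apply hcm).
    rewrite <- cmean_sub.
    * rewrite (cmean_ext _ (fun w => Cmul (Cmul h h) (Cmul (Cmul (Cmul (Cmul (f w) w) (Cinv (Csub w z))) (Cinv (Csub w z))) (Cinv (Csub w (Cadd z h)))))).
      -- rewrite cmean_mul by (now repeat apply hcm).
         rewrite !Cmod_mul.
         replace (C * Cmod h ^ 2) with (Cmod h * Cmod h * C) by ring.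
         apply Rmult_le_compat_l; [apply Rmult_le_pos; apply Cmod_ge0 |].
         apply Rle_trans with (B * 1 * e * e * e); [| unfold C; lra].
         apply cmean_bound; [now repeat apply hcm |]; intros t.
         assert (0 <= B * 1 * e * e) by lra.
         apply hb2; trivial; [apply hb2; [lra | apply hb2; [lra | apply hb2; trivial | now apply hden] | now apply hden] | now apply hden].
      -- intros t; field; split; now apply hden.
    * intros t; apply ccont_sub; now repeat apply hcm.
    * apply (hcm (fun _ => h)); [intros t; apply ccont_const | now repeat apply hcm].
Qed.

(** * Area integrals and the spaces *)

Definition dcont (g : Cx -> R) : Prop := forall z, Cmod z < 1 -> rcont g z.

Definition area (g : Cx -> R) (rho : R) : R := RInt (fun r => 2 * r * mean g r) 0 rho.

Lemma dcont_circ (g : Cx -> R) (r : R) : dcont g -> Rabs r < 1 -> circ g r.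
Proof. intros h hr t; apply h; now rewrite Cmod_pt. Qed.

Lemma dcont_circ' (g : Cx -> R) (r : R) : dcont g -> 0 <= r < 1 -> circ g r.
Proof. intros h hr; apply dcont_circ; trivial; rewrite Rabs_pos_eq; lra. Qed.

Lemma dcont_mean_continuous (g : Cx -> R) (r : R) : dcont g -> 0 <= r < 1 -> continuity_pt (mean g) r.
Proof.
intros h hr; apply (mean_continuity g r (1 - r)); [lra |].
intros x hx; apply dcont_circ; trivial; apply Rabs_def2 in hx; apply Rabs_def1; lra.
Qed.

Lemma area_integrand_continuous (g : Cx -> R) (r : R) : dcont g -> 0 <= r < 1 ->
  continuous (fun r => 2 * r * mean g r) r.
Proof.
intros h hr; apply continuity_pt_filterlim, continuity_pt_mult.
- apply continuity_pt_scal, continuity_pt_id.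
- now apply dcont_mean_continuous.
Qed.

Lemma area_ex_RInt (g : Cx -> R) (a b : R) : dcont g -> 0 <= a <= b -> b < 1 ->
  ex_RInt (fun r => 2 * r * mean g r) a b.
Proof.
intros; apply ex_RInt_cont; [lra |]; intros; apply area_integrand_continuous; trivial; lra.
Qed.

Lemma Rint_RInt (f : R -> R) (a b : R) : ex_RInt f a b -> Rint f a b = RInt f a b.
Proof.
intros h; assert (pr := ex_RInt_Reals_0 _ _ _ h).
assert (k : exists pr' : Riemann_integrable f a b, RiemannInt pr' = Rint f a b).
{ apply (epsilon_spec (inhabits 0) (fun v => exists pr' : Riemann_integrable f a b, RiemannInt pr' = v)).
  now exists (RiemannInt pr), pr. }
destruct k as [pr' <-]; symmetry; apply RInt_Reals.
Qed.

Lemma area_partial_eq (g : Cx -> R) (rho : R) : dcont g -> 0 <= rho < 1 ->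
  area_partial g rho = area g rho.
Proof.
intros hg hr; unfold area_partial.
assert (hp := PI_RGT_0).
assert (hext : forall r, Rmin 0 rho < r < Rmax 0 rho ->
  PI * (2 * r * mean g r) = r * Rint (fun t => g (pt r t)) 0 (2 * PI)).
{ intros r hr'; rewrite Rmin_left, Rmax_right in hr' by lra.
  rewrite Rint_RInt; [unfold mean; field; lra |].
  apply circ_ex_RInt, dcont_circ'; trivial; lra. }
assert (hex := area_ex_RInt g 0 rho hg ltac:(lra) ltac:(lra)).
rewrite Rint_RInt.
- rewrite (RInt_ext (fun r => r * Rint (fun t => g (pt r t)) 0 (2 * PI)) (fun r => PI * (2 * r * mean g r)))
    by (intros; symmetry; now apply hext).
  rewrite RInt_cmul by trivial; unfold area; field; lra.
- apply (ex_RInt_ext (V := R_NormedModule) (fun r => PI * (2 * r * mean g r))); trivial.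
  exact (ex_RInt_scal (V := R_NormedModule) _ _ _ PI hex).
Qed.

Lemma area_add (f g : Cx -> R) (rho : R) : dcont f -> dcont g -> 0 <= rho < 1 ->
  area (fun w => f w + g w) rho = area f rho + area g rho.
Proof.
intros hf hg hr; unfold area; rewrite <- RInt_add by (apply area_ex_RInt; trivial; lra).
apply RInt_ext; intros x hx; rewrite Rmin_left, Rmax_right in hx by lra.
rewrite mean_add by (apply dcont_circ'; trivial; lra); eq_in_R; ring.
Qed.

Lemma area_sub (f g : Cx -> R) (rho : R) : dcont f -> dcont g -> 0 <= rho < 1 ->
  area (fun w => f w - g w) rho = area f rho - area g rho.
Proof.
intros hf hg hr; unfold area; rewrite <- RInt_sub by (apply area_ex_RInt; trivial; lra).
apply RInt_ext; intros x hx; rewrite Rmin_left, Rmax_right in hx by lra.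
rewrite mean_sub by (apply dcont_circ'; trivial; lra); eq_in_R; ring.
Qed.

Lemma area_cmul (c : R) (g : Cx -> R) (rho : R) : dcont g -> 0 <= rho < 1 ->
  area (fun w => c * g w) rho = c * area g rho.
Proof.
intros hg hr; unfold area; rewrite <- RInt_cmul by (apply area_ex_RInt; trivial; lra).
apply RInt_ext; intros x hx; rewrite Rmin_left, Rmax_right in hx by lra.
rewrite mean_cmul by (apply dcont_circ'; trivial; lra); eq_in_R; ring.
Qed.

Lemma area_ext (f g : Cx -> R) (rho : R) : 0 <= rho < 1 ->
  (forall w, Cmod w < 1 -> f w = g w) -> area f rho = area g rho.
Proof.
intros hr h; apply RInt_ext; intros x hx; rewrite Rmin_left, Rmax_right in hx by lra.
f_equal; apply mean_ext; intros t; apply h; rewrite Cmod_pt, Rabs_pos_eq; lra.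
Qed.

Lemma area_split (g : Cx -> R) (a b : R) : dcont g -> 0 <= a <= b -> b < 1 ->
  area g b - area g a = RInt (fun r => 2 * r * mean g r) a b.
Proof.
intros hg hab hb; unfold area; rewrite (RInt_split _ 0 a b) by (apply area_ex_RInt; trivial; lra).
eq_in_R; ring.
Qed.

Lemma area_tail_le (f g : Cx -> R) (a b : R) : dcont f -> dcont g -> 0 <= a <= b -> b < 1 ->
  (forall w, Cmod w < 1 -> f w <= g w) -> area f b - area f a <= area g b - area g a.
Proof.
intros hf hg hab hb h; rewrite !area_split by trivial.
apply RInt_le; [lra | apply area_ex_RInt; trivial | apply area_ex_RInt; trivial |].
intros x hx; apply Rmult_le_compat_l; [lra |].
apply mean_le; try (apply dcont_circ'; trivial; lra).
intros t; apply h; rewrite Cmod_pt, Rabs_pos_eq; lra.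
Qed.

Lemma area_0 (g : Cx -> R) : area g 0 = 0.
Proof. exact (RInt_point (V := R_CompleteNormedModule) _ _). Qed.

Lemma area_le (f g : Cx -> R) (rho : R) : dcont f -> dcont g -> 0 <= rho < 1 ->
  (forall w, Cmod w < 1 -> f w <= g w) -> area f rho <= area g rho.
Proof.
intros hf hg hr h; assert (k := area_tail_le f g 0 rho hf hg ltac:(lra) ltac:(lra) h).
rewrite !area_0 in k; lra.
Qed.

Lemma RInt_2r (a b : R) : RInt (fun r => 2 * r) a b = b ^ 2 - a ^ 2.
Proof.
apply is_RInt_unique.
apply (is_RInt_derive (V := R_CompleteNormedModule) (fun r => r ^ 2) (fun r => 2 * r)).
- intros; auto_derive; trivial; ring.
- intros; apply continuity_pt_filterlim, continuity_pt_scal, continuity_pt_id.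
Qed.

Lemma ex_RInt_2r (c a b : R) : a <= b -> ex_RInt (fun r => 2 * r * c) a b.
Proof.
intros; apply ex_RInt_cont; trivial; intros; apply continuity_pt_filterlim.
apply continuity_pt_mult; [apply continuity_pt_scal, continuity_pt_id | apply continuity_pt_const; now intros ? ?].
Qed.

Lemma RInt_2r_cmul (c a b : R) : a <= b -> RInt (fun r => 2 * r * c) a b = c * (b ^ 2 - a ^ 2).
Proof.
intros h; rewrite <- RInt_2r, <- RInt_cmul.
- apply RInt_ext; intros; eq_in_R; ring.
- apply (ex_RInt_ext (V := R_NormedModule) (fun r => 2 * r * 1)); [intros; eq_in_R; ring | now apply ex_RInt_2r].
Qed.

Lemma area_tail_le_const (g : Cx -> R) (a b B : R) : dcont g -> 0 <= a <= b -> b < 1 ->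
  (forall r, a <= r <= b -> mean g r <= B) -> area g b - area g a <= B * (b ^ 2 - a ^ 2).
Proof.
intros hg hab hb h; rewrite area_split, <- RInt_2r_cmul by (trivial; lra).
apply RInt_le; [lra | now apply area_ex_RInt | apply ex_RInt_2r; lra |].
intros x hx; apply Rmult_le_compat_l; [lra | apply h; lra].
Qed.

Lemma area_tail_ge_const (g : Cx -> R) (a b B : R) : dcont g -> 0 <= a <= b -> b < 1 ->
  (forall r, a <= r <= b -> B <= mean g r) -> B * (b ^ 2 - a ^ 2) <= area g b - area g a.
Proof.
intros hg hab hb h; rewrite area_split, <- RInt_2r_cmul by (trivial; lra).
apply RInt_le; [lra | apply ex_RInt_2r; lra | now apply area_ex_RInt |].
intros x hx; apply Rmult_le_compat_l; [lra | apply h; lra].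
Qed.

Lemma area_incr (g : Cx -> R) (a b : R) : dcont g -> (forall w, Cmod w < 1 -> 0 <= g w) ->
  0 <= a <= b -> b < 1 -> area g a <= area g b.
Proof.
intros hg h hab hb.
assert (k : 0 * (b ^ 2 - a ^ 2) <= area g b - area g a); [| lra].
apply area_tail_ge_const; trivial; intros r hr.
apply mean_ge0; [apply dcont_circ'; trivial; lra |].
intros t; apply h; rewrite Cmod_pt, Rabs_pos_eq; lra.
Qed.

Lemma area_ge0 (g : Cx -> R) (rho : R) : dcont g -> (forall w, Cmod w < 1 -> 0 <= g w) ->
  0 <= rho < 1 -> 0 <= area g rho.
Proof.
intros; rewrite <- (area_0 g); apply area_incr; trivial; lra.
Qed.

Lemma area_rot (g : Cx -> R) (th rho : R) : dcont g -> 0 <= rho < 1 ->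
  area (fun w => g (Cmul (pt 1 th) w)) rho = area g rho.
Proof.
intros hg hr; apply RInt_ext; intros x hx; rewrite Rmin_left, Rmax_right in hx by lra.
f_equal; apply mean_rot, dcont_circ'; trivial; lra.
Qed.

Lemma mean_dil (g : Cx -> R) (s r : R) : mean (fun w => g (Cmul (s, 0) w)) r = mean g (s * r).
Proof. unfold mean; f_equal; apply RInt_ext; intros; now rewrite pt_scal. Qed.

Lemma area_dil (g : Cx -> R) (s rho : R) : dcont g -> 0 < s -> 0 <= rho -> s * rho < 1 ->
  area (fun w => g (Cmul (s, 0) w)) rho = / s ^ 2 * area g (s * rho).
Proof.
intros hg hs hr hsr; unfold area.
assert (h := RInt_comp_lin (V := R_CompleteNormedModule) (fun r => 2 * r * mean g r) s 0 0 rho).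
assert (hsr0 : 0 <= s * rho) by (apply Rmult_le_pos; lra).
rewrite Rmult_0_r, !Rplus_0_r in h.
rewrite <- h by (apply area_ex_RInt; trivial; lra).
rewrite <- RInt_cmul.
- apply RInt_ext; intros x _; rewrite mean_dil; unfold scal; simpl; unfold mult; simpl.
  rewrite Rplus_0_r; field; lra.
- apply (ex_RInt_comp_lin (V := R_NormedModule) (fun r => 2 * r * mean g r)).
  rewrite Rmult_0_r, !Rplus_0_r; apply area_ex_RInt; trivial; lra.
Qed.

(** * Limits as the radius tends to 1 *)

Lemma lim1_unique (h : R -> R) (u v : R) : lim1 h u -> lim1 h v -> u = v.
Proof.
intros hu hv; apply cond_eq; intros eps heps.
destruct (hu (eps / 2) ltac:(lra)) as [d [hd H]]; destruct (hv (eps / 2) ltac:(lra)) as [e [he G]].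
set (x := 1 - Rmin d e / 2).
assert (hm : 0 < Rmin d e) by (now apply Rmin_pos); assert (h1 := Rmin_l d e); assert (h2 := Rmin_r d e).
specialize (H x ltac:(unfold x; lra)); specialize (G x ltac:(unfold x; lra)).
replace (u - v) with ((h x - v) - (h x - u)) by ring; unfold Rminus at 1.
apply Rle_lt_trans with (1 := Rabs_triang _ _); rewrite Rabs_Ropp; lra.
Qed.

Lemma lim1_ext (h k : R -> R) (v : R) : (forall x, 0 <= x < 1 -> h x = k x) -> lim1 h v -> lim1 k v.
Proof.
intros hk hv eps heps; destruct (hv eps heps) as [d [hd H]].
exists (Rmin d 1); split; [apply Rmin_pos; lra |]; intros x hx.
assert (h1 := Rmin_l d 1); assert (h2 := Rmin_r d 1).
rewrite <- hk by lra; apply H; lra.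
Qed.

Lemma lim1_add (h k : R -> R) (u v : R) : lim1 h u -> lim1 k v -> lim1 (fun x => h x + k x) (u + v).
Proof.
intros hu hv eps heps.
destruct (hu (eps / 2) ltac:(lra)) as [d [hd H]]; destruct (hv (eps / 2) ltac:(lra)) as [e [he G]].
exists (Rmin d e); split; [now apply Rmin_pos |]; intros x hx.
assert (h1 := Rmin_l d e); assert (h2 := Rmin_r d e).
specialize (H x ltac:(lra)); specialize (G x ltac:(lra)).
replace (h x + k x - (u + v)) with ((h x - u) + (k x - v)) by ring.
apply Rle_lt_trans with (1 := Rabs_triang _ _); lra.
Qed.

Lemma lim1_cmul (c : R) (h : R -> R) (u : R) : lim1 h u -> lim1 (fun x => c * h x) (c * u).
Proof.
intros hu eps heps; assert (hc := Rabs_pos c).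
destruct (hu (eps / (Rabs c + 1)) ltac:(apply Rdiv_lt_0_compat; lra)) as [d [hd H]].
exists d; split; trivial; intros x hx; specialize (H x hx).
replace (c * h x - c * u) with (c * (h x - u)) by ring; rewrite Rabs_mult.
apply Rle_lt_trans with (Rabs c * (eps / (Rabs c + 1))); [apply Rmult_le_compat_l; lra |].
apply (Rmult_lt_reg_r (Rabs c + 1)); [lra |].
replace (Rabs c * (eps / (Rabs c + 1)) * (Rabs c + 1)) with (Rabs c * eps) by (field; lra); nra.
Qed.

Lemma lim1_le (h : R -> R) (u B : R) : lim1 h u -> (forall x, 0 <= x < 1 -> h x <= B) -> u <= B.
Proof.
intros hu H; apply Rnot_lt_le; intros hB.
destruct (hu (u - B) ltac:(lra)) as [d [hd G]].
assert (hm : 0 < Rmin d 1) by (apply Rmin_pos; lra); assert (h1 := Rmin_l d 1); assert (h2 := Rmin_r d 1).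
specialize (G (1 - Rmin d 1 / 2) ltac:(lra)); specialize (H (1 - Rmin d 1 / 2) ltac:(lra)).
apply Rabs_def2 in G; lra.
Qed.

Lemma lim1_ge (h : R -> R) (u B a : R) : lim1 h u -> a < 1 -> (forall x, a <= x < 1 -> B <= h x) -> B <= u.
Proof.
intros hu ha H; apply Rnot_lt_le; intros hB.
destruct (hu (B - u) ltac:(lra)) as [d [hd G]].
assert (hm : 0 < Rmin d (1 - a)) by (apply Rmin_pos; lra).
assert (h1 := Rmin_l d (1 - a)); assert (h2 := Rmin_r d (1 - a)).
specialize (G (1 - Rmin d (1 - a) / 2) ltac:(lra)); specialize (H (1 - Rmin d (1 - a) / 2) ltac:(lra)).
apply Rabs_def2 in G; lra.
Qed.

Lemma lim1_incr (h : R -> R) (B : R) : (forall x y, 0 <= x <= y -> y < 1 -> h x <= h y) ->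
  (forall x, 0 <= x < 1 -> h x <= B) -> exists v, lim1 h v.
Proof.
intros hi hB.
destruct (completeness (fun y => exists x, 0 <= x < 1 /\ y = h x)) as [v [hv1 hv2]].
- exists B; intros y [x [hx ->]]; auto.
- exists (h 0), 0; split; trivial; lra.
- exists v; intros eps heps.
  assert (hex : exists x, 0 <= x < 1 /\ v - eps < h x).
  { apply NNPP; intros hn; assert (v <= v - eps); [| lra].
    apply hv2; intros y [x [hx ->]]; apply Rnot_lt_le; intros k; apply hn; now exists x. }
  destruct hex as [x [hx hvx]]; exists (1 - x); split; [lra |]; intros y hy.
  assert (h1 := hi x y ltac:(lra) ltac:(lra)).
  assert (h2 : h y <= v) by (apply hv1; exists y; split; trivial; lra).
  apply Rabs_def1; lra.
Qed.

Lemma lim1_incr_le (h : R -> R) (v x : R) : (forall x y, 0 <= x <= y -> y < 1 -> h x <= h y) ->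
  lim1 h v -> 0 <= x < 1 -> h x <= v.
Proof.
intros hi hv hx; apply (lim1_ge h v (h x) x hv); [lra |]; intros; apply hi; lra.
Qed.

Lemma lim1_sq (c : R) : lim1 (fun x => c * x ^ 2) c.
Proof.
assert (h := lim1_cmul c (fun x => x ^ 2) 1); rewrite Rmult_1_r in h; apply h; clear h.
intros eps heps; exists (Rmin 1 (eps / 2)); split; [apply Rmin_pos; lra |]; intros x hx.
assert (h1 := Rmin_l 1 (eps / 2)); assert (h2 := Rmin_r 1 (eps / 2)).
apply Rabs_def1; nra.
Qed.

Lemma lim1_area_partial (g : Cx -> R) (v : R) : dcont g ->
  lim1 (area_partial g) v <-> lim1 (area g) v.
Proof.
intros hg; split; apply lim1_ext; intros; [| symmetry]; now apply area_partial_eq.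
Qed.

Lemma area_int_eq (g : Cx -> R) (v : R) : dcont g -> lim1 (area g) v -> area_int g = v.
Proof.
intros hg hv; apply (lim1_unique (area g)); trivial.
apply lim1_area_partial; trivial.
apply (epsilon_spec (inhabits 0) (fun v => lim1 (area_partial g) v)).
exists v; now apply lim1_area_partial.
Qed.

(** * The spaces expressed by circle means and disc integrals *)

Definition pm (p : R) (f : Cx -> Cx) (w : Cx) : R := rpow (Cmod (f w)) p.

Lemma pm_ge0 (p : R) (f : Cx -> Cx) (w : Cx) : 0 <= pm p f w.
Proof. apply rpow_ge0. Qed.

Lemma holo_ccont (f : Cx -> Cx) (z : Cx) : holo f -> Cmod z < 1 -> ccont f z.
Proof. intros hf hz; now apply cdiff_ccont, (proj1 (holo_cdiff f)). Qed.

Lemma pm_dcont (p : R) (f : Cx -> Cx) : 0 < p -> holo f -> dcont (pm p f).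
Proof. intros hp hf z hz; apply rcont_mod_rpow; trivial; now apply holo_ccont. Qed.

Lemma pm_mean_monotone (p : R) (f : Cx -> Cx) (r s : R) : 1 <= p -> holo f -> 0 <= r <= s -> s < 1 ->
  mean (pm p f) r <= mean (pm p f) s.
Proof.
intros hp hf hrs hs; apply mean_monotone; trivial.
intros w hw; apply (proj1 (holo_cdiff f) hf); lra.
Qed.

Lemma pm_mean_ge0 (p : R) (f : Cx -> Cx) (r : R) : 0 < p -> holo f -> 0 <= r < 1 -> 0 <= mean (pm p f) r.
Proof.
intros hp hf hr; apply mean_ge0; [apply dcont_circ'; trivial; now apply pm_dcont |].
intros; apply pm_ge0.
Qed.

Lemma pm_area_incr (p : R) (f : Cx -> Cx) (a b : R) : 0 < p -> holo f -> 0 <= a <= b -> b < 1 ->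
  area (pm p f) a <= area (pm p f) b.
Proof. intros; apply area_incr; trivial; [now apply pm_dcont | intros; apply pm_ge0]. Qed.

(** The integrals over |z| < rho increase with rho, so the limit required by [Ap] exists exactly
    when they are bounded. *)
Lemma Ap_iff (p : R) (f : Cx -> Cx) : 0 < p ->
  Ap p f <-> (holo f /\ exists B, forall rho, 0 <= rho < 1 -> area (pm p f) rho <= B).
Proof.
intros hp; split; intros [hf [v hv]]; split; trivial; assert (hd := pm_dcont p f hp hf).
- exists v; intros rho hr; apply (lim1_incr_le (area (pm p f))); trivial.
  + intros; now apply pm_area_incr.
  + now apply lim1_area_partial.
- destruct (lim1_incr (area (pm p f)) v) as [u hu]; trivial.
  + intros; now apply pm_area_incr.
  + exists u; now apply lim1_area_partial.
Qed.

(** The p-th power of the A^p norm. Estimates are stated for it rather than for the norm, so that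
    they stay affine in integrals. *)
Definition mass (p : R) (f : Cx -> Cx) : R := area_int (pm p f).

Lemma mass_lim (p : R) (f : Cx -> Cx) : 0 < p -> Ap p f -> lim1 (area (pm p f)) (mass p f).
Proof.
intros hp [hf [v hv]]; assert (hd := pm_dcont p f hp hf).
assert (hv' : lim1 (area (pm p f)) v) by (now apply lim1_area_partial).
unfold mass; now rewrite (area_int_eq (pm p f) v).
Qed.

Lemma mass_ub (p : R) (f : Cx -> Cx) (rho : R) : 0 < p -> Ap p f -> 0 <= rho < 1 ->
  area (pm p f) rho <= mass p f.
Proof.
intros hp hf hr; apply (lim1_incr_le (area (pm p f))); trivial; [| now apply mass_lim].
intros; apply pm_area_incr; trivial; apply hf.
Qed.

Lemma mass_ge0 (p : R) (f : Cx -> Cx) : 0 < p -> Ap p f -> 0 <= mass p f.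
Proof. intros hp hf; rewrite <- (area_0 (pm p f)); apply mass_ub; trivial; lra. Qed.

Lemma mass_le (p : R) (f : Cx -> Cx) (B : R) : 0 < p -> Ap p f ->
  (forall rho, 0 <= rho < 1 -> area (pm p f) rho <= B) -> mass p f <= B.
Proof. intros hp hf h; apply (lim1_le (area (pm p f))); trivial; now apply mass_lim. Qed.

Lemma Ap_norm_mass (p : R) (f : Cx -> Cx) : Ap_norm p f = rpow (mass p f) (/ p).
Proof. reflexivity. Qed.

Lemma Ap_norm_one (p : R) (f : Cx -> Cx) : 0 < p -> Ap p f -> Ap_norm p f = 1 <-> mass p f = 1.
Proof.
intros hp hf; rewrite Ap_norm_mass; split; intros h.
- rewrite <- (rpow_inv' (mass p f) p), h; trivial; [apply rpow_one | now apply mass_ge0].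
- rewrite h; apply rpow_one.
Qed.

Lemma Mp_eq (p : R) (f : Cx -> Cx) (r : R) : 0 < p -> holo f -> 0 <= r < 1 -> Mp p f r = mean (pm p f) r.
Proof.
intros hp hf hr; unfold Mp, mean; f_equal; apply (Rint_RInt (fun t => pm p f (pt r t))).
apply circ_ex_RInt, dcont_circ'; trivial; now apply pm_dcont.
Qed.

Lemma Hp_iff (p : R) (f : Cx -> Cx) : 0 < p ->
  Hp p f <-> (holo f /\ exists B, forall r, 0 <= r < 1 -> mean (pm p f) r <= B).
Proof.
intros hp; split; intros [hf [B hB]]; split; trivial; exists B; intros r hr.
- rewrite <- Mp_eq; auto.
- rewrite Mp_eq; auto.
Qed.

Lemma Hp_norm_lub (p : R) (f : Cx -> Cx) : 0 < p -> Hp p f ->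
  is_lub (fun x => exists r, 0 <= r < 1 /\ x = rpow (Mp p f r) (/ p)) (Hp_norm p f).
Proof.
intros hp hf; apply (epsilon_spec (inhabits 0)
  (fun v => is_lub (fun x => exists r, 0 <= r < 1 /\ x = rpow (Mp p f r) (/ p)) v)).
destruct (completeness (fun x => exists r, 0 <= r < 1 /\ x = rpow (Mp p f r) (/ p))) as [v hv].
- apply (Hp_iff p f hp) in hf; destruct hf as [hh [B hB]].
  exists (rpow B (/ p)); intros x [r [hr ->]]; rewrite Mp_eq by trivial.
  apply rpow_le; [now apply Rinv_0_lt_compat |]; split; auto; now apply pm_mean_ge0.
- exists (rpow (Mp p f 0) (/ p)), 0; split; trivial; lra.
- now exists v.
Qed.

Lemma Hp_norm_ge0 (p : R) (f : Cx -> Cx) : 0 < p -> Hp p f -> 0 <= Hp_norm p f.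
Proof.
intros hp hf; apply Rle_trans with (rpow (Mp p f 0) (/ p)); [apply rpow_ge0 |].
apply (Hp_norm_lub p f hp hf); exists 0; split; trivial; lra.
Qed.

Lemma Hp_norm_ub (p : R) (f : Cx -> Cx) (r : R) : 0 < p -> Hp p f -> 0 <= r < 1 ->
  mean (pm p f) r <= rpow (Hp_norm p f) p.
Proof.
intros hp hf hr; assert (hh : holo f) by apply hf.
rewrite <- (rpow_inv' (mean (pm p f) r) p); trivial; [| now apply pm_mean_ge0].
apply rpow_le; trivial; split; [apply rpow_ge0 |].
apply (Hp_norm_lub p f hp hf); exists r; split; trivial; now rewrite Mp_eq.
Qed.

Lemma Hp_norm_le (p : R) (f : Cx -> Cx) (B : R) : 0 < p -> Hp p f ->
  (forall r, 0 <= r < 1 -> mean (pm p f) r <= B) -> Hp_norm p f <= rpow B (/ p).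
Proof.
intros hp hf h; assert (hh : holo f) by apply hf.
apply (Hp_norm_lub p f hp hf); intros x [r [hr ->]]; rewrite Mp_eq by trivial.
apply rpow_le; [now apply Rinv_0_lt_compat |]; split; auto; now apply pm_mean_ge0.
Qed.

Lemma area_le_mean_bound (p : R) (f : Cx -> Cx) (B rho : R) : 0 < p -> holo f ->
  (forall r, 0 <= r < 1 -> mean (pm p f) r <= B) -> 0 <= rho < 1 -> area (pm p f) rho <= B * rho ^ 2.
Proof.
intros hp hf h hr.
assert (k := area_tail_le_const (pm p f) 0 rho B (pm_dcont p f hp hf) ltac:(lra) ltac:(lra)).
rewrite area_0 in k; replace (B * (rho ^ 2 - 0 ^ 2)) with (B * rho ^ 2) in k by ring.
specialize (k ltac:(intros; apply h; lra)); lra.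
Qed.

Lemma Hp_Ap (p : R) (f : Cx -> Cx) : 0 < p -> Hp p f -> Ap p f.
Proof.
intros hp h; apply (Hp_iff p f hp) in h; destruct h as [hf [B hB]].
apply Ap_iff; trivial; split; trivial; exists B; intros rho hr.
apply Rle_trans with (1 := area_le_mean_bound p f B rho hp hf hB hr).
assert (0 <= B) by (apply Rle_trans with (2 := hB rho hr); now apply pm_mean_ge0).
assert (rho ^ 2 <= 1) by nra; nra.
Qed.

(** * The functional and its norm *)

Definition pair (k f : Cx -> Cx) (w : Cx) : R := fst (Cmul (f w) (Cconj (k w))).

(** The real part of [phi k f], which is what extremality concerns; the imaginary part is the real
    part at -i f. *)
Definition rphi (k f : Cx -> Cx) : R := area_int (pair k f).

Definition lcomb (a b : Cx) (f g : Cx -> Cx) (w : Cx) : Cx := Cadd (Cmul a (f w)) (Cmul b (g w)).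

Lemma holo_lcomb (a b : Cx) (f g : Cx -> Cx) : holo f -> holo g -> holo (lcomb a b f g).
Proof.
rewrite !holo_cdiff; intros hf hg z hz; apply cdiff_add; apply cdiff_mul;
  try apply cdiff_const; auto.
Qed.

Lemma pm_lcomb_le (p : R) (a b : Cx) (f g : Cx -> Cx) (w : Cx) : 0 < p ->
  pm p (lcomb a b f g) w <=
  rpow 2 p * rpow (Cmod a) p * pm p f w + rpow 2 p * rpow (Cmod b) p * pm p g w.
Proof.
intros hp; unfold pm, lcomb.
apply Rle_trans with (rpow (Cmod (Cmul a (f w)) + Cmod (Cmul b (g w))) p).
- apply rpow_le; trivial; split; [apply Cmod_ge0 | apply Cmod_tri].
- apply Rle_trans with (1 := rpow_sum p _ _ hp (Cmod_ge0 _) (Cmod_ge0 _)).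
  rewrite !Cmod_mul, !rpow_mult by apply Cmod_ge0; right; ring.
Qed.

Lemma dcont_add (f g : Cx -> R) : dcont f -> dcont g -> dcont (fun w => f w + g w).
Proof. intros hf hg z hz; apply rcont_plus; auto. Qed.

Lemma dcont_cmul (c : R) (f : Cx -> R) : dcont f -> dcont (fun w => c * f w).
Proof. intros hf z hz; apply rcont_scal; auto. Qed.

Lemma pm_mean_lcomb_le (p : R) (a b : Cx) (f g : Cx -> Cx) (r : R) : 0 < p -> holo f -> holo g ->
  0 <= r < 1 ->
  mean (pm p (lcomb a b f g)) r <= rpow 2 p * rpow (Cmod a) p * mean (pm p f) r +
    rpow 2 p * rpow (Cmod b) p * mean (pm p g) r.
Proof.
intros hp hf hg hr.
assert (h1 := dcont_circ' _ r (pm_dcont p f hp hf) hr); assert (h2 := dcont_circ' _ r (pm_dcont p g hp hg) hr).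
rewrite <- !mean_cmul by trivial.
rewrite <- mean_add by now apply circ_cmul.
apply mean_le.
- apply dcont_circ'; trivial; now apply pm_dcont, holo_lcomb.
- now apply circ_add; apply circ_cmul.
- intros t; now apply pm_lcomb_le.
Qed.

Lemma pm_area_lcomb_le (p : R) (a b : Cx) (f g : Cx -> Cx) (r : R) : 0 < p -> holo f -> holo g ->
  0 <= r < 1 ->
  area (pm p (lcomb a b f g)) r <= rpow 2 p * rpow (Cmod a) p * area (pm p f) r +
    rpow 2 p * rpow (Cmod b) p * area (pm p g) r.
Proof.
intros hp hf hg hr.
assert (h1 := pm_dcont p f hp hf); assert (h2 := pm_dcont p g hp hg).
rewrite <- !area_cmul by trivial.
rewrite <- area_add by (trivial; now apply dcont_cmul).
apply area_le; trivial.
- now apply pm_dcont, holo_lcomb.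
- now apply dcont_add; apply dcont_cmul.
- intros; now apply pm_lcomb_le.
Qed.

Lemma Hp_lcomb (p : R) (a b : Cx) (f g : Cx -> Cx) : 0 < p -> Hp p f -> Hp p g -> Hp p (lcomb a b f g).
Proof.
intros hp; rewrite !Hp_iff by trivial; intros [hf [B hB]] [hg [D hD]].
split; [now apply holo_lcomb |].
exists (rpow 2 p * rpow (Cmod a) p * B + rpow 2 p * rpow (Cmod b) p * D); intros r hr.
apply Rle_trans with (1 := pm_mean_lcomb_le p a b f g r hp hf hg hr).
apply Rplus_le_compat; apply Rmult_le_compat_l; auto; apply Rmult_le_pos; apply rpow_ge0.
Qed.

Lemma Ap_lcomb (p : R) (a b : Cx) (f g : Cx -> Cx) : 0 < p -> Ap p f -> Ap p g -> Ap p (lcomb a b f g).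
Proof.
intros hp; rewrite !Ap_iff by trivial; intros [hf [B hB]] [hg [D hD]].
split; [now apply holo_lcomb |].
exists (rpow 2 p * rpow (Cmod a) p * B + rpow 2 p * rpow (Cmod b) p * D); intros r hr.
apply Rle_trans with (1 := pm_area_lcomb_le p a b f g r hp hf hg hr).
apply Rplus_le_compat; apply Rmult_le_compat_l; auto; apply Rmult_le_pos; apply rpow_ge0.
Qed.

Lemma pair_dcont (k f : Cx -> Cx) : holo k -> holo f -> dcont (pair k f).
Proof.
intros hk hf z hz; apply (ccont_mul f (fun w => Cconj (k w))); [| apply ccont_conj]; now apply holo_ccont.
Qed.

Section Young.
Variables (p q : R).
Hypothesis hp : 1 < p.
Hypothesis hq : q = p / (p - 1).

Lemma q_gt1 : 1 < q.
Proof.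
subst q; apply (Rmult_lt_reg_r (p - 1)); [lra |]; unfold Rdiv; rewrite Rmult_assoc, Rinv_l; lra.
Qed.

(** Young's inequality with an arbitrarily small weight d on the side of f. It takes the place of
    Hoelder's inequality: bounds are sums of integrals and pass to annuli and limits termwise. *)
Definition young_const (d K : R) : Prop := 0 < d /\ 0 <= K /\
  forall x y, 0 <= x -> 0 <= y -> x * y <= d * rpow x p + K * rpow y q.

Lemma young_exists (d : R) : 0 < d -> exists K, young_const d K.
Proof. intros hd; destruct (rpow_young p q hp hq d hd) as [K [h1 h2]]; exists K; now split. Qed.

Lemma pair_young (d K : R) (k f : Cx -> Cx) (w : Cx) : young_const d K ->
  Rabs (pair k f w) <= d * pm p f w + K * pm q k w.
Proof.
intros [_ [_ h]]; unfold pair; apply Rle_trans with (1 := Cre_le _).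
rewrite Cmod_mul, Cmod_conj; apply h; apply Cmod_ge0.
Qed.

Lemma pair_mean_young (d K : R) (k f : Cx -> Cx) (r : R) : young_const d K -> holo k -> holo f ->
  0 <= r < 1 -> Rabs (mean (pair k f) r) <= d * mean (pm p f) r + K * mean (pm q k) r.
Proof.
intros hy hk hf hr; assert (hq1 := q_gt1).
assert (h1 := dcont_circ' _ r (pm_dcont p f ltac:(lra) hf) hr).
assert (h2 := dcont_circ' _ r (pm_dcont q k ltac:(lra) hk) hr).
assert (h3 := dcont_circ' _ r (pair_dcont k f hk hf) hr).
rewrite <- !mean_cmul, <- mean_add by (trivial; now apply circ_cmul).
apply Rabs_le; split.
- replace (- mean (fun w => d * pm p f w + K * pm q k w) r) with
    (mean (fun w => -1 * (d * pm p f w + K * pm q k w)) r).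
  2: { rewrite (mean_cmul (-1) (fun w => d * pm p f w + K * pm q k w)) by (now apply circ_add; apply circ_cmul); ring. }
  apply mean_le; trivial; [apply circ_cmul; now apply circ_add; apply circ_cmul |].
  intros t; assert (h := pair_young d K k f (pt r t) hy); apply Rabs_le_between in h; lra.
- apply mean_le; trivial; [now apply circ_add; apply circ_cmul |].
  intros t; assert (h := pair_young d K k f (pt r t) hy); apply Rabs_le_between in h; lra.
Qed.

Lemma pair_area_tail (d K : R) (k f : Cx -> Cx) (a b : R) : young_const d K -> holo k -> holo f ->
  0 <= a <= b -> b < 1 ->
  Rabs (area (pair k f) b - area (pair k f) a) <=
    d * (area (pm p f) b - area (pm p f) a) + K * (area (pm q k) b - area (pm q k) a).
Proof.
intros hy hk hf hab hb; assert (hq1 := q_gt1).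
assert (h1 := pm_dcont p f ltac:(lra) hf); assert (h2 := pm_dcont q k ltac:(lra) hk).
assert (h3 := pair_dcont k f hk hf).
assert (hA : forall x, 0 <= x < 1 -> area (fun w => d * pm p f w + K * pm q k w) x =
  d * area (pm p f) x + K * area (pm q k) x).
{ intros x hx; rewrite (area_add (fun w => d * pm p f w) (fun w => K * pm q k w)) by (trivial; now apply dcont_cmul).
  now rewrite !area_cmul. }
assert (hd : dcont (fun w => d * pm p f w + K * pm q k w)) by (now apply dcont_add; apply dcont_cmul).
apply Rabs_le; split.
- assert (k1 := area_tail_le (fun w => -1 * (d * pm p f w + K * pm q k w)) (pair k f) a b
    (dcont_cmul _ _ hd) h3 hab hb).
  rewrite !area_cmul, !hA in k1 by (trivial; lra).
  specialize (k1 ltac:(intros w _; assert (h := pair_young d K k f w hy); apply Rabs_le_between in h; lra)); lra.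
- assert (k1 := area_tail_le (pair k f) (fun w => d * pm p f w + K * pm q k w) a b h3 hd hab hb).
  rewrite !hA in k1 by lra.
  specialize (k1 ltac:(intros w _; assert (h := pair_young d K k f w hy); apply Rabs_le_between in h; lra)); lra.
Qed.

(* Adding the Young majorant makes the integrand nonnegative. *)
Lemma pair_lim (k f : Cx -> Cx) : Hp q k -> Ap p f -> lim1 (area (pair k f)) (rphi k f).
Proof.
intros hk hf; assert (hq1 := q_gt1).
destruct (young_exists 1 Rlt_0_1) as [K hK].
assert (hk1 : holo k) by apply hk; assert (hf1 : holo f) by apply hf.
assert (hkA : Ap q k) by (apply Hp_Ap; trivial; lra).
assert (hK0 : 0 <= K) by apply hK.
assert (hp0 : 0 < p) by lra; assert (hq0 : 0 < q) by lra.
set (S := fun x => area (pair k f) x + (1 * area (pm p f) x + K * area (pm q k) x)).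
assert (hS : exists v, lim1 S v).
{ apply (lim1_incr S (2 * (mass p f + K * mass q k))).
  - intros x y hxy hy; assert (h := pair_area_tail 1 K k f x y hK hk1 hf1 hxy hy).
    apply Rabs_le_between in h; unfold S; lra.
  - intros x hx; assert (h := pair_area_tail 1 K k f 0 x hK hk1 hf1 ltac:(lra) ltac:(lra)).
    rewrite !area_0 in h; apply Rabs_le_between in h.
    assert (k1 := mass_ub p f x hp0 hf hx); assert (k2 := mass_ub q k x hq0 hkA hx).
    assert (k3 := Rmult_le_compat_l K _ _ hK0 k2); unfold S; lra. }
destruct hS as [v hv].
assert (hT := lim1_add _ _ _ _ hv (lim1_cmul (-1) _ _ (lim1_add _ _ _ _
  (lim1_cmul 1 _ _ (mass_lim p f hp0 hf)) (lim1_cmul K _ _ (mass_lim q k hq0 hkA))))).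
assert (hlim : lim1 (area (pair k f)) (v + -1 * (1 * mass p f + K * mass q k))).
{ apply lim1_ext with (2 := hT); intros; unfold S; ring. }
unfold rphi; rewrite (area_int_eq (pair k f) _ (pair_dcont k f hk1 hf1) hlim); trivial.
Qed.

Lemma rphi_tail (d K : R) (k f : Cx -> Cx) (a : R) : young_const d K -> Hp q k -> Ap p f -> 0 <= a < 1 ->
  Rabs (rphi k f - area (pair k f) a) <=
    d * (mass p f - area (pm p f) a) + K * (mass q k - area (pm q k) a).
Proof.
intros hy hk hf ha; assert (hq1 := q_gt1).
assert (hkA : Ap q k) by (apply Hp_Ap; trivial; lra).
assert (hk1 : holo k) by apply hk; assert (hf1 : holo f) by apply hf.
assert (hlim := pair_lim k f hk hf).
assert (hb : forall x, a <= x < 1 -> Rabs (area (pair k f) x - area (pair k f) a) <=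
   d * (mass p f - area (pm p f) a) + K * (mass q k - area (pm q k) a)).
{ intros x hx; apply Rle_trans with (1 := pair_area_tail d K k f a x hy hk1 hf1 ltac:(lra) ltac:(lra)).
  apply Rplus_le_compat; apply Rmult_le_compat_l; try apply hy.
  - apply Rlt_le, hy.
  - assert (h := mass_ub p f x ltac:(lra) hf ltac:(lra)); lra.
  - assert (h := mass_ub q k x ltac:(lra) hkA ltac:(lra)); lra. }
set (B := d * (mass p f - area (pm p f) a) + K * (mass q k - area (pm q k) a)) in *.
apply Rabs_le; split.
- assert (h := lim1_ge (area (pair k f)) (rphi k f) (area (pair k f) a - B) a hlim ltac:(lra)
    ltac:(intros x hx; assert (h := hb x hx); apply Rabs_le_between in h; lra)); lra.
- assert (h := lim1_ge (fun x => -1 * area (pair k f) x) (-1 * rphi k f) (- area (pair k f) a - B) a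
    (lim1_cmul _ _ _ hlim) ltac:(lra)
    ltac:(intros x hx; assert (h := hb x hx); apply Rabs_le_between in h; lra)); lra.
Qed.

Lemma rphi_bound (d K : R) (k f : Cx -> Cx) : young_const d K -> Hp q k -> Ap p f ->
  Rabs (rphi k f) <= d * mass p f + K * mass q k.
Proof.
intros hy hk hf; assert (h := rphi_tail d K k f 0 hy hk hf ltac:(lra)).
rewrite !area_0, !Rminus_0_r in h; exact h.
Qed.

Lemma rphi_lcomb (a b : R) (k f g : Cx -> Cx) : Hp q k -> Ap p f -> Ap p g ->
  rphi k (lcomb (a, 0) (b, 0) f g) = a * rphi k f + b * rphi k g.
Proof.
intros hk hf hg.
assert (h := lim1_add _ _ _ _ (lim1_cmul a _ _ (pair_lim k f hk hf)) (lim1_cmul b _ _ (pair_lim k g hk hg))).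
assert (hk1 : holo k) by apply hk; assert (hf1 : holo f) by apply hf; assert (hg1 : holo g) by apply hg.
apply area_int_eq; [now apply pair_dcont, holo_lcomb |].
apply lim1_ext with (2 := h); intros x hx.
assert (h1 := pair_dcont k f hk1 hf1); assert (h2 := pair_dcont k g hk1 hg1).
rewrite <- !area_cmul, <- area_add by (trivial; now apply dcont_cmul).
apply area_ext; trivial; intros w _; unfold pair, lcomb, Cadd, Cmul, Cconj; simpl; ring.
Qed.

Lemma mass_scal (c : Cx) (f : Cx -> Cx) : Ap p f ->
  Ap p (fun w => Cmul c (f w)) /\ mass p (fun w => Cmul c (f w)) = rpow (Cmod c) p * mass p f.
Proof.
intros hf; assert (hf1 : holo f) by apply hf.
assert (hpm : forall w, pm p (fun w => Cmul c (f w)) w = rpow (Cmod c) p * pm p f w).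
{ intros w; unfold pm; rewrite Cmod_mul, rpow_mult by apply Cmod_ge0; trivial. }
assert (hh : holo (fun w => Cmul c (f w))).
{ rewrite holo_cdiff in *; intros z hz; apply cdiff_mul; [apply cdiff_const | auto]. }
assert (ha : forall x, 0 <= x < 1 -> area (pm p (fun w => Cmul c (f w))) x = rpow (Cmod c) p * area (pm p f) x).
{ intros x hx; rewrite <- area_cmul by (trivial; apply pm_dcont; trivial; lra).
  apply area_ext; trivial; intros; apply hpm. }
assert (hlim : lim1 (area (pm p (fun w => Cmul c (f w)))) (rpow (Cmod c) p * mass p f)).
{ apply lim1_ext with (fun x => rpow (Cmod c) p * area (pm p f) x); [intros; symmetry; auto |].
  apply lim1_cmul, mass_lim; trivial; lra. }
assert (hd := pm_dcont p _ ltac:(lra) hh).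
split.
- split; trivial; exists (rpow (Cmod c) p * mass p f); now apply lim1_area_partial.
- now apply area_int_eq.
Qed.

Lemma phi_snd (k g : Cx -> Cx) : snd (phi k g) = rphi k (fun w => Cmul (0, -1) (g w)).
Proof.
unfold phi, rphi, pair; simpl snd; f_equal; apply functional_extensionality; intros w.
unfold Cim, Cmul, Cconj; simpl; ring.
Qed.

Lemma phi_Cmod_bound (d K : R) (k g : Cx -> Cx) : young_const d K -> Hp q k -> Ap p g ->
  Cmod (phi k g) <= 2 * (d * mass p g + K * mass q k).
Proof.
intros hy hk hg.
apply Rle_trans with (1 := Cmod_le_abs _).
assert (h1 := rphi_bound d K k g hy hk hg).
destruct (mass_scal (0, -1) g hg) as [h2 h3].
assert (h4 := rphi_bound d K k _ hy hk h2).
rewrite h3 in h4; replace (Cmod (0, -1)) with 1 in h4.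
- rewrite rpow_one, <- phi_snd in h4; change (fst (phi k g)) with (rphi k g); lra.
- symmetry; unfold Cmod; simpl; replace (0 * (0 * 1) + -1 * (-1 * 1)) with 1 by ring; apply sqrt_1.
Qed.

Definition normalized (g : Cx -> Cx) : Prop := Ap p g /\ Ap_norm p g = 1.

Lemma normalized_mass (g : Cx -> Cx) : normalized g -> mass p g = 1.
Proof. intros [h1 h2]; apply Ap_norm_one; trivial; lra. Qed.

(** [phi_norm] is picked by [epsilon], so it is a supremum only once the set of values is bounded,
    by Young, and nonempty, by the witness [g0]. *)
Lemma phi_norm_lub (k g0 : Cx -> Cx) : Hp q k -> normalized g0 ->
  is_lub (fun x => exists g, Ap p g /\ Ap_norm p g = 1 /\ x = Cmod (phi k g)) (phi_norm p k).
Proof.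
intros hk [h1 h2].
apply (epsilon_spec (inhabits 0)
  (fun v => is_lub (fun x => exists g, Ap p g /\ Ap_norm p g = 1 /\ x = Cmod (phi k g)) v)).
destruct (completeness (fun x => exists g, Ap p g /\ Ap_norm p g = 1 /\ x = Cmod (phi k g))) as [v hv].
- destruct (young_exists 1 Rlt_0_1) as [K hK].
  exists (2 * (1 * 1 + K * mass q k)); intros x [g [hg [hg1 ->]]].
  apply Rle_trans with (1 := phi_Cmod_bound 1 K k g hK hk hg).
  rewrite (normalized_mass g) by (now split); lra.
- exists (Cmod (phi k g0)), g0; auto.
- now exists v.
Qed.

Lemma phi_norm_ge0 (k g0 : Cx -> Cx) : Hp q k -> normalized g0 -> 0 <= phi_norm p k.
Proof.
intros hk hg; apply Rle_trans with (Cmod (phi k g0)); [apply Cmod_ge0 |].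
apply (phi_norm_lub k g0 hk hg); exists g0; repeat split; apply hg.
Qed.

Lemma rphi_real_scal (c : R) (k g : Cx -> Cx) : Hp q k -> Ap p g ->
  rphi k (fun w => Cmul (c, 0) (g w)) = c * rphi k g.
Proof.
intros hk hg; rewrite <- (Rplus_0_r (c * rphi k g)), <- (Rmult_0_l (rphi k g)) at 1.
rewrite <- rphi_lcomb by trivial; f_equal; apply functional_extensionality; intros w.
unfold lcomb, Cadd, Cmul; simpl; f_equal; ring.
Qed.

(* Bernoulli's inequality turns the defining property
   [rphi k g <= phi_norm * |g|] into a bound affine in [|g|^p]. *)
Lemma rphi_extremal_bound (k g0 g : Cx -> Cx) : Hp q k -> normalized g0 -> Ap p g ->
  rphi k g <= phi_norm p k * (1 + (mass p g - 1) / p).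
Proof.
intros hk hg0 hg; assert (hn := phi_norm_ge0 k g0 hk hg0); assert (hq1 := q_gt1).
destruct (mass_ge0 p g ltac:(lra) hg) as [hm | hm].
- set (x := rpow (mass p g) (/ p)).
  assert (hx : 0 < x) by now apply rpow_gt0.
  assert (hxp : rpow x p = mass p g) by (unfold x; apply rpow_inv'; lra).
  destruct (mass_scal (/ x, 0) g hg) as [h1 h2].
  assert (hnorm : normalized (fun w => Cmul (/ x, 0) (g w))).
  { split; trivial; apply Ap_norm_one; trivial; [lra |].
    rewrite h2, Cmod_real, Rabs_pos_eq by (apply Rlt_le, Rinv_0_lt_compat, hx).
    rewrite <- hxp, <- rpow_mult by (try apply Rlt_le, Rinv_0_lt_compat; lra).
    rewrite Rinv_l by lra; apply rpow_one. }
  assert (h3 : rphi k (fun w => Cmul (/ x, 0) (g w)) <= phi_norm p k).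
  { apply Rle_trans with (Cmod (phi k (fun w => Cmul (/ x, 0) (g w)))).
    - apply Rle_trans with (1 := Rle_abs _), (Cre_le (phi k (fun w => Cmul (/ x, 0) (g w)))).
    - apply (phi_norm_lub k g0 hk hg0); eexists; repeat split; try apply hnorm. }
  rewrite rphi_real_scal in h3 by trivial.
  apply (Rmult_le_compat_l x) in h3; [| lra].
  rewrite <- Rmult_assoc, Rinv_r, Rmult_1_l in h3 by lra.
  apply Rle_trans with (1 := h3); rewrite Rmult_comm; apply Rmult_le_compat_l; trivial.
  assert (hb := bernoulli p x ltac:(lra) ltac:(lra)); rewrite hxp in hb.
  apply (Rmult_le_reg_l p); [lra |].
  replace (p * (1 + (mass p g - 1) / p)) with (p + (mass p g - 1)) by (field; lra); lra.
(* A function of mass 0 cannot pair to a positive number: a large multiple, still of mass 0, would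
   violate the Young bound. *)
- assert (h0 : rphi k g <= 0).
  { apply Rnot_lt_le; intros hpos.
    destruct (young_exists 1 Rlt_0_1) as [K hK].
    set (c := (K * mass q k + 1) / rphi k g).
    destruct (mass_scal (c, 0) g hg) as [h1 h2].
    assert (h3 := rphi_bound 1 K k _ hK hk h1).
    rewrite h2, <- hm, rphi_real_scal in h3 by trivial.
    assert (h4 := Rle_abs (c * rphi k g)).
    replace (c * rphi k g) with (K * mass q k + 1) in * by (unfold c; field; lra); lra. }
  rewrite <- hm; apply Rle_trans with (1 := h0); apply Rmult_le_pos; trivial.
  replace (1 + (0 - 1) / p) with ((p - 1) / p) by (field; lra).
  apply Rmult_le_pos; [lra | apply Rlt_le, Rinv_0_lt_compat; lra].
Qed.

Lemma rphi_kernel_sub (k1 k2 g : Cx -> Cx) : Hp q k1 -> Hp q k2 -> Ap p g ->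
  rphi (fun w => Csub (k1 w) (k2 w)) g = rphi k1 g - rphi k2 g.
Proof.
intros h1 h2 hg.
assert (h := lim1_add _ _ _ _ (pair_lim k1 g h1 hg) (lim1_cmul (-1) _ _ (pair_lim k2 g h2 hg))).
assert (hk1 : holo k1) by apply h1; assert (hk2 : holo k2) by apply h2; assert (hg1 : holo g) by apply hg.
replace (rphi k1 g - rphi k2 g) with (rphi k1 g + -1 * rphi k2 g) by ring.
assert (hs : holo (fun w => Csub (k1 w) (k2 w))).
{ rewrite holo_cdiff in *; intros z hz; apply cdiff_sub; auto. }
apply area_int_eq; [now apply pair_dcont |].
apply lim1_ext with (2 := h); intros x hx.
assert (d1 := pair_dcont k1 g hk1 hg1); assert (d2 := pair_dcont k2 g hk2 hg1).
rewrite <- area_cmul, <- area_add by (trivial; now apply dcont_cmul).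
apply area_ext; trivial; intros w _; unfold pair, Csub, Copp, Cadd, Cmul, Cconj; simpl; ring.
Qed.

Lemma Hp_sub (r : R) (f g : Cx -> Cx) : 0 < r -> Hp r f -> Hp r g -> Hp r (fun w => Csub (f w) (g w)).
Proof.
intros hr hf hg; assert (h := Hp_lcomb r Cone (Copp Cone) f g hr hf hg).
replace (fun w => Csub (f w) (g w)) with (lcomb Cone (Copp Cone) f g); trivial.
apply functional_extensionality; intros w; unfold lcomb; ring.
Qed.

(** Each normalized g is tested against both kernels; the difference kernel contributes at most its
    Young bound, in which the mass of g is 1. *)
Lemma phi_norm_perturb (d K : R) (k1 k2 g0 : Cx -> Cx) : young_const d K -> Hp q k1 -> Hp q k2 ->
  normalized g0 ->
  phi_norm p k1 <= phi_norm p k2 + 2 * (d + K * mass q (fun w => Csub (k1 w) (k2 w))).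
Proof.
intros hy h1 h2 hg0; assert (hq1 := q_gt1); apply (phi_norm_lub k1 g0 h1 hg0).
intros x [g [hg [hg1 ->]]].
assert (hn : Cmod (phi k2 g) <= phi_norm p k2) by (apply (phi_norm_lub k2 g0 h2 hg0); exists g; auto).
assert (h3 := phi_Cmod_bound d K (fun w => Csub (k1 w) (k2 w)) g hy (Hp_sub q k1 k2 ltac:(lra) h1 h2) hg).
rewrite (normalized_mass g) in h3 by (now split).
assert (h4 : phi (fun w => Csub (k1 w) (k2 w)) g = Csub (phi k1 g) (phi k2 g)).
{ rewrite <- (Cx_eta (phi (fun w => Csub (k1 w) (k2 w)) g)).
  change (fst (phi (fun w => Csub (k1 w) (k2 w)) g)) with (rphi (fun w => Csub (k1 w) (k2 w)) g).
  rewrite phi_snd, !rphi_kernel_sub; trivial; [| apply mass_scal; trivial].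
  rewrite <- !phi_snd; reflexivity. }
rewrite h4 in h3; assert (h5 := Cmod_tri_sub (phi k1 g) (phi k2 g)); lra.
Qed.
End Young.

(** * Dilations and membership in the Hardy space *)

Definition dil (s : R) (f : Cx -> Cx) (w : Cx) : Cx := f (Cmul (s, 0) w).

Lemma holo_dil (s : R) (f : Cx -> Cx) : 0 <= s <= 1 -> holo f -> holo (dil s f).
Proof.
rewrite !holo_cdiff; intros hs hf z hz; unfold dil.
apply (cdiff_comp f (fun w => Cmul (s, 0) w)).
- apply cdiff_mul; [apply cdiff_const | apply cdiff_id].
- apply hf; rewrite Cmod_scal, Rabs_pos_eq by lra.
  assert (h := Cmod_ge0 z); nra.
Qed.

Lemma pm_mean_dil (p s r : R) (f : Cx -> Cx) : mean (pm p (dil s f)) r = mean (pm p f) (s * r).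
Proof. exact (mean_dil (pm p f) s r). Qed.

Lemma Hp_dil (p s : R) (f : Cx -> Cx) : 1 <= p -> 0 <= s < 1 -> holo f -> Hp p (dil s f).
Proof.
intros hp hs hf; apply Hp_iff; [lra |]; split; [apply holo_dil; trivial; lra |].
exists (mean (pm p f) s); intros r hr; rewrite pm_mean_dil.
apply pm_mean_monotone; trivial; [| lra]; nra.
Qed.

Lemma area_lim_dil (g : Cx -> R) (t : R) : dcont g -> 0 <= t < 1 -> lim1 (fun x => area g (t * x)) (area g t).
Proof.
intros hg ht.
destruct (continuity_ab_maj (fun r => Rabs (mean g r)) 0 t) as [m [hm _]]; [lra | |].
{ intros c hc; apply (continuity_pt_comp (mean g) Rabs); [| apply Rcontinuity_abs].
  apply dcont_mean_continuous; trivial; lra. }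
set (B := Rabs (mean g m)) in *.
assert (hB : 0 <= B) by apply Rabs_pos.
intros eps heps.
exists (Rmin 1 (eps / (2 * B + 1))); split; [apply Rmin_pos; [lra | apply Rdiv_lt_0_compat; lra] |].
intros x hx; assert (h1 := Rmin_l 1 (eps / (2 * B + 1))); assert (h2 := Rmin_r 1 (eps / (2 * B + 1))).
assert (htx : 0 <= t * x <= t) by nra.
assert (k1 := area_tail_le_const g (t * x) t B hg htx ltac:(lra)
  ltac:(intros r hr; apply Rle_trans with (2 := hm r ltac:(lra)); apply Rle_abs)).
assert (k2 := area_tail_ge_const g (t * x) t (- B) hg htx ltac:(lra)
  ltac:(intros r hr; assert (h := hm r ltac:(lra)); apply Rabs_le_between in h; lra)).
assert (k3 : B * (t ^ 2 - (t * x) ^ 2) < eps).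
{ apply Rle_lt_trans with (2 * B * (1 - x)).
  - replace (B * (t ^ 2 - (t * x) ^ 2)) with (B * (t ^ 2 * (1 - x ^ 2))) by ring.
    replace (2 * B * (1 - x)) with (B * (2 * (1 - x))) by ring.
    apply Rmult_le_compat_l; trivial.
    apply Rle_trans with (1 * (1 - x ^ 2)); [apply Rmult_le_compat_r; nra | nra].
  - apply Rle_lt_trans with ((2 * B + 1) * (1 - x)); [nra |].
    apply Rlt_le_trans with ((2 * B + 1) * (eps / (2 * B + 1))); [apply Rmult_lt_compat_l; lra |].
    right; field; lra. }
apply Rabs_def1; lra.
Qed.

Lemma mass_dil (p s : R) (f : Cx -> Cx) : 1 <= p -> 0 < s < 1 -> holo f ->
  mass p (dil s f) = / s ^ 2 * area (pm p f) s.
Proof.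
intros hp hs hf; assert (hd := pm_dcont p f ltac:(lra) hf).
apply area_int_eq; [apply pm_dcont; [lra | apply holo_dil; trivial; lra] |].
apply lim1_ext with (fun x => / s ^ 2 * area (pm p f) (s * x)).
- intros x hx; symmetry; apply (area_dil (pm p f)); trivial; nra.
- apply lim1_cmul, area_lim_dil; trivial; lra.
Qed.

(* [f(w) conj(k(x y / conj w))] is holomorphic in [w], so the mean of
   [f(x e^it) conj(k(y e^it))] depends on the product [x y] only. *)
Lemma pair_mean_dil (k f : Cx -> Cx) (t r : R) : holo k -> holo f -> 0 < t < 1 -> 0 <= r < 1 ->
  mean (pair k (dil (t ^ 2) f)) r = mean (pair k f) (t * r).
Proof.
rewrite !holo_cdiff; intros hk hf ht hr.
destruct (Req_dec r 0) as [-> | hr0].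
{ rewrite Rmult_0_r; apply mean_ext; intros s; unfold pair, dil; rewrite pt_0.
  f_equal; f_equal; f_equal; ring. }
assert (hr' : 0 < r) by (destruct (proj1 hr); [trivial | congruence]).
(* The common product of radii: (t^2 r) r = (t r) (t r). *)
set (P := t ^ 2 * r ^ 2).
set (G := fun w => Cmul (f w) (Cconj (k (Cconj (Cmul (P, 0) (Cinv w)))))).
assert (htr : 0 < t * r) by (apply Rmult_lt_0_compat; lra).
assert (hab : 0 < t ^ 2 * r <= t * r) by (replace (t ^ 2 * r) with (t * (t * r)) by ring; split; nra).
assert (hinv : forall x s, 0 < x -> Cinv (pt x s) = pt (/ x) (- s)).
{ intros x s hx; assert (hne : pt x s <> C0).
  { intros h; apply (f_equal Cmod) in h; rewrite Cmod_pt, Cmod_C0, Rabs_pos_eq in h; lra. }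
  replace (Cinv (pt x s)) with (Cmul (Cmul (pt (/ x) (- s)) (pt x s)) (Cinv (pt x s))); [field; trivial |].
  rewrite pt_mul, Rinv_l by lra; replace (- s + s) with 0 by ring.
  replace (pt 1 0) with Cone by (unfold pt, Cone; rewrite cos_0, sin_0; f_equal; ring); ring. }
assert (h := mean_fst_const G (t ^ 2 * r) (t * r) hab).
assert (hG : forall x s, t ^ 2 * r <= x <= t * r -> cdiff G (pt x s)).
{ intros x s hx; assert (hx0 : 0 < x) by lra.
  assert (hne : pt x s <> C0).
  { intros h0; apply (f_equal Cmod) in h0; rewrite Cmod_pt, Cmod_C0, Rabs_pos_eq in h0; lra. }
  apply cdiff_mul.
  - apply hf; rewrite Cmod_pt, Rabs_pos_eq by lra; nra.
  - apply (cdiff_comp (fun w => Cconj (k (Cconj w))) (fun w => Cmul (P, 0) (Cinv w))).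
    + apply cdiff_mul; [apply cdiff_const |]; now apply Cinv_cdiff.
    + apply cdiff_reflect, hk; rewrite Cmod_conj, hinv, pt_scal, Cmod_pt by lra.
      rewrite Rabs_pos_eq.
      * apply (Rmult_lt_reg_r x); trivial; rewrite Rmult_assoc, Rinv_l by lra; unfold P; nra.
      * apply Rmult_le_pos; [unfold P; nra | apply Rlt_le, Rinv_0_lt_compat; lra]. }
specialize (h hG).
assert (hGpt : forall x s, 0 < x -> G (pt x s) = Cmul (f (pt x s)) (Cconj (k (pt (P / x) s)))).
{ intros x s hx; unfold G; rewrite hinv, pt_scal, pt_conj by trivial; now rewrite Ropp_involutive. }
rewrite (mean_ext (pair k f) (fun w => fst (G w))), <- h.
- unfold mean; f_equal; apply RInt_ext; intros s _; rewrite hGpt by lra.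
  unfold pair, dil; rewrite pt_scal; now replace (P / (t ^ 2 * r)) with r by (unfold P; field; lra).
- intros s; rewrite hGpt by lra; unfold pair; now replace (P / (t * r)) with (t * r) by (unfold P; field; lra).
Qed.

Lemma pair_area_dil (k f : Cx -> Cx) (t rho : R) : holo k -> holo f -> 0 < t < 1 -> 0 <= rho < 1 ->
  area (pair k (dil (t ^ 2) f)) rho = / t ^ 2 * area (pair k f) (t * rho).
Proof.
intros hk hf ht hr; rewrite <- area_dil by (try (now apply pair_dcont); nra).
apply RInt_ext; intros x hx; rewrite Rmin_left, Rmax_right in hx by lra.
rewrite pair_mean_dil, mean_dil by (trivial; lra); reflexivity.
Qed.

(** The pairing with the dilated function is a rescaled pairing of the undilated one over |z| < t;
    for extremal f, what is lost is a tail near the boundary. *)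
Lemma rphi_dil (k f : Cx -> Cx) (t : R) : holo k -> holo f -> 0 < t < 1 ->
  rphi k (dil (t ^ 2) f) = / t ^ 2 * area (pair k f) t.
Proof.
intros hk hf ht; assert (hd := pair_dcont k f hk hf).
apply area_int_eq; [apply pair_dcont; trivial; apply holo_dil; trivial; nra |].
apply lim1_ext with (fun x => / t ^ 2 * area (pair k f) (t * x)).
- intros x hx; symmetry; now apply pair_area_dil.
- apply lim1_cmul, area_lim_dil; trivial; lra.
Qed.

(** Harnack's bound: on |w| = s one has |w - a| >= s - |a|, so the Poisson kernel is at most (s +
    |a|) / (s - |a|). *)
Lemma pm_point_bound (p : R) (f : Cx -> Cx) (a : Cx) (s : R) : 1 <= p -> holo f -> Cmod a < s < 1 ->
  pm p f a <= (s + Cmod a) / (s - Cmod a) * mean (pm p f) s.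
Proof.
intros hp hf hs; assert (ha := Cmod_ge0 a).
assert (hd : circ (pm p f) s) by (apply dcont_circ'; [apply pm_dcont; trivial; lra | lra]).
apply Rle_trans with (1 := poisson_jensen p f a s hp ltac:(lra)
  ltac:(intros w hw; apply (proj1 (holo_cdiff f) hf); lra)).
rewrite <- mean_cmul by trivial; apply mean_le.
- apply circ_mult; [apply poisson_kernel_circ; lra | exact hd].
- now apply circ_cmul.
- intros t; apply Rmult_le_compat_r; [apply rpow_ge0 |].
  unfold poisson_kernel.
  assert (k := Cmod_sub_ge (pt s t) a); rewrite Cmod_pt, Rabs_pos_eq in k by lra.
  apply Rle_trans with ((s ^ 2 - Cmod a ^ 2) * / (s - Cmod a) ^ 2).
  + apply Rmult_le_compat_l; [nra |]; apply Rinv_le_contravar; [apply pow_lt; lra |].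
    apply pow_incr; lra.
  + right; field; lra.
Qed.

(** * Hardy space bounds for extremal functions *)

Section Regularity.
Variables (p q : R).
Hypothesis hp : 1 < p.
Hypothesis hq : q = p / (p - 1).

Let hq1 : 1 < q := q_gt1 p q hp hq.

(** The kernel lies in H^q but perhaps not in A^p, so it is tested against its own dilation k(t^2
    z): the pairing is t^-2 times the integral of |k|^2 over |z| < t, which is positive. *)
Lemma phi_norm_pos (k g0 : Cx -> Cx) : Hp q k -> not_zero k -> normalized p g0 -> 0 < phi_norm p k.
Proof.
intros hk [z0 [hz0 hkz]] hg0.
destruct (phi_norm_ge0 p q hp hq k g0 hk hg0) as [h | h]; trivial; exfalso.
assert (hkh : holo k) by apply hk; assert (hz := Cmod_ge0 z0).
set (r1 := (1 + Cmod z0) / 2); set (t := (1 + r1) / 2).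
assert (hr1 : Cmod z0 < r1 < 1) by (unfold r1; lra).
assert (ht : r1 < t < 1) by (unfold t; lra).
assert (hD := Hp_dil p (t ^ 2) k ltac:(lra) ltac:(nra) hkh).
assert (hE := rphi_extremal_bound p q hp hq k g0 (dil (t ^ 2) k) hk hg0 (Hp_Ap p _ ltac:(lra) hD)).
rewrite <- h, Rmult_0_l, rphi_dil in hE by (trivial; lra).
assert (ht2 : 0 < / t ^ 2) by (apply Rinv_0_lt_compat, pow_lt; lra).
assert (hpos : 0 < area (pair k k) t); [| nra].
rewrite (area_ext (pair k k) (pm 2 k)); [| lra |].
2: { intros w _; unfold pair, pm; rewrite rpow_2 by apply Cmod_ge0; now rewrite Cmul_conj. }
assert (hm : 0 < mean (pm 2 k) r1).
{ assert (k1 := pm_point_bound 2 k z0 r1 ltac:(lra) hkh hr1).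
  assert (k2 : 0 < pm 2 k z0) by (unfold pm; now apply rpow_gt0, Cmod_gt0).
  assert (k3 : 0 < (r1 + Cmod z0) / (r1 - Cmod z0)) by (apply Rdiv_lt_0_compat; lra).
  nra. }
assert (hd := pm_dcont 2 k ltac:(lra) hkh).
assert (k1 := area_tail_ge_const (pm 2 k) r1 t (mean (pm 2 k) r1) hd ltac:(lra) ltac:(lra)
  ltac:(intros r hr; apply pm_mean_monotone; trivial; lra)).
assert (k2 := area_ge0 (pm 2 k) r1 hd ltac:(intros; apply pm_ge0) ltac:(lra)).
assert (0 < mean (pm 2 k) r1 * (t ^ 2 - r1 ^ 2)) by (apply Rmult_lt_0_compat; [trivial | nra]).
lra.
Qed.

Lemma extremal_normalized (k F : Cx -> Cx) : is_extremal p k F -> normalized p F.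
Proof. intros [h1 [h2 _]]; now split. Qed.

(** This is [rphi_extremal_bound] at F(t^2 z), multiplied by t^4 to clear the factor t^-4 of its
    mass and t^-2 of its pairing. The left side is the mass of an annulus; the right side is of
    order 1 - t plus a tail of the pairing. *)
Lemma extremal_dil (k F : Cx -> Cx) (t : R) : Hp q k -> is_extremal p k F -> 0 < t < 1 ->
  phi_norm p k * (1 - area (pm p F) (t ^ 2)) / p <=
  phi_norm p k * (1 - t ^ 4) / p + phi_norm p k * t ^ 4 - t ^ 2 * area (pair k F) t.
Proof.
intros hk hF ht; assert (hn := extremal_normalized k F hF).
assert (hkh : holo k) by apply hk; assert (hFh : holo F) by apply hF.
assert (ht2 : 0 < t ^ 2 < 1) by nra.
assert (hE := rphi_extremal_bound p q hp hq k F (dil (t ^ 2) F) hk hn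
  (Hp_Ap p _ ltac:(lra) (Hp_dil p (t ^ 2) F ltac:(lra) ltac:(lra) hFh))).
rewrite rphi_dil, mass_dil in hE by (trivial; lra).
apply (Rmult_le_compat_l (t ^ 4)) in hE; [| apply pow_le; lra].
replace (t ^ 4 * (/ t ^ 2 * area (pair k F) t)) with (t ^ 2 * area (pair k F) t) in hE by (field; lra).
replace (t ^ 4 * (phi_norm p k * (1 + (/ (t ^ 2) ^ 2 * area (pm p F) (t ^ 2) - 1) / p))) with
  (phi_norm p k * t ^ 4 + phi_norm p k * (area (pm p F) (t ^ 2) - t ^ 4) / p) in hE by (field; lra).
apply Rle_trans with (phi_norm p k * (1 - t ^ 4) / p + (phi_norm p k * t ^ 4 -
  (phi_norm p k * t ^ 4 + phi_norm p k * (area (pm p F) (t ^ 2) - t ^ 4) / p))); [right; field; lra | lra].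
Qed.

(** The annulus r < |z| < 1 has normalized area 1 - r^2, and every mean there is at least the one at
    r. Thus decay of the tail at the rate 1 - r bounds the means. *)
Lemma mass_tail_ge (f : Cx -> Cx) (r : R) : Ap p f -> 0 <= r < 1 ->
  mean (pm p f) r * (1 - r ^ 2) <= mass p f - area (pm p f) r.
Proof.
intros hf hr; assert (hfh : holo f) by apply hf.
assert (hd := pm_dcont p f ltac:(lra) hfh).
set (m := mean (pm p f) r).
assert (h1 := lim1_sq m).
enough (m <= m * r ^ 2 + mass p f - area (pm p f) r) by lra.
assert (h2 := lim1_add _ _ _ _ (lim1_cmul (-1) _ _ h1) (mass_lim p f ltac:(lra) hf)).
assert (h3 := lim1_ge _ _ (area (pm p f) r - m * r ^ 2) r h2 ltac:(lra)); simpl in h3.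
enough (area (pm p f) r - m * r ^ 2 <= -1 * m + mass p f) by lra.
apply h3; intros x hx.
assert (k := area_tail_ge_const (pm p f) r x m hd ltac:(lra) ltac:(lra)
  ltac:(intros y hy; apply pm_mean_monotone; trivial; lra)); lra.
Qed.

Lemma mass_tail_le (r : R) (f : Cx -> Cx) (h a : R) : 1 <= r -> Ap r f -> 0 <= a < 1 ->
  (forall x, 0 <= x < 1 -> mean (pm r f) x <= h) ->
  mass r f - area (pm r f) a <= h * (1 - a ^ 2).
Proof.
intros hr hf ha hm; assert (hfh : holo f) by apply hf.
assert (hd := pm_dcont r f ltac:(lra) hfh).
assert (h0 : 0 <= h) by (apply Rle_trans with (2 := hm a ha); apply pm_mean_ge0; trivial; lra).
enough (mass r f <= area (pm r f) a + h * (1 - a ^ 2)) by lra.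
apply mass_le; [lra | trivial |]; intros x hx.
destruct (Rle_or_lt a x) as [hax | hax].
- assert (k := area_tail_le_const (pm r f) a x h hd ltac:(lra) ltac:(lra) ltac:(intros; apply hm; lra)).
  assert (x ^ 2 <= 1) by nra; nra.
- assert (k := pm_area_incr r f x a ltac:(lra) hfh ltac:(lra) ltac:(lra)).
  assert (a ^ 2 <= 1) by nra; nra.
Qed.

Lemma extremal_Hp_bound (nu h : R) : 0 < nu -> 0 <= h -> exists B, forall k F : Cx -> Cx,
  Hp q k -> (forall r, 0 <= r < 1 -> mean (pm q k) r <= h) -> nu <= phi_norm p k ->
  is_extremal p k F -> forall r, 0 <= r < 1 -> mean (pm p F) r <= B.
Proof.
intros hnu hh.
(* With this weight the Young term in the mass of F is at most N (1 - A) / (2 p), half of what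
   [extremal_dil] bounds, and can be absorbed. *)
destruct (young_exists p q hp hq (nu / (2 * p)) ltac:(apply Rdiv_lt_0_compat; lra)) as [K hK].
assert (hK0 : 0 <= K) by apply hK.
exists (4 + 2 * p * K * h / nu); intros k F hk hkm hN hF.
assert (hn := extremal_normalized k F hF); assert (hm1 := normalized_mass p hp F hn).
assert (hFA : Ap p F) by apply hF.
assert (hFh : holo F) by apply hF.
assert (hmain : forall t, 0 < t < 1 -> mean (pm p F) (t ^ 2) <= 4 + 2 * p * K * h / nu).
{ intros t ht; assert (ht2 : 0 < t ^ 2 < t) by nra.
  assert (hE := extremal_dil k F t hk hF ht).
  assert (hT := rphi_tail p q hp hq (nu / (2 * p)) K k F t hK hk hFA ltac:(lra)).
  assert (hrN : rphi k F = phi_norm p k) by apply hF.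
  rewrite hm1, hrN in hT.
  assert (hinc := pm_area_incr p F (t ^ 2) t ltac:(lra) hFh ltac:(lra) ltac:(lra)).
  assert (hkt := mass_tail_le q k h t ltac:(lra) (Hp_Ap q k ltac:(lra) hk) ltac:(lra) hkm).
  assert (hM := mass_tail_ge F (t ^ 2) hFA ltac:(lra)); rewrite hm1 in hM.
  set (N := phi_norm p k) in *; set (P := area (pair k F) t) in *.
  set (A := area (pm p F) (t ^ 2)) in *; set (m := mean (pm p F) (t ^ 2)) in *.
  assert (hA : A <= 1) by (rewrite <- hm1; apply mass_ub; trivial; lra).
  assert (k1 : K * (mass q k - area (pm q k) t) <= K * (h * (1 - t ^ 2))) by (apply Rmult_le_compat_l; trivial).
  assert (hnp : 0 < nu / (2 * p)) by (apply Rdiv_lt_0_compat; lra).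
  assert (k2 : nu / (2 * p) * (1 - area (pm p F) t) <= nu / (2 * p) * (1 - A)) by (apply Rmult_le_compat_l; lra).
  apply Rabs_le_between in hT.
  assert (hP : N - nu / (2 * p) * (1 - A) - K * (h * (1 - t ^ 2)) <= P) by lra.
  assert (k3 : nu / (2 * p) * (1 - A) <= N * (1 - A) / (2 * p)).
  { replace (N * (1 - A) / (2 * p)) with (N / (2 * p) * (1 - A)) by (field; lra).
    apply Rmult_le_compat_r; [lra |]; apply Rmult_le_compat_r; [apply Rlt_le, Rinv_0_lt_compat; lra | lra]. }
  set (u := 1 - t ^ 2) in *; assert (hu : 0 < u < 1) by (unfold u; lra).
  assert (ht2u : t ^ 2 = 1 - u) by (unfold u; ring).
  replace (t ^ 4) with ((1 - u) ^ 2) in hE by (rewrite <- ht2u; ring).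
  rewrite ht2u in hE.
  replace (1 - (t ^ 2) ^ 2) with (u * (2 - u)) in hM by (rewrite ht2u; ring).
  (* Half the left side of [extremal_dil]. Absorbing one X leaves X <= 2 (N/p) u + K h u with u = 1
     - t^2; dividing by N / (2 p) gives the constant 4 + 2 p K h / nu. *)
  set (X := N * (1 - A) / (2 * p)) in *.
  assert (hX0 : 0 <= X).
  { unfold X; apply Rmult_le_pos; [apply Rmult_le_pos; lra | apply Rlt_le, Rinv_0_lt_compat; lra]. }
  assert (hKh : 0 <= K * (h * u)) by (apply Rmult_le_pos; [| apply Rmult_le_pos]; lra).
  assert (k4 : (1 - u) * (N - X - K * (h * u)) <= (1 - u) * P) by (apply Rmult_le_compat_l; lra).
  replace (N * (1 - A) / p) with (2 * X) in hE by (unfold X; field; lra).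
  set (Y := N / p); assert (hY : 0 < Y) by (apply Rdiv_lt_0_compat; lra).
  replace (N * (1 - (1 - u) ^ 2) / p) with (Y * (u * (2 - u))) in hE by (unfold Y; field; lra).
  assert (k5 : X <= 2 * Y * u + K * (h * u)).
  { assert (0 <= N * u * (1 - u)) by (apply Rmult_le_pos; [apply Rmult_le_pos |]; lra).
    assert (0 <= Y * (u * u)) by (apply Rmult_le_pos; nra).
    assert (0 <= u * X) by (apply Rmult_le_pos; lra).
    assert (0 <= u * (K * (h * u))) by (apply Rmult_le_pos; lra).
    nra. }
  assert (k6 : m * u <= 1 - A).
  { assert (0 <= m) by (apply pm_mean_ge0; trivial; lra).
    assert (0 <= m * (u * (1 - u))) by (apply Rmult_le_pos; [| apply Rmult_le_pos]; lra).
    nra. }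
  assert (k7 : 1 - A = 2 * X / Y) by (unfold X, Y; field; lra).
  assert (k8 : 1 - A <= (4 + 2 * p * K * h / nu) * u).
  { rewrite k7; apply (Rmult_le_reg_r Y); trivial.
    replace (2 * X / Y * Y) with (2 * X) by (field; lra).
    assert (k9 : 2 * K * h <= 2 * p * K * h / nu * Y).
    { unfold Y; replace (2 * p * K * h / nu * (N / p)) with (2 * (K * h) * (N / nu)) by (field; lra).
      rewrite <- (Rmult_1_r (2 * K * h)), !Rmult_assoc.
      assert (1 <= N / nu) by (apply (Rmult_le_reg_r nu); trivial; unfold Rdiv; rewrite Rmult_assoc, Rinv_l; lra).
      assert (0 <= K * h) by (now apply Rmult_le_pos). nra. }
    nra. }
  apply (Rmult_le_reg_r u); lra. }
assert (hpos : forall r, 0 < r < 1 -> mean (pm p F) r <= 4 + 2 * p * K * h / nu).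
{ intros r hr; rewrite <- (pow2_sqrt r) by lra; apply hmain; split; [apply sqrt_lt_R0; lra |].
  rewrite <- sqrt_1; apply sqrt_lt_1_alt; lra. }
intros r hr; apply Rle_trans with (mean (pm p F) ((1 + r) / 2)); [| apply hpos; lra].
apply pm_mean_monotone; trivial; lra.
Qed.
End Regularity.

(** * Uniform convexity and local uniform convergence *)

Definition cmid (a b : Cx) : Cx := Cadd (Cmul (/ 2, 0) a) (Cmul (/ 2, 0) b).

Definition gap (p : R) (a b : Cx) : R :=
  (rpow (Cmod a) p + rpow (Cmod b) p) / 2 - rpow (Cmod (cmid a b)) p.

Lemma gap_lower (p : R) : 1 < p -> exists c, 0 < c /\ forall a b,
  c * (rpow (Rmax (Cmod a) (Cmod b)) (p - 2) * Cmod (Csub a b) ^ 2) <= gap p a b.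
Proof.
intros hp; destruct (rpow_gap p hp) as [c [hc H]].
exists (c / 4); split; [lra |]; intros a b.
assert (h := H (Cmod a) (Cmod b) (Cmod (cmid a b)) (Cmod (Csub a b) / 2) (Cmod_ge0 _) (Cmod_ge0 _) (Cmod_ge0 _)).
replace (c / 4 * (rpow (Rmax (Cmod a) (Cmod b)) (p - 2) * Cmod (Csub a b) ^ 2)) with
  (c * rpow (Rmax (Cmod a) (Cmod b)) (p - 2) * (Cmod (Csub a b) / 2) ^ 2) by field.
apply h.
- apply Rle_trans with (1 := Cmod_tri _ _); rewrite !Cmod_scal, Rabs_pos_eq by lra; lra.
- replace ((Cmod (Csub a b) / 2) ^ 2) with (Cmod (Csub a b) ^ 2 / 4) by field.
  rewrite !Cmod_sq; unfold cmid, Csub, Cadd, Copp, Cmul; simpl; field.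
Qed.

Lemma gap_ge0 (p : R) (a b : Cx) : 1 < p -> 0 <= gap p a b.
Proof.
intros hp; destruct (gap_lower p hp) as [c [hc h]]; apply Rle_trans with (2 := h a b).
apply Rmult_le_pos; [lra |]; apply Rmult_le_pos; [apply rpow_ge0 | apply pow2_ge_0].
Qed.

Lemma Rmax_Cmod (p : R) (a b : Cx) :
  0 <= Rmax (Cmod a) (Cmod b) /\ Cmod (Csub a b) <= 2 * Rmax (Cmod a) (Cmod b) /\
  rpow (Rmax (Cmod a) (Cmod b)) p <= rpow (Cmod a) p + rpow (Cmod b) p.
Proof.
assert (ha := Cmod_ge0 a); assert (hb := Cmod_ge0 b).
assert (h1 := Rmax_l (Cmod a) (Cmod b)); assert (h2 := Rmax_r (Cmod a) (Cmod b)).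
assert (h3 := Cmod_sub_le a b); assert (h4 := rpow_ge0 (Cmod a) p); assert (h5 := rpow_ge0 (Cmod b) p).
split; [lra |]; split; [lra |]; apply Rmax_case; lra.
Qed.

(** Let eta^p = eps and W = max(|a|,|b|). If |a - b| <= eta W, the first term suffices; otherwise
    W^p <= W^(p-2) |a - b|^2 / eta^2, which the gap controls. This additive form can be integrated
    directly. *)
Lemma uniform_convexity (p eps : R) : 1 < p -> 0 < eps -> exists K, 0 <= K /\ forall a b,
  rpow (Cmod (Csub a b)) p <= eps * (rpow (Cmod a) p + rpow (Cmod b) p) + K * gap p a b.
Proof.
intros hp heps; destruct (gap_lower p hp) as [c [hc H]].
set (eta := rpow eps (/ p)); assert (heta : 0 < eta) by now apply rpow_gt0.
set (K := rpow 2 p / (eta ^ 2 * c)).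
assert (h2p : 0 < rpow 2 p) by (apply rpow_gt0; lra).
assert (he2 : 0 < eta ^ 2) by now apply pow_lt.
assert (hK : 0 <= K).
{ unfold K; apply Rlt_le, Rdiv_lt_0_compat; trivial; now apply Rmult_lt_0_compat. }
exists K; split; trivial; intros a b.
destruct (Rmax_Cmod p a b) as [hW [hd hs]]; specialize (H a b); assert (hg := gap_ge0 p a b hp).
assert (hD := Cmod_ge0 (Csub a b)).
set (W := Rmax (Cmod a) (Cmod b)) in *; set (D := Cmod (Csub a b)) in *.
assert (hKg := Rmult_le_pos _ _ hK hg).
destruct (Rle_or_lt D (eta * W)) as [h | h].
- apply Rle_trans with (rpow (eta * W) p); [apply rpow_le; lra |].
  rewrite rpow_mult by lra.
  replace (rpow eta p) with eps by (symmetry; apply rpow_inv'; lra).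
  assert (k := Rmult_le_compat_l eps _ _ (Rlt_le _ _ heps) hs); lra.
- assert (hs0 : 0 <= eps * (rpow (Cmod a) p + rpow (Cmod b) p)).
  { apply Rmult_le_pos; [lra |]; apply Rle_trans with (2 := hs); apply rpow_ge0. }
  apply Rle_trans with (K * gap p a b); [| lra].
  apply Rle_trans with (rpow (2 * W) p); [apply rpow_le; lra |].
  rewrite rpow_mult by lra.
  apply Rle_trans with (K * (c * (rpow W (p - 2) * D ^ 2))); [| now apply Rmult_le_compat_l].
  replace (K * (c * (rpow W (p - 2) * D ^ 2))) with (rpow 2 p * (rpow W (p - 2) * (D ^ 2 / eta ^ 2)))
    by (unfold K; field; lra).
  apply Rmult_le_compat_l; [lra |].
  replace (rpow W p) with (rpow W (p - 2) * W ^ 2).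
  2: { rewrite <- rpow_2, <- rpow_plus by lra; f_equal; ring. }
  apply Rmult_le_compat_l; [apply rpow_ge0 |].
  apply (Rmult_le_reg_r (eta ^ 2)); trivial.
  replace (D ^ 2 / eta ^ 2 * eta ^ 2) with (D ^ 2) by (field; lra).
  assert (0 <= eta * W) by (apply Rmult_le_pos; lra); nra.
Qed.

(** Weighted arithmetic-geometric mean: with W the maximum and D = |a - b|, D W^(p-1) is the product
    of W^((p-2)/2) D, whose square the gap controls, and W^(p/2). It measures a first-order change
    of |.|^p by the second-order gap. *)
Lemma gap_first_order (p : R) : 1 < p -> exists C, 0 < C /\ forall l a b, 0 < l ->
  Cmod (Csub a b) * rpow (Rmax (Cmod a) (Cmod b)) (p - 1) <=
  l * C * gap p a b + (rpow (Cmod a) p + rpow (Cmod b) p) / l.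
Proof.
intros hp; destruct (gap_lower p hp) as [c [hc H]].
exists (/ c); split; [now apply Rinv_0_lt_compat |]; intros l a b hl.
destruct (Rmax_Cmod p a b) as [hW [hd hs]]; specialize (H a b); assert (hg := gap_ge0 p a b hp).
set (W := Rmax (Cmod a) (Cmod b)) in *; set (D := Cmod (Csub a b)) in *.
assert (hil := Rinv_0_lt_compat l hl).
assert (h1 : l * (rpow W (p - 2) * D ^ 2) <= l * / c * gap p a b).
{ rewrite Rmult_assoc; apply Rmult_le_compat_l; [lra |].
  apply (Rmult_le_reg_l c); trivial; rewrite <- (Rmult_assoc c (/ c)), Rinv_r, Rmult_1_l by lra; exact H. }
assert (h2 : rpow W p / l <= (rpow (Cmod a) p + rpow (Cmod b) p) / l) by (apply Rmult_le_compat_r; lra).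
apply Rle_trans with (l * (rpow W (p - 2) * D ^ 2) + rpow W p / l); [| lra].
replace (rpow W p) with (rpow W (p - 2) * W ^ 2).
2: { rewrite <- rpow_2, <- rpow_plus by lra; f_equal; ring. }
replace (rpow W (p - 1)) with (rpow W (p - 2) * W).
2: { rewrite <- (rpow_1 W) at 2 by lra; rewrite <- rpow_plus by lra; f_equal; ring. }
replace (l * (rpow W (p - 2) * D ^ 2) + rpow W (p - 2) * W ^ 2 / l) with
  (rpow W (p - 2) * (l * D ^ 2 + W ^ 2 / l)) by (field; lra).
replace (D * (rpow W (p - 2) * W)) with (rpow W (p - 2) * (D * W)) by ring.
apply Rmult_le_compat_l; [apply rpow_ge0 |].
apply (Rmult_le_reg_l l); trivial.
replace (l * (l * D ^ 2 + W ^ 2 / l)) with ((l * D) ^ 2 + W ^ 2) by (field; lra).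
assert (k := pow2_ge_0 (l * D - W)); assert (k1 := pow2_ge_0 (l * D)); assert (k2 := pow2_ge_0 W); nra.
Qed.

Definition fmid (f g : Cx -> Cx) : Cx -> Cx := lcomb (/ 2, 0) (/ 2, 0) f g.
Definition fsub (f g : Cx -> Cx) : Cx -> Cx := fun w => Csub (f w) (g w).

Lemma holo_fmid (f g : Cx -> Cx) : holo f -> holo g -> holo (fmid f g).
Proof. apply holo_lcomb. Qed.

Lemma holo_fsub (f g : Cx -> Cx) : holo f -> holo g -> holo (fsub f g).
Proof.
rewrite !holo_cdiff; intros hf hg z hz; apply cdiff_sub; auto.
Qed.

Lemma mean_lin3 (a b : R) (f g h : Cx -> R) (r : R) : circ f r -> circ g r -> circ h r ->
  mean (fun w => a * (f w + g w) + b * h w) r = a * (mean f r + mean g r) + b * mean h r.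
Proof.
intros hf hg hh.
rewrite (mean_add (fun w => a * (f w + g w)) (fun w => b * h w)).
- rewrite (mean_cmul a (fun w => f w + g w)), mean_cmul, mean_add; trivial; now apply circ_add.
- now apply circ_cmul, circ_add.
- now apply circ_cmul.
Qed.

Lemma area_lin3 (a b : R) (f g h : Cx -> R) (r : R) : dcont f -> dcont g -> dcont h -> 0 <= r < 1 ->
  area (fun w => a * (f w + g w) + b * h w) r = a * (area f r + area g r) + b * area h r.
Proof.
intros hf hg hh hr.
rewrite (area_add (fun w => a * (f w + g w)) (fun w => b * h w)); trivial.
- rewrite (area_cmul a (fun w => f w + g w)), area_cmul, area_add; trivial; now apply dcont_add.
- now apply dcont_cmul, dcont_add.
- now apply dcont_cmul.
Qed.

Lemma pm_uniform_convexity (p eps : R) : 1 < p -> 0 < eps -> exists K, 0 <= K /\ forall f g w,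
  pm p (fsub f g) w <= (eps + K / 2) * (pm p f w + pm p g w) + (- K) * pm p (fmid f g) w.
Proof.
intros hp heps; destruct (uniform_convexity p eps hp heps) as [K [hK H]].
exists K; split; trivial; intros f g w; unfold pm, fsub.
apply Rle_trans with (1 := H (f w) (g w)); unfold gap; change (cmid (f w) (g w)) with (fmid f g w); right; field.
Qed.

Lemma mean_uniform_convexity (p eps : R) : 1 < p -> 0 < eps -> exists K, 0 <= K /\ forall f g r,
  holo f -> holo g -> 0 <= r < 1 ->
  mean (pm p (fsub f g)) r <= (eps + K / 2) * (mean (pm p f) r + mean (pm p g) r)
    - K * mean (pm p (fmid f g)) r.
Proof.
intros hp heps; destruct (pm_uniform_convexity p eps hp heps) as [K [hK H]].
exists K; split; trivial; intros f g r hf hg hr.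
assert (hc : forall f, holo f -> circ (pm p f) r) by (intros; apply dcont_circ'; trivial; apply pm_dcont; trivial; lra).
assert (h1 := hc f hf); assert (h2 := hc g hg); assert (h3 := hc _ (holo_fmid f g hf hg)).
unfold Rminus; rewrite Ropp_mult_distr_l, <- mean_lin3 by trivial.
apply mean_le; [now apply hc, holo_fsub | | intros; apply H].
apply circ_add; apply circ_cmul; trivial; now apply circ_add.
Qed.

Lemma area_uniform_convexity (p eps : R) : 1 < p -> 0 < eps -> exists K, 0 <= K /\ forall f g r,
  holo f -> holo g -> 0 <= r < 1 ->
  area (pm p (fsub f g)) r <= (eps + K / 2) * (area (pm p f) r + area (pm p g) r)
    - K * area (pm p (fmid f g)) r.
Proof.
intros hp heps; destruct (pm_uniform_convexity p eps hp heps) as [K [hK H]].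
exists K; split; trivial; intros f g r hf hg hr.
assert (hc : forall f, holo f -> dcont (pm p f)) by (intros; apply pm_dcont; trivial; lra).
assert (h1 := hc f hf); assert (h2 := hc g hg); assert (h3 := hc _ (holo_fmid f g hf hg)).
unfold Rminus; rewrite Ropp_mult_distr_l, <- area_lin3 by trivial.
apply area_le; [now apply hc, holo_fsub | | trivial | intros; apply H].
apply dcont_add; apply dcont_cmul; trivial; now apply dcont_add.
Qed.

Lemma fsub_lcomb (f g : Cx -> Cx) : fsub f g = lcomb (1, 0) (-1, 0) f g.
Proof.
apply functional_extensionality; intros w; unfold fsub, lcomb, Csub, Cadd, Copp, Cmul; simpl; f_equal; ring.
Qed.

Lemma Ap_fsub (p : R) (f g : Cx -> Cx) : 0 < p -> Ap p f -> Ap p g -> Ap p (fsub f g).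
Proof. intros; rewrite fsub_lcomb; now apply Ap_lcomb. Qed.

Lemma mass_uniform_convexity (p eps : R) : 1 < p -> 0 < eps -> exists K, 0 <= K /\ forall f g,
  Ap p f -> Ap p g ->
  mass p (fsub f g) <= (eps + K / 2) * (mass p f + mass p g) - K * mass p (fmid f g).
Proof.
intros hp heps; destruct (area_uniform_convexity p eps hp heps) as [K [hK H]].
assert (hp0 : 0 < p) by lra.
exists K; split; trivial; intros f g hf hg; assert (hfh : holo f) by apply hf; assert (hgh : holo g) by apply hg.
assert (h1 := mass_lim p _ hp0 (Ap_fsub p f g hp0 hf hg)).
assert (h2 := mass_lim p f hp0 hf); assert (h3 := mass_lim p g hp0 hg).
assert (h4 := mass_lim p (fmid f g) hp0 (Ap_lcomb p _ _ f g hp0 hf hg)).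
assert (h5 := lim1_add _ _ _ _ (lim1_cmul (-1) _ _ h1) (lim1_add _ _ _ _
   (lim1_cmul (eps + K / 2) _ _ (lim1_add _ _ _ _ h2 h3)) (lim1_cmul (- K) _ _ h4))).
assert (h6 := lim1_ge _ _ 0 0 h5 Rlt_0_1
  ltac:(intros x hx; simpl; assert (k := H f g x hfh hgh hx); lra)).
lra.
Qed.

Definition loc_unif_lim (fn : nat -> Cx -> Cx) (f : Cx -> Cx) : Prop :=
  forall rho eps, 0 <= rho < 1 -> 0 < eps -> exists N, forall n, (n >= N)%nat ->
    forall z, Cmod z <= rho -> Cmod (Csub (fn n z) (f z)) <= eps.

Lemma rpow_small (p eps : R) : 0 < p -> 0 < eps -> exists e, 0 < e /\ forall x, 0 <= x -> rpow x p <= e -> x <= eps.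
Proof.
intros hp heps; exists (rpow eps p); split; [now apply rpow_gt0 |]; intros x hx h.
apply Rnot_lt_le; intros hlt; assert (k := rpow_lt eps x p hp ltac:(lra)); lra.
Qed.

(** The point value is bounded by the mean over |z| = s, halfway between rho and 1, and this mean by
    the mass of the annulus beyond s. *)
Lemma mass_point_bound (p rho : R) : 1 < p -> 0 <= rho < 1 -> exists C, 0 < C /\ forall f a,
  Ap p f -> Cmod a <= rho -> pm p f a <= C * mass p f.
Proof.
intros hp hr; set (s := (1 + rho) / 2); assert (hs : rho < s < 1) by (unfold s; lra).
exists ((s + rho) / (s - rho) / (1 - s ^ 2)).
assert (hs2 : 0 < 1 - s ^ 2) by nra.
assert (hC1 : 0 < (s + rho) / (s - rho)) by (apply Rdiv_lt_0_compat; lra).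
split; [now apply Rdiv_lt_0_compat |]; intros f a hf ha; assert (hfh : holo f) by apply hf.
assert (ha0 := Cmod_ge0 a).
apply Rle_trans with (1 := pm_point_bound p f a s ltac:(lra) hfh ltac:(lra)).
assert (h1 := mass_tail_ge p hp f s hf ltac:(lra)).
assert (h2 := area_ge0 (pm p f) s (pm_dcont p f ltac:(lra) hfh) ltac:(intros; apply pm_ge0) ltac:(lra)).
assert (h3 : mean (pm p f) s <= mass p f / (1 - s ^ 2)).
{ apply (Rmult_le_reg_r (1 - s ^ 2)); trivial; unfold Rdiv; rewrite Rmult_assoc, Rinv_l; lra. }
assert (hm := pm_mean_ge0 p f s ltac:(lra) hfh ltac:(lra)).
assert (h4 : (s + Cmod a) / (s - Cmod a) <= (s + rho) / (s - rho)).
{ apply Rmult_le_compat; try lra; [apply Rlt_le, Rinv_0_lt_compat; lra | apply Rinv_le_contravar; lra]. }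
apply Rle_trans with ((s + rho) / (s - rho) * (mass p f / (1 - s ^ 2))).
- apply Rmult_le_compat; trivial.
  apply Rmult_le_pos; [lra | apply Rlt_le, Rinv_0_lt_compat; lra].
- right; field; lra.
Qed.

(** * Convergence of the extremal functions in A^p *)

Section Convergence.
Variables (p q : R).
Hypothesis hp : 1 < p.
Hypothesis hq : q = p / (p - 1).
Variables (kn : nat -> Cx -> Cx) (k : Cx -> Cx) (Fn : nat -> Cx -> Cx) (F : Cx -> Cx).
Hypothesis hkn : forall n, Hp q (kn n).
Hypothesis hk : Hp q k.
Hypothesis hk0 : not_zero k.
Hypothesis hconv : forall eta, 0 < eta -> exists N, forall n, (n >= N)%nat ->
  forall r, 0 <= r < 1 -> mean (pm q (fsub (kn n) k)) r <= eta.
Hypothesis hFn : forall n, is_extremal p (kn n) (Fn n).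
Hypothesis hF : is_extremal p k F.

Let hq1 : 1 < q := q_gt1 p q hp hq.
Let hnF : normalized p F := extremal_normalized p k F hF.
Let hnFn (n : nat) : normalized p (Fn n) := extremal_normalized p (kn n) (Fn n) (hFn n).

Lemma Hp_fsub (r : R) (f g : Cx -> Cx) : 0 < r -> Hp r f -> Hp r g -> Hp r (fsub f g).
Proof. intros; rewrite fsub_lcomb; now apply Hp_lcomb. Qed.

Lemma mass_le_mean_bound (r : R) (f : Cx -> Cx) (h : R) : 1 <= r -> Ap r f ->
  (forall x, 0 <= x < 1 -> mean (pm r f) x <= h) -> mass r f <= h.
Proof.
intros hr hf h0; assert (k0 := mass_tail_le r f h 0 hr hf ltac:(lra) h0).
rewrite area_0 in k0; lra.
Qed.

Lemma kernel_mass_small (eta : R) : 0 < eta -> exists N, forall n, (n >= N)%nat ->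
  mass q (fsub (kn n) k) <= eta.
Proof.
intros heta; destruct (hconv eta heta) as [N hN]; exists N; intros n hn.
apply mass_le_mean_bound; [lra | | now apply hN].
apply Hp_Ap; [lra | apply Hp_fsub; trivial; lra].
Qed.

Lemma fsub_mass_sym (r : R) (f g : Cx -> Cx) : mass r (fsub f g) = mass r (fsub g f).
Proof.
unfold mass; f_equal; apply functional_extensionality; intros w; unfold pm, fsub; now rewrite Cmod_sub_sym.
Qed.

Lemma phi_norm_conv (eta : R) : 0 < eta -> exists N, forall n, (n >= N)%nat ->
  Rabs (phi_norm p (kn n) - phi_norm p k) <= eta.
Proof.
intros heta; destruct (young_exists p q hp hq (eta / 4) ltac:(lra)) as [K hK].
assert (hK0 : 0 <= K) by apply hK.
destruct (kernel_mass_small (eta / (4 * (K + 1)))) as [N hN]; [apply Rdiv_lt_0_compat; lra |].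
exists N; intros n hn; specialize (hN n hn).
assert (hKm : K * mass q (fsub (kn n) k) <= eta / 4).
{ apply Rle_trans with (K * (eta / (4 * (K + 1)))); [now apply Rmult_le_compat_l |].
  apply (Rmult_le_reg_r (4 * (K + 1))); [lra |].
  replace (K * (eta / (4 * (K + 1))) * (4 * (K + 1))) with (K * eta) by (field; lra); nra. }
assert (h1 := phi_norm_perturb p q hp hq _ K (kn n) k F hK (hkn n) hk hnF).
assert (h2 := phi_norm_perturb p q hp hq _ K k (kn n) F hK hk (hkn n) hnF).
change (fun w => Csub (kn n w) (k w)) with (fsub (kn n) k) in h1.
change (fun w => Csub (k w) (kn n w)) with (fsub k (kn n)) in h2; rewrite fsub_mass_sym in h2.
apply Rabs_le; lra.
Qed.

Lemma phi_norm_k_pos : 0 < phi_norm p k.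
Proof. apply (phi_norm_pos p q hp hq k F); trivial. Qed.

(** The bound of [extremal_Hp_bound] depends only on the means of the kernel and on a lower bound
    for its functional; for large n the kernels stay near k and the norms above half of the
    limit. *)
Lemma extremal_uniform_bound : exists B N, forall n, (n >= N)%nat ->
  forall r, 0 <= r < 1 -> mean (pm p (Fn n)) r <= B.
Proof.
assert (hpos := phi_norm_k_pos).
destruct (proj1 (Hp_iff q k ltac:(lra)) hk) as [hkh [hb hhb]].
assert (hb0 : 0 <= hb) by (apply Rle_trans with (2 := hhb 0 ltac:(lra)); apply pm_mean_ge0; trivial; lra).
assert (h2q := rpow_ge0 2 q).
destruct (extremal_Hp_bound p q hp hq (phi_norm p k / 2) (rpow 2 q * (1 + hb)) ltac:(lra)
  ltac:(apply Rmult_le_pos; lra)) as [B hB].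
destruct (hconv 1 Rlt_0_1) as [N1 h1].
destruct (phi_norm_conv (phi_norm p k / 2) ltac:(lra)) as [N2 h2].
exists B, (max N1 N2); intros n hn.
apply (hB (kn n) (Fn n)); trivial.
- intros r hr.
  replace (kn n) with (lcomb Cone Cone (fsub (kn n) k) k).
  2: { apply functional_extensionality; intros w; unfold lcomb, fsub; ring. }
  assert (hs : holo (fsub (kn n) k)) by (apply holo_fsub; [apply (hkn n) | trivial]).
  apply Rle_trans with (1 := pm_mean_lcomb_le q Cone Cone _ k r ltac:(lra) hs hkh hr).
  replace (Cmod Cone) with 1 by (symmetry; unfold Cone; rewrite Cmod_real; apply Rabs_R1).
  rewrite rpow_one, !Rmult_1_r, <- Rmult_plus_distr_l.
  apply Rmult_le_compat_l; trivial; apply Rplus_le_compat; [apply h1; trivial; lia | now apply hhb].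
- specialize (h2 n ltac:(lia)); apply Rabs_le_between in h2; lra.
Qed.

Lemma extremal_in_Hp (k' F' : Cx -> Cx) : Hp q k' -> not_zero k' -> is_extremal p k' F' -> Hp p F'.
Proof.
intros h1 h2 h3.
assert (hpos := phi_norm_pos p q hp hq k' F' h1 h2 (extremal_normalized p k' F' h3)).
destruct (proj1 (Hp_iff q k' ltac:(lra)) h1) as [hkh [hb hhb]].
assert (hb0 : 0 <= hb) by (apply Rle_trans with (2 := hhb 0 ltac:(lra)); apply pm_mean_ge0; trivial; lra).
destruct (extremal_Hp_bound p q hp hq (phi_norm p k') hb hpos hb0) as [B hB].
apply Hp_iff; [lra |]; split; [apply h3 |]; exists B.
apply (hB k' F'); trivial; lra.
Qed.

(** The functional of k is almost N at F_n and equal to N at F, hence almost N at their midpoint;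
    the affine extremal bound then forces the mass of the midpoint to be almost 1. *)
Lemma extremal_mass_conv (eps : R) : 0 < eps -> exists N, forall n, (n >= N)%nat ->
  mass p (fsub (Fn n) F) <= eps.
Proof.
intros heps; assert (hpos := phi_norm_k_pos).
destruct (mass_uniform_convexity p (eps / 4) hp ltac:(lra)) as [K [hK H]].
set (Nk := phi_norm p k) in *.
(* The midpoint loses at most eta against k, hence at most p eta / N in mass, and K times this is at
   most eps / 2. *)
set (eta := eps * Nk / (2 * p * (K + 1))).
assert (heta : 0 < eta).
{ unfold eta; apply Rdiv_lt_0_compat; [nra |]; nra. }
destruct (young_exists p q hp hq (eta / 2) ltac:(lra)) as [K2 hK2].
assert (hK20 : 0 <= K2) by apply hK2.
destruct (kernel_mass_small (eta / (2 * (K2 + 1)))) as [N1 h1]; [apply Rdiv_lt_0_compat; lra |].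
destruct (phi_norm_conv eta heta) as [N2 h2].
exists (max N1 N2); intros n hn; specialize (h1 n ltac:(lia)); specialize (h2 n ltac:(lia)).
assert (hA : Ap p (Fn n)) by apply (hnFn n); assert (hA' : Ap p F) by apply hnF.
assert (hm := normalized_mass p hp _ (hnFn n)); assert (hm' := normalized_mass p hp _ hnF).
assert (hU := H (Fn n) F hA hA'); rewrite hm, hm' in hU.
assert (hE := rphi_extremal_bound p q hp hq k F (fmid (Fn n) F) hk hnF (Ap_lcomb p _ _ _ _ ltac:(lra) hA hA')).
unfold fmid in hE at 1; rewrite (rphi_lcomb p q hp hq) in hE by trivial.
assert (hrF : rphi k F = Nk) by apply hF.
assert (hrFn : rphi (kn n) (Fn n) = phi_norm p (kn n)) by apply (hFn n).
assert (hs := rphi_kernel_sub p q hp hq (kn n) k (Fn n) (hkn n) hk hA).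
change (fun w => Csub (kn n w) (k w)) with (fsub (kn n) k) in hs.
assert (hb := rphi_bound p q hp hq (eta / 2) K2 (fsub (kn n) k) (Fn n) hK2 (Hp_fsub q _ _ ltac:(lra) (hkn n) hk) hA).
rewrite hm in hb.
assert (hK2m : K2 * mass q (fsub (kn n) k) <= eta / 2).
{ apply Rle_trans with (K2 * (eta / (2 * (K2 + 1)))); [now apply Rmult_le_compat_l |].
  apply (Rmult_le_reg_r (2 * (K2 + 1))); [lra |].
  replace (K2 * (eta / (2 * (K2 + 1))) * (2 * (K2 + 1))) with (K2 * eta) by (field; lra); nra. }
apply Rabs_le_between in hb; apply Rabs_le_between in h2; fold Nk in h2.
rewrite hrF in hE; fold Nk in hE.
set (mm := mass p (fmid (Fn n) F)) in *.
assert (hmm : 1 - mm <= p * eta / Nk).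
{ apply (Rmult_le_reg_r (Nk / p)); [apply Rdiv_lt_0_compat; lra |].
  replace (p * eta / Nk * (Nk / p)) with eta by (field; lra).
  replace ((1 - mm) * (Nk / p)) with (Nk - Nk * (1 + (mm - 1) / p)) by (field; lra); lra. }
apply Rle_trans with (1 := hU).
replace ((eps / 4 + K / 2) * (1 + 1) - K * mm) with (eps / 2 + K * (1 - mm)) by field.
assert (hKm : K * (1 - mm) <= K * (p * eta / Nk)) by now apply Rmult_le_compat_l.
assert (K * (p * eta / Nk) <= eps / 2); [| lra].
replace (K * (p * eta / Nk)) with (eps / 2 * (K / (K + 1))) by (unfold eta; field; lra).
rewrite <- (Rmult_1_r (eps / 2)) at 2; apply Rmult_le_compat_l; [lra |].
apply (Rmult_le_reg_r (K + 1)); [lra |]; unfold Rdiv; rewrite Rmult_assoc, Rinv_l; lra.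
Qed.

Lemma extremal_loc_unif : loc_unif_lim Fn F.
Proof.
intros rho eps hr heps.
destruct (mass_point_bound p rho hp hr) as [C [hC H]].
destruct (rpow_small p eps ltac:(lra) heps) as [e [he he']].
destruct (extremal_mass_conv (e / C)) as [N hN]; [now apply Rdiv_lt_0_compat |].
exists N; intros n hn z hz; apply he'; [apply Cmod_ge0 |].
assert (hA : Ap p (fsub (Fn n) F)).
{ apply Ap_fsub; [lra | apply (hnFn n) | apply hnF]. }
apply Rle_trans with (1 := H _ z hA hz).
specialize (hN n hn).
apply Rle_trans with (C * (e / C)); [apply Rmult_le_compat_l; lra | right; field; lra].
Qed.
End Convergence.

(** * Weak convergence *)

(** Closed under midpoints only: uniform convexity compares two functions with their midpoint, so no
    other convex combination is formed. *)
Inductive hull (S : (Cx -> Cx) -> Prop) : (Cx -> Cx) -> Prop :=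
| hull_base f : S f -> hull S f
| hull_mid f g : hull S f -> hull S g -> hull S (fmid f g).

Lemma hull_mono (S T : (Cx -> Cx) -> Prop) (f : Cx -> Cx) :
  (forall g, S g -> T g) -> hull S f -> hull T f.
Proof. intros h; induction 1; [apply hull_base; auto | now apply hull_mid]. Qed.

Lemma pm_mean_fmid_le (p : R) (f g : Cx -> Cx) (r B : R) : 1 < p -> holo f -> holo g -> 0 <= r < 1 ->
  mean (pm p f) r <= B -> mean (pm p g) r <= B -> mean (pm p (fmid f g)) r <= B.
Proof.
intros hp hf hg hr h1 h2.
assert (hc : forall f, holo f -> circ (pm p f) r) by (intros; apply dcont_circ'; trivial; apply pm_dcont; trivial; lra).
assert (c1 := hc f hf); assert (c2 := hc g hg).
apply Rle_trans with (mean (fun w => / 2 * (pm p f w + pm p g w)) r).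
- apply mean_le; [now apply hc, holo_fmid | now apply circ_cmul, circ_add |].
  intros t; assert (h := gap_ge0 p (f (pt r t)) (g (pt r t)) hp); unfold gap in h.
  change (cmid (f (pt r t)) (g (pt r t))) with (fmid f g (pt r t)) in h; unfold pm; lra.
- rewrite (mean_cmul (/ 2) (fun w => pm p f w + pm p g w)), mean_add; trivial; [lra | now apply circ_add].
Qed.

Lemma Hp_scal (p : R) (u : Cx) (f : Cx -> Cx) : 0 < p -> Hp p f ->
  Hp p (fun w => Cmul u (f w)).
Proof.
intros hp hf.
replace (fun w => Cmul u (f w)) with (lcomb u C0 f f); [now apply Hp_lcomb |].
apply functional_extensionality; intros w; unfold lcomb; ring.
Qed.

Lemma pm_unimodular (p : R) (u : Cx) (f : Cx -> Cx) : Cmod u = 1 -> pm p (fun w => Cmul u (f w)) = pm p f.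
Proof.
intros hu; apply functional_extensionality; intros w; unfold pm; now rewrite Cmod_mul, hu, Rmult_1_l.
Qed.

Lemma Cmul_phase (z : Cx) : exists u, Cmod u = 1 /\ fst (Cmul u z) = Cmod z.
Proof.
destruct (excluded_middle_informative (z = C0)) as [-> | h].
- exists Cone; rewrite Cmod_C0; split; [unfold Cone; rewrite Cmod_real; apply Rabs_R1 | simpl; ring].
- assert (hz := Cmod_gt0 z h); assert (hi := Rinv_0_lt_compat _ hz).
  exists (Cmul (/ Cmod z, 0) (Cconj z)); split.
  + rewrite Cmod_scal, Cmod_conj, Rabs_pos_eq by lra; field; lra.
  + replace (Cmul (Cmul (/ Cmod z, 0) (Cconj z)) z) with (Cmul (/ Cmod z, 0) (Cmul z (Cconj z))) by ring.
    rewrite Cmul_conj; simpl; field; lra.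
Qed.

Section Weak.
Variable p : R.
Hypothesis hp : 1 < p.
Variable L : (Cx -> Cx) -> Cx.
Hypothesis hlin : Hp_linear p L.

Lemma Hp_zero : Hp p (fun _ => C0).
Proof.
apply Hp_iff; [lra |]; split.
- apply holo_cdiff; intros; apply cdiff_const.
- exists 0; intros r hr; right; unfold pm; rewrite Cmod_C0, rpow_0; apply mean_const.
Qed.

Lemma linear_zero : L (fun _ => C0) = C0.
Proof.
assert (h := hlin (fun _ => C0) (fun _ => C0) Cone Hp_zero Hp_zero); cbv beta in h.
replace (fun z : Cx => Cadd (Cmul Cone C0) C0) with (fun _ : Cx => C0) in h
  by (apply functional_extensionality; intros; ring).
set (x := L (fun _ => C0)) in *.
transitivity (Csub (Cadd (Cmul Cone x) x) x); [ring |].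
rewrite <- h; ring.
Qed.

Lemma linear_scal (u : Cx) (f : Cx -> Cx) : Hp p f -> L (fun z => Cmul u (f z)) = Cmul u (L f).
Proof.
intros hf; assert (h := hlin f (fun _ => C0) u hf Hp_zero); cbv beta in h.
rewrite linear_zero in h.
replace (fun z : Cx => Cadd (Cmul u (f z)) C0) with (fun z => Cmul u (f z)) in h
  by (apply functional_extensionality; intros; ring).
rewrite h; ring.
Qed.

Lemma linear_fsub (f g : Cx -> Cx) : Hp p f -> Hp p g -> L (fsub f g) = Csub (L f) (L g).
Proof.
intros hf hg; assert (h := hlin g f (Copp Cone) hg hf).
replace (fun z : Cx => Cadd (Cmul (Copp Cone) (g z)) (f z)) with (fsub f g) in h
  by (apply functional_extensionality; intros; unfold fsub; ring).
rewrite h; ring.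
Qed.

Lemma linear_fmid (f g : Cx -> Cx) : Hp p f -> Hp p g -> L (fmid f g) = cmid (L f) (L g).
Proof.
intros hf hg; assert (h := hlin f (fun z => Cmul (/ 2, 0) (g z)) (/ 2, 0) hf (Hp_scal p _ g ltac:(lra) hg)).
rewrite linear_scal in h by trivial; exact h.
Qed.

Variables (c e0 B : R) (G : nat -> Cx -> Cx).
Hypothesis hc : forall f, Hp p f -> Cmod (L f) <= c * Hp_norm p f.
Hypothesis he0 : 0 < e0.
Hypothesis hG : forall n, Hp p (G n).
Variable N1 : nat.
Hypothesis hB : forall n, (n >= N1)%nat -> forall r, 0 <= r < 1 -> mean (pm p (G n)) r <= B.
Hypothesis hG0 : loc_unif_lim G (fun _ => C0).
Hypothesis hfar : forall N, exists n, (n >= N)%nat /\ e0 <= Cmod (L (G n)).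

(** The unimodular factors turn |L(G n)| >= e0 into Re L >= e0, a condition that midpoints
    preserve. *)
Let base (N : nat) (f : Cx -> Cx) : Prop :=
  exists n u, (n >= N)%nat /\ (n >= N1)%nat /\ Cmod u = 1 /\ f = (fun z => Cmul u (G n z)) /\ e0 <= fst (L f).

Lemma hull_nonempty (N : nat) : exists f, hull (base N) f.
Proof.
destruct (hfar (max N N1)) as [n [hn hL]].
destruct (Cmul_phase (L (G n))) as [u [hu1 hu2]].
exists (fun z => Cmul u (G n z)); apply hull_base; exists n, u; repeat split; trivial; try lia.
rewrite linear_scal by trivial; lra.
Qed.

(** Each clause holds on the tail and passes to midpoints; the last one carries smallness of the
    tail on a disc over to its hull. *)
Lemma hull_properties (N : nat) (f : Cx -> Cx) : hull (base N) f ->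
  Hp p f /\ e0 <= fst (L f) /\ (forall r, 0 <= r < 1 -> mean (pm p f) r <= B) /\
  (forall rho e, (forall n, (n >= N)%nat -> forall z, Cmod z <= rho -> Cmod (G n z) <= e) ->
     forall z, Cmod z <= rho -> Cmod (f z) <= e).
Proof.
induction 1 as [f [n [u [hn [hn1 [hu [-> hL]]]]]] | f g _ [f1 [f2 [f3 f4]]] _ [g1 [g2 [g3 g4]]]].
- split; [apply Hp_scal; trivial; lra |]; split; trivial; split.
  + intros r hr; rewrite pm_unimodular by trivial; now apply hB.
  + intros rho e h z hz; rewrite Cmod_mul, hu, Rmult_1_l; now apply (h n).
- split; [apply Hp_lcomb; trivial; lra |]; split; [| split].
  + rewrite linear_fmid by trivial; unfold cmid; simpl; lra.
  + intros r hr; apply pm_mean_fmid_le; auto; [apply f1 | apply g1].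
  + intros rho e h z hz; unfold fmid, lcomb.
    apply Rle_trans with (1 := Cmod_tri _ _); rewrite !Cmod_scal, Rabs_pos_eq by lra.
    specialize (f4 rho e h z hz); specialize (g4 rho e h z hz); lra.
Qed.

Lemma hull_far : exists delta, 0 < delta /\ forall N f x, hull (base N) f ->
  (forall r, 0 <= r < 1 -> mean (pm p f) r <= x) -> delta <= x.
Proof.
assert (hc0 : 0 < c).
{ destruct (hull_nonempty 0) as [f hf]; destruct (hull_properties 0 f hf) as [h1 [h2 _]].
  assert (h3 := hc f h1); assert (h4 := Hp_norm_ge0 p f ltac:(lra) h1).
  assert (h5 := Cre_le (L f)); assert (h6 := Rle_abs (fst (L f))).
  apply Rnot_le_lt; intros h; assert (c * Hp_norm p f <= 0) by nra; lra. }
exists (rpow (e0 / c) p); split; [apply rpow_gt0, Rdiv_lt_0_compat; trivial |].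
intros N f x hf hx; destruct (hull_properties N f hf) as [h1 [h2 _]].
assert (h3 := hc f h1); assert (h4 := Hp_norm_le p f x ltac:(lra) h1 hx).
assert (h5 := Cre_le (L f)); assert (h6 := Rle_abs (fst (L f))).
assert (hx0 : 0 <= x).
{ apply Rle_trans with (2 := hx 0 ltac:(lra)); apply pm_mean_ge0; [lra | apply h1 | lra]. }
rewrite <- (rpow_inv' x p) by lra; apply rpow_le; [lra |]; split.
- apply Rlt_le, Rdiv_lt_0_compat; trivial.
- apply Rle_trans with (Hp_norm p f); trivial.
  apply (Rmult_le_reg_l c); trivial; replace (c * (e0 / c)) with e0 by (field; lra); lra.
Qed.

(* A norm-minimizing sequence in the hulls of the tails is Cauchy by uniform
   convexity; its limit is 0 by local uniform convergence, yet it stays at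
   distance [delta] from 0. *)
Lemma weak_contradiction : False.
Proof.
destruct hull_far as [delta [hdelta hfar']].
set (E := fun N x => exists f, hull (base N) f /\ forall r, 0 <= r < 1 -> mean (pm p f) r <= x).
assert (hEB : forall N, E N B).
{ intros N; destruct (hull_nonempty N) as [f hf]; exists f; split; trivial.
  apply (hull_properties N f hf). }
(* The supremum is over lower bounds of the sets [E N], so D is the limit, as N grows, of the
   infimum of the p-th powers of the norms over the hull of the N-th tail. *)
destruct (completeness (fun x => exists N, forall y, E N y -> x <= y)) as [D [hD1 hD2]].
- exists B; intros x [N hN]; apply hN, hEB.
- exists delta, O; intros y [f [h1 h2]]; now apply (hfar' O f).
- assert (hDd : delta <= D) by (apply hD1; exists O; intros y [f [h1 h2]]; now apply (hfar' O f)).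
  assert (hpp := rpow_gt0 2 p ltac:(lra)).
  set (eps := delta / (16 * rpow 2 p * (D + 1))).
  assert (heps : 0 < eps) by (apply Rdiv_lt_0_compat; trivial; nra).
  destruct (mean_uniform_convexity p eps hp heps) as [K [hK HK]].
  set (tau := Rmin 1 (delta / (16 * rpow 2 p * (K + 1)))).
  assert (htau : 0 < tau) by (apply Rmin_pos; [lra | apply Rdiv_lt_0_compat; trivial; nra]).
  assert (htau1 : tau <= 1) by apply Rmin_l.
  assert (htau2 : tau <= delta / (16 * rpow 2 p * (K + 1))) by apply Rmin_r.
  (* What uniform convexity gives for |f - g|^p when f and g have means at most D + tau and their
     midpoint has a mean above D - tau. The choices of eps and tau make 2 2^p theta < delta, the
     final contradiction. *)
  set (theta := 2 * eps * (D + tau) + 2 * K * tau).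
  assert (htheta0 : 0 < theta).
  { unfold theta; assert (0 <= K * tau) by (apply Rmult_le_pos; lra).
    assert (0 < eps * (D + tau)) by (apply Rmult_lt_0_compat; lra); lra. }
  assert (htheta : 2 * rpow 2 p * theta < delta).
  { assert (k1 : rpow 2 p * (eps * (D + tau)) <= delta / 16).
    { apply Rle_trans with (rpow 2 p * (eps * (D + 1))).
      - apply Rmult_le_compat_l; [lra |]; apply Rmult_le_compat_l; lra.
      - right; unfold eps; field; lra. }
    assert (k2 : rpow 2 p * (K * tau) <= delta / 16).
    { apply Rle_trans with (rpow 2 p * ((K + 1) * (delta / (16 * rpow 2 p * (K + 1))))).
      - apply Rmult_le_compat_l; [lra |]; apply Rmult_le_compat; lra.
      - right; field; lra. }
    unfold theta; lra. }
  assert (hN0 : exists N0, forall y, E N0 y -> D - tau < y).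
  { apply NNPP; intros hn; assert (D <= D - tau); [| lra].
    apply hD2; intros x [N hN]; apply Rnot_lt_le; intros hx; apply hn.
    exists N; intros y hy; specialize (hN y hy); lra. }
  destruct hN0 as [N0 hN0].
  assert (hnear : forall N, exists f, hull (base N) f /\ forall r, 0 <= r < 1 -> mean (pm p f) r <= D + tau).
  { intros N; apply NNPP; intros hn; assert (D + tau <= D); [| lra].
    apply hD1; exists N; intros y [f [h1 h2]]; apply Rnot_lt_le; intros hy; apply hn.
    exists f; split; trivial; intros r hr; specialize (h2 r hr); lra. }
  destruct (hnear N0) as [f [hf hfm]]; destruct (hull_properties N0 f hf) as [f1 _].
  assert (hfh : holo f) by apply f1.
  enough (hfin : forall r, 0 <= r < 1 -> mean (pm p f) r <= 2 * rpow 2 p * theta).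
  { assert (k := hfar' N0 f _ hf hfin); lra. }
  intros r0 hr0.
  set (e := rpow theta (/ p)).
  assert (he : 0 < e) by now apply rpow_gt0.
  destruct (hG0 r0 e hr0 he) as [M hM].
  (* A second almost minimal element from a tail so late that it is small on |z| <= r0; it still
     lies in the hull that contains f, so their midpoint cannot be much smaller. *)
  destruct (hnear (max M N0)) as [g [hg hgm]].
  destruct (hull_properties _ g hg) as [g1 [_ [_ g4]]].
  assert (hgh : holo g) by apply g1.
  assert (hge : forall z, Cmod z <= r0 -> Cmod (g z) <= e).
  { apply g4; intros n hn z hz.
    assert (k := hM n ltac:(lia) z hz); now rewrite Csub_0_r in k. }
  assert (hg' : hull (base N0) g).
  { apply hull_mono with (2 := hg); intros h [n [u [h1 h2]]]; exists n, u; split; trivial; lia. }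
  (* The radius r1 where the midpoint is large depends on g. Monotonicity of the means allows
     working at max(r0, r1) and then returning to r0. *)
  assert (hmid : exists r1, 0 <= r1 < 1 /\ D - tau < mean (pm p (fmid f g)) r1).
  { apply NNPP; intros hn; assert (D - tau < D - tau); [| lra].
    apply hN0; exists (fmid f g); split; [now apply hull_mid |].
    intros r hr; apply Rnot_lt_le; intros h; apply hn; now exists r. }
  destruct hmid as [r1 [hr1 hr1m]].
  set (r := Rmax r0 r1).
  assert (hr : 0 <= r < 1) by (unfold r; apply Rmax_case; trivial).
  assert (hrr0 : r0 <= r) by apply Rmax_l; assert (hrr1 : r1 <= r) by apply Rmax_r.
  assert (hmr := pm_mean_monotone p (fmid f g) r1 r ltac:(lra) (holo_fmid f g hfh hgh) ltac:(lra) ltac:(lra)).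
  assert (hU := HK f g r hfh hgh hr).
  assert (hfr := hfm r hr); assert (hgr := hgm r hr).
  assert (hsub : mean (pm p (fsub f g)) r0 <= theta).
  { apply Rle_trans with (1 := pm_mean_monotone p (fsub f g) r0 r ltac:(lra) (holo_fsub f g hfh hgh) ltac:(lra) ltac:(lra)).
    apply Rle_trans with (1 := hU); unfold theta.
    assert (k1 : (eps + K / 2) * (mean (pm p f) r + mean (pm p g) r) <= (eps + K / 2) * (2 * (D + tau)))
      by (apply Rmult_le_compat_l; lra).
    assert (k2 : K * (D - tau) <= K * mean (pm p (fmid f g)) r) by (apply Rmult_le_compat_l; lra).
    lra. }
  replace f with (lcomb Cone Cone (fsub f g) g)
    by (apply functional_extensionality; intros; unfold lcomb, fsub; ring).
  apply Rle_trans with (1 := pm_mean_lcomb_le p Cone Cone _ g r0 ltac:(lra) (holo_fsub f g hfh hgh) hgh hr0).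
  replace (Cmod Cone) with 1 by (symmetry; unfold Cone; rewrite Cmod_real; apply Rabs_R1).
  rewrite rpow_one, !Rmult_1_r.
  assert (hgr0 : mean (pm p g) r0 <= theta).
  { rewrite <- (mean_const theta r0); apply mean_le.
    - apply dcont_circ'; trivial; apply pm_dcont; trivial; lra.
    - apply circ_const.
    - intros t; unfold pm; rewrite <- (rpow_inv' theta p) by lra.
      apply rpow_le; [lra |]; split; [apply Cmod_ge0 |]; apply hge; rewrite Cmod_pt, Rabs_pos_eq; lra. }
  assert (k1 := Rmult_le_compat_l (rpow 2 p) _ _ (Rlt_le _ _ hpp) hsub).
  assert (k2 := Rmult_le_compat_l (rpow 2 p) _ _ (Rlt_le _ _ hpp) hgr0); lra.
Qed.
End Weak.

(** If the values of L fail to converge at some eps, the differences F_n - F satisfy all the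
    hypotheses of [weak_contradiction]. *)
Lemma bounded_loc_unif_weak (p : R) (Fn : nat -> Cx -> Cx) (F : Cx -> Cx) : 1 < p ->
  (forall n, Hp p (Fn n)) -> Hp p F ->
  (exists B N, forall n, (n >= N)%nat -> forall r, 0 <= r < 1 -> mean (pm p (Fn n)) r <= B) ->
  loc_unif_lim Fn F -> weak_conv_Hp p Fn F.
Proof.
intros hp hFn hF [B [N1 hB]] hloc L hlin [c hc] eps heps.
apply NNPP; intros hn.
assert (hF1 := proj1 (Hp_iff p F ltac:(lra)) hF); destruct hF1 as [hFh [BF hBF]].
assert (hh : forall n, holo (Fn n)) by (intros; apply hFn).
apply (weak_contradiction p hp L hlin c eps (rpow 2 p * (B + BF)) (fun n => fsub (Fn n) F) hc heps) with (N1 := N1).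
- intros n; apply Hp_fsub; trivial; lra.
- intros n hn1 r hr; rewrite fsub_lcomb.
  apply Rle_trans with (1 := pm_mean_lcomb_le p _ _ _ _ r ltac:(lra) (hh n) hFh hr).
  rewrite !Cmod_real; replace (Rabs (-1)) with 1 by (rewrite Rabs_left; lra); rewrite Rabs_R1.
  rewrite rpow_one, !Rmult_1_r, <- Rmult_plus_distr_l.
  apply Rmult_le_compat_l; [apply rpow_ge0 |]; apply Rplus_le_compat; auto.
- intros rho e hr he; destruct (hloc rho e hr he) as [N hN]; exists N; intros n hn1 z hz.
  rewrite Csub_0_r; now apply hN.
- intros N; apply NNPP; intros h; apply hn; exists N; intros n hn1.
  apply Rnot_le_lt; intros hle; apply h; exists n; split; trivial.
  rewrite (linear_fsub p L hlin); trivial.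
Qed.

(** * Polynomial kernels *)

Lemma Cpow_cdiff (j : nat) (z : Cx) : cdiff (fun w => Cpow w j) z.
Proof.
induction j; simpl; [apply cdiff_const |].
apply cdiff_mul; [apply cdiff_id | trivial].
Qed.

Lemma Cpow_mul (z w : Cx) (j : nat) : Cpow (Cmul z w) j = Cmul (Cpow z j) (Cpow w j).
Proof.
induction j; simpl; [fold Cone; ring | rewrite IHj; ring].
Qed.

Lemma Cpow_ne (z : Cx) (j : nat) : z <> C0 -> Cpow z j <> C0.
Proof.
intros hz; induction j; simpl.
- intros h; injection h; lra.
- intros h; apply (f_equal Cmod) in h; rewrite Cmod_mul, Cmod_C0 in h.
  assert (h1 := Cmod_gt0 _ hz); assert (h2 := Cmod_gt0 _ IHj); nra.
Qed.

Lemma Cmod_pow (z : Cx) (j : nat) : Cmod (Cpow z j) = Cmod z ^ j.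
Proof.
induction j; simpl; [change (1, 0) with Cone; unfold Cone; rewrite Cmod_real; apply Rabs_R1 |].
now rewrite Cmod_mul, IHj.
Qed.

Lemma Cpow_pt (t : R) (j : nat) : Cpow (pt 1 t) j = pt 1 (INR j * t).
Proof.
induction j.
- simpl; unfold pt; rewrite Rmult_0_l, cos_0, sin_0; f_equal; ring.
- simpl Cpow; rewrite IHj, pt_mul, Rmult_1_l, S_INR; f_equal; ring.
Qed.

(* the Taylor coefficient of order [j] at 0 *)
Definition coef (f : Cx -> Cx) (j : nat) : Cx :=
  cmean (fun w => Cmul (f w) (Cinv (Cpow w j))) (1 / 2).

Lemma pt_ne (r t : R) : 0 < r -> pt r t <> C0.
Proof. intros hr h; apply (f_equal Cmod) in h; rewrite Cmod_pt, Cmod_C0, Rabs_pos_eq in h; lra. Qed.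

Lemma coef_integrand_cdiff (f : Cx -> Cx) (j : nat) (r t : R) : holo f -> 0 < r < 1 ->
  cdiff (fun w => Cmul (f w) (Cinv (Cpow w j))) (pt r t).
Proof.
intros hf hr; apply cdiff_mul.
- apply (proj1 (holo_cdiff f) hf); rewrite Cmod_pt, Rabs_pos_eq; lra.
- apply (cdiff_inv (fun w => Cpow w j)); [apply Cpow_cdiff | apply Cpow_ne, pt_ne; lra].
Qed.

Lemma coef_radius (f : Cx -> Cx) (j : nat) (r : R) : holo f -> 0 < r < 1 ->
  cmean (fun w => Cmul (f w) (Cinv (Cpow w j))) r = coef f j.
Proof.
intros hf hr; unfold coef; destruct (Rle_or_lt r (1 / 2)) as [h | h]; [| symmetry];
  apply cmean_const_annulus; try lra; intros; apply coef_integrand_cdiff; trivial; lra.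
Qed.

(** On |w| = r the product of w^j and its conjugate is r^(2j), so conj(w^j) is r^(2j) / w^j. *)
Lemma coef_conj_mean (f : Cx -> Cx) (j : nat) (r : R) : holo f -> 0 < r < 1 ->
  cmean (fun w => Cmul (f w) (Cconj (Cpow w j))) r = Cmul ((r ^ 2) ^ j, 0) (coef f j).
Proof.
intros hf hr; rewrite <- (coef_radius f j r hf hr), <- cmean_mul.
- apply cmean_ext; intros t; set (w := pt r t).
  assert (hw : Cpow w j <> C0) by (apply Cpow_ne, pt_ne; lra).
  replace (((r ^ 2) ^ j, 0) : Cx) with (Cmul (Cpow w j) (Cconj (Cpow w j))).
  + field; trivial.
  + rewrite Cmul_conj, Cmod_pow; unfold w; rewrite Cmod_pt, Rabs_pos_eq, <- !pow_mult by lra.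
    do 2 f_equal; lia.
- intros t; now apply cdiff_ccont, coef_integrand_cdiff.
Qed.

Lemma coef_lcomb (a b : Cx) (f g : Cx -> Cx) (j : nat) : holo f -> holo g ->
  coef (lcomb a b f g) j = Cadd (Cmul a (coef f j)) (Cmul b (coef g j)).
Proof.
intros hf hg.
assert (h1 : ccirc (fun w => Cmul (f w) (Cinv (Cpow w j))) (1 / 2))
  by (intros t; apply cdiff_ccont, coef_integrand_cdiff; trivial; lra).
assert (h2 : ccirc (fun w => Cmul (g w) (Cinv (Cpow w j))) (1 / 2))
  by (intros t; apply cdiff_ccont, coef_integrand_cdiff; trivial; lra).
unfold coef; rewrite <- !cmean_mul by trivial; rewrite <- cmean_add.
- apply cmean_ext; intros t; unfold lcomb; ring.
- intros t; apply ccont_mul; [apply ccont_const | apply h1].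
- intros t; apply ccont_mul; [apply ccont_const | apply h2].
Qed.

Lemma coef_bound (f : Cx -> Cx) (j : nat) (e : R) : holo f -> 0 <= e ->
  (forall w, Cmod w <= 1 / 2 -> Cmod (f w) <= e) -> Cmod (coef f j) <= e * 2 ^ j.
Proof.
intros hf he h; apply cmean_bound.
- intros t; apply cdiff_ccont, coef_integrand_cdiff; trivial; lra.
- intros t; assert (hw : Cpow (pt (1 / 2) t) j <> C0) by (apply Cpow_ne, pt_ne; lra).
  rewrite Cmod_mul, Cmod_inv, Cmod_pow, Cmod_pt, Rabs_pos_eq by (trivial; lra).
  replace (/ (1 / 2) ^ j) with (2 ^ j).
  + apply Rmult_le_compat_r; [apply pow_le; lra |]; apply h; rewrite Cmod_pt, Rabs_pos_eq; lra.
  + unfold Rdiv; rewrite Rmult_1_l, pow_inv, Rinv_inv; trivial.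
Qed.

Definition rot (th : R) (f : Cx -> Cx) (w : Cx) : Cx := f (Cmul (pt 1 th) w).

Lemma Cmod_rot (th : R) (w : Cx) : Cmod (Cmul (pt 1 th) w) = Cmod w.
Proof. rewrite Cmod_mul, Cmod_pt, Rabs_R1; ring. Qed.

Lemma holo_rot (th : R) (f : Cx -> Cx) : holo f -> holo (rot th f).
Proof.
rewrite !holo_cdiff; intros hf z hz; apply (cdiff_comp f (fun w => Cmul (pt 1 th) w)).
- apply cdiff_mul; [apply cdiff_const | apply cdiff_id].
- apply hf; now rewrite Cmod_rot.
Qed.

Lemma pm_area_rot (p th x : R) (f : Cx -> Cx) : 0 < p -> holo f -> 0 <= x < 1 ->
  area (pm p (rot th f)) x = area (pm p f) x.
Proof. intros hp hf hx; apply (area_rot (pm p f)); trivial; now apply pm_dcont. Qed.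

Lemma Ap_rot (p th : R) (f : Cx -> Cx) : 0 < p -> Ap p f -> Ap p (rot th f).
Proof.
intros hp; rewrite !Ap_iff by trivial; intros [hf [B hB]]; split; [now apply holo_rot |].
exists B; intros x hx; rewrite pm_area_rot; auto.
Qed.

Lemma mass_rot (p th : R) (f : Cx -> Cx) : 0 < p -> Ap p f -> mass p (rot th f) = mass p f.
Proof.
intros hp hf; apply area_int_eq; [apply pm_dcont; trivial; apply holo_rot, hf |].
apply lim1_ext with (2 := mass_lim p f hp hf); intros; symmetry; apply pm_area_rot; trivial; apply hf.
Qed.

Lemma coef_rot (th : R) (f : Cx -> Cx) (j : nat) : holo f ->
  coef (rot th f) j = Cmul (pt 1 (INR j * th)) (coef f j).
Proof.
intros hf; unfold coef.
set (G := fun w => Cmul (f w) (Cinv (Cpow w j))).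
assert (hG : ccirc G (1 / 2)) by (intros t; apply cdiff_ccont, coef_integrand_cdiff; trivial; lra).
transitivity (Cmul (pt 1 (INR j * th)) (cmean (fun w => G (Cmul (pt 1 th) w)) (1 / 2))).
- rewrite <- cmean_mul.
  + apply cmean_ext; intros t; unfold G, rot; rewrite Cpow_mul, Cpow_pt; field; split.
    * apply Cpow_ne, pt_ne; lra.
    * apply pt_ne; lra.
  + intros t; apply (ccont_comp G (fun w => Cmul (pt 1 th) w)).
    * apply ccont_mul; [apply ccont_const | apply ccont_id].
    * rewrite pt_mul, Rmult_1_l; apply hG.
- f_equal; unfold cmean; f_equal.
  + apply (mean_rot (fun w => fst (G w))); now apply ccirc_fst.
  + apply (mean_rot (fun w => snd (G w))); now apply ccirc_snd.
Qed.

Definition poly (a : nat -> Cx) (n : nat) (z : Cx) : Cx := Csum (fun j => Cmul (a j) (Cpow z j)) n.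

(** For the kernel with coefficients [a] the functional is the sum of these numbers divided by j +
    1, because z^j has squared A^2 norm 1/(j + 1). *)
Definition pcoef (a : nat -> Cx) (f : Cx -> Cx) (j : nat) : Cx := Cmul (coef f j) (Cconj (a j)).

Lemma poly_cdiff (a : nat -> Cx) (n : nat) (z : Cx) : cdiff (poly a n) z.
Proof.
assert (h : forall j, cdiff (fun z => Cmul (a j) (Cpow z j)) z)
  by (intros; apply cdiff_mul; [apply cdiff_const | apply Cpow_cdiff]).
unfold poly; induction n; simpl; [apply h |].
apply (cdiff_add (fun z => Csum (fun j => Cmul (a j) (Cpow z j)) n)); trivial; apply (h (S n)).
Qed.

Lemma pair_monomial_mean (c : Cx) (j : nat) (f : Cx -> Cx) (r : R) : holo f -> 0 < r < 1 ->
  mean (pair (fun z => Cmul c (Cpow z j)) f) r = fst (Cmul (coef f j) (Cconj c)) * (r ^ 2) ^ j.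
Proof.
intros hf hr.
assert (h := coef_conj_mean f j r hf hr).
apply (f_equal (fun z => fst (Cmul (Cconj c) z))) in h.
rewrite <- cmean_mul in h.
- transitivity (fst (Cmul (Cconj c) (Cmul ((r ^ 2) ^ j, 0) (coef f j)))); [rewrite <- h |].
  + apply mean_ext; intros t; unfold pair; rewrite Cconj_mul; f_equal; ring.
  + unfold Cmul, Cconj; simpl; ring.
- intros t; apply ccont_mul; [apply holo_ccont; trivial; rewrite Cmod_pt, Rabs_pos_eq; lra |].
  apply (ccont_conj (fun w => Cpow w j)), cdiff_ccont, Cpow_cdiff.
Qed.

Lemma pair_poly_mean (a : nat -> Cx) (n : nat) (f : Cx -> Cx) (r : R) : holo f -> 0 < r < 1 ->
  mean (pair (poly a n) f) r = sum_f_R0 (fun j => fst (pcoef a f j) * (r ^ 2) ^ j) n.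
Proof.
intros hf hr; induction n.
- cbn [sum_f_R0]; unfold pcoef; rewrite <- (pair_monomial_mean (a O) O f r hf hr); reflexivity.
- cbn [sum_f_R0]; rewrite <- IHn; unfold pcoef.
  rewrite <- (pair_monomial_mean (a (S n)) (S n) f r hf hr), <- mean_add.
  + apply mean_ext; intros t; unfold pair, poly; simpl Csum; rewrite Cconj_add.
    unfold Cmul, Cadd, Cconj; simpl; ring.
  + apply dcont_circ'; [| lra]; apply pair_dcont; trivial.
    apply holo_cdiff; intros; apply poly_cdiff.
  + apply dcont_circ'; [| lra]; apply pair_dcont; trivial.
    apply holo_cdiff; intros; apply cdiff_mul; [apply cdiff_const | apply Cpow_cdiff].
Qed.

Lemma RInt_even_monomial (b : R) (j : nat) (x : R) :
  is_RInt (fun r => 2 * r * (b * (r ^ 2) ^ j)) 0 x (b / INR (S j) * (x ^ 2) ^ (S j)).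
Proof.
assert (hj : 0 < INR (S j)) by (apply lt_0_INR; lia).
replace (b / INR (S j) * (x ^ 2) ^ S j) with
  (minus (b / INR (S j) * (x ^ 2) ^ S j) (b / INR (S j) * (0 ^ 2) ^ S j)).
- apply (is_RInt_derive (V := R_CompleteNormedModule) (fun r => b / INR (S j) * (r ^ 2) ^ S j)).
  + intros r _.
    replace (2 * r * (b * (r ^ 2) ^ j)) with (b / INR (S j) * (INR (S j) * (2 * r) * (r ^ 2) ^ pred (S j)))
      by (simpl pred; field; lra).
    apply (is_derive_scal (fun r => (r ^ 2) ^ S j)), (is_derive_pow (fun r => r ^ 2)).
    auto_derive; trivial; ring.
  + intros r _; apply continuity_pt_filterlim.
    apply derivable_continuous_pt, ex_derive_Reals_0; auto_derive; trivial.
- unfold minus, plus, opp; simpl; ring.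
Qed.

Lemma sum_RInt (b : nat -> R) (n : nat) (x : R) :
  is_RInt (fun r => 2 * r * sum_f_R0 (fun j => b j * (r ^ 2) ^ j) n) 0 x
    (sum_f_R0 (fun j => b j / INR (S j) * (x ^ 2) ^ (S j)) n).
Proof.
induction n; cbn [sum_f_R0].
- apply (RInt_even_monomial (b O) O x).
- apply (is_RInt_ext (fun r => plus (2 * r * sum_f_R0 (fun j => b j * (r ^ 2) ^ j) n) (2 * r * (b (S n) * (r ^ 2) ^ S n)))).
  + intros; unfold plus; simpl; ring.
  + apply (is_RInt_plus (V := R_NormedModule)); trivial; apply RInt_even_monomial.
Qed.

Definition is_poly_of (k : Cx -> Cx) (a : nat -> Cx) (n : nat) : Prop :=
  forall z, Cmod z < 1 -> k z = poly a n z.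

Lemma pair_poly_mean' (k : Cx -> Cx) (a : nat -> Cx) (n : nat) (f : Cx -> Cx) (r : R) :
  is_poly_of k a n -> holo f -> 0 < r < 1 ->
  mean (pair k f) r = sum_f_R0 (fun j => fst (pcoef a f j) * (r ^ 2) ^ j) n.
Proof.
intros hk hf hr; rewrite <- pair_poly_mean by trivial.
apply mean_ext; intros t; unfold pair; rewrite hk; trivial; rewrite Cmod_pt, Rabs_pos_eq; lra.
Qed.

Lemma pair_poly_area (k : Cx -> Cx) (a : nat -> Cx) (n : nat) (f : Cx -> Cx) (x : R) :
  is_poly_of k a n -> holo f -> 0 <= x < 1 ->
  area (pair k f) x = sum_f_R0 (fun j => fst (pcoef a f j) / INR (S j) * (x ^ 2) ^ (S j)) n.
Proof.
intros hk hf hx; apply is_RInt_unique.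
apply (is_RInt_ext (fun r => 2 * r * sum_f_R0 (fun j => fst (pcoef a f j) * (r ^ 2) ^ j) n)); [| apply (sum_RInt (fun j => fst (pcoef a f j)))].
intros r hr; rewrite Rmin_left, Rmax_right in hr by lra; rewrite (pair_poly_mean' k a n); trivial; lra.
Qed.

Lemma one_minus_pow (j : nat) (x : R) : 0 <= x <= 1 ->
  0 <= x ^ j <= 1 /\ 1 - x ^ j <= INR j * (1 - x) /\
  INR j * (1 - x) - INR j ^ 2 * (1 - x) ^ 2 <= 1 - x ^ j.
Proof.
intros hx; induction j; [simpl; lra |].
destruct IHj as [[h1 h2] [h3 h4]]; rewrite S_INR; simpl (x ^ S j).
assert (hj := pos_INR j); repeat split; try nra.
Qed.

Lemma lim1_pow (c : R) (j : nat) : lim1 (fun x => c * (x ^ 2) ^ j) c.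
Proof.
assert (h : lim1 (fun x => (x ^ 2) ^ j) 1).
{ intros eps heps; assert (hj := pos_INR j).
  exists (Rmin 1 (eps / (2 * INR j + 1))); split; [apply Rmin_pos; [lra | apply Rdiv_lt_0_compat; lra] |].
  intros x hx; assert (h1 := Rmin_l 1 (eps / (2 * INR j + 1))); assert (h2 := Rmin_r 1 (eps / (2 * INR j + 1))).
  destruct (one_minus_pow j (x ^ 2) ltac:(nra)) as [h3 [h4 _]].
  assert (h5 : INR j * (1 - x ^ 2) <= INR j * (2 * (1 - x))) by (apply Rmult_le_compat_l; nra).
  assert (h6 : INR j * (2 * (1 - x)) < eps).
  { apply Rle_lt_trans with ((2 * INR j + 1) * (1 - x)); [nra |].
    apply Rlt_le_trans with ((2 * INR j + 1) * (eps / (2 * INR j + 1))); [apply Rmult_lt_compat_l; lra |].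
    right; field; lra. }
  apply Rabs_def1; lra. }
assert (h' := lim1_cmul c _ _ h); now rewrite Rmult_1_r in h'.
Qed.

Lemma lim1_sum (b : nat -> R) (n : nat) :
  lim1 (fun x => sum_f_R0 (fun j => b j * (x ^ 2) ^ (S j)) n) (sum_f_R0 b n).
Proof.
induction n; cbn [sum_f_R0]; [apply (lim1_pow (b O) 1) |].
apply (lim1_add _ (fun x => b (S n) * (x ^ 2) ^ S (S n))); trivial; apply lim1_pow.
Qed.

Lemma rphi_poly (k : Cx -> Cx) (a : nat -> Cx) (n : nat) (f : Cx -> Cx) :
  is_poly_of k a n -> holo k -> holo f ->
  rphi k f = sum_f_R0 (fun j => fst (pcoef a f j) / INR (S j)) n.
Proof.
intros hk hkh hf; apply area_int_eq; [now apply pair_dcont |].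
apply lim1_ext with (2 := lim1_sum (fun j => fst (pcoef a f j) / INR (S j)) n).
intros x hx; symmetry; now apply pair_poly_area.
Qed.

(** * The lower bound for the Hardy norm *)

Lemma one_minus_cos (x : R) : 0 <= 1 - cos x <= x ^ 2.
Proof.
assert (h := COS_bound x); split; [lra |].
replace x with (2 * (x / 2)) at 1 by field; rewrite cos_2a_sin.
destruct (trig_lipschitz (x / 2) 0) as [_ h1]; rewrite sin_0, !Rminus_0_r in h1.
assert (h2 := Rabs_pos (sin (x / 2))).
assert (h3 : Rabs (sin (x / 2)) ^ 2 <= Rabs (x / 2) ^ 2) by (apply pow_incr; lra).
rewrite !pow2_abs in h3; assert (h4 := pow2_ge_0 x); nra.
Qed.

Lemma sin_minus_id (x : R) : Rabs (sin x - x) <= x ^ 2.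
Proof.
destruct (MVT_gen (fun t => sin t - t) 0 x (fun t => cos t - 1)) as [c [hc h]].
- intros; auto_derive; trivial; ring.
- intros; apply continuity_pt_minus; [apply continuity_sin | apply continuity_pt_id].
- rewrite sin_0, !Rminus_0_r in h; rewrite h, Rabs_mult.
  destruct (trig_lipschitz c 0) as [h1 _]; rewrite cos_0, Rminus_0_r in h1.
  assert (hcx : Rabs c <= Rabs x).
  { apply Rabs_le; unfold Rabs; destruct (Rcase_abs x) as [hx | hx];
      [rewrite Rmin_right, Rmax_left in hc by lra | rewrite Rmin_left, Rmax_right in hc by lra]; lra. }
  rewrite <- pow2_abs; assert (h2 := Rabs_pos x); nra.
Qed.

Definition gapf (p : R) (f g : Cx -> Cx) (w : Cx) : R := gap p (f w) (g w).

Lemma gapf_eq (p : R) (f g : Cx -> Cx) :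
  gapf p f g = (fun w => / 2 * (pm p f w + pm p g w) + (-1) * pm p (fmid f g) w).
Proof.
apply functional_extensionality; intros w; unfold gapf, gap, pm.
change (cmid (f w) (g w)) with (fmid f g w); field.
Qed.

Lemma gapf_dcont (p : R) (f g : Cx -> Cx) : 0 < p -> holo f -> holo g -> dcont (gapf p f g).
Proof.
intros hp hf hg; rewrite gapf_eq; apply dcont_add; apply dcont_cmul.
- apply dcont_add; now apply pm_dcont.
- now apply pm_dcont, holo_fmid.
Qed.

Lemma gapf_area (p : R) (f g : Cx -> Cx) (x : R) : 0 < p -> holo f -> holo g -> 0 <= x < 1 ->
  area (gapf p f g) x = / 2 * (area (pm p f) x + area (pm p g) x) + (-1) * area (pm p (fmid f g)) x.
Proof.
intros hp hf hg hx; rewrite gapf_eq; apply area_lin3; trivial; apply pm_dcont; trivial; now apply holo_fmid.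
Qed.

Lemma gapf_area_le (p : R) (f g : Cx -> Cx) (x : R) : 1 < p -> Ap p f -> Ap p g -> 0 <= x < 1 ->
  area (gapf p f g) x <= (mass p f + mass p g) / 2 - mass p (fmid f g).
Proof.
intros hp hf hg hx; assert (hfh : holo f) by apply hf; assert (hgh : holo g) by apply hg.
assert (hp0 : 0 < p) by lra.
assert (hl := lim1_add _ _ _ _ (lim1_cmul (/ 2) _ _ (lim1_add _ _ _ _ (mass_lim p f hp0 hf) (mass_lim p g hp0 hg)))
  (lim1_cmul (-1) _ _ (mass_lim p (fmid f g) hp0 (Ap_lcomb p _ _ f g hp0 hf hg)))).
replace ((mass p f + mass p g) / 2 - mass p (fmid f g)) with
  (/ 2 * (mass p f + mass p g) + -1 * mass p (fmid f g)) by field.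
apply (lim1_incr_le (area (gapf p f g))); trivial.
- intros; apply area_incr; trivial; [now apply gapf_dcont | intros; now apply gap_ge0].
- apply lim1_ext with (2 := hl); intros; symmetry; now apply gapf_area.
Qed.

Lemma rot_rot (a b : R) (f : Cx -> Cx) : rot a (rot b f) = rot (a + b) f.
Proof.
apply functional_extensionality; intros w; unfold rot.
replace (pt 1 (a + b)) with (Cmul (pt 1 b) (pt 1 a)) by (rewrite pt_mul; f_equal; ring).
f_equal; ring.
Qed.

Lemma rot_0 (f : Cx -> Cx) : rot 0 f = f.
Proof.
apply functional_extensionality; intros w; unfold rot; f_equal.
unfold pt; rewrite cos_0, sin_0; unfold Cmul; simpl; rewrite <- (Cx_eta w) at 5; f_equal; ring.
Qed.

Section Lower.
Variables (p q : R).
Hypothesis hp : 1 < p.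
Hypothesis hq : q = p / (p - 1).
Variables (k F : Cx -> Cx) (a : nat -> Cx) (n : nat).
Hypothesis hka : is_poly_of k a n.
Hypothesis hk : Hp q k.
Hypothesis hk0 : not_zero k.
Hypothesis hF : is_extremal p k F.

Let hkh : holo k := proj1 hk.
Let hFA : Ap p F := proj1 hF.
Let hFh : holo F := proj1 (proj1 hF).
Let hn : normalized p F := extremal_normalized p k F hF.
Let hm1 : mass p F = 1 := normalized_mass p hp F hn.
Let hp0 : 0 < p := Rlt_trans _ _ _ Rlt_0_1 hp.
Let N := phi_norm p k.
Let hN : 0 < N := phi_norm_pos p q hp hq k F hk hk0 hn.

Let b (j : nat) : R := fst (pcoef a F j).
Let b' (j : nat) : R := snd (pcoef a F j).

(** The real part of the functional at z F', whose coefficients are j times those of F. *)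
Definition radial_slope : R := sum_f_R0 (fun j => fst (pcoef a F j) * (INR j / INR (S j))) n.

(** One constant for all second-order errors: 1 - cos(j th) and |sin(j th) - j th| are both at most
    j^2 th^2. *)
Let second : R := sum_f_R0 (fun j => (Rabs (b j) + Rabs (b' j)) * (INR j ^ 2 / INR (S j))) n.

Lemma phi_norm_sum : N = sum_f_R0 (fun j => b j / INR (S j)) n.
Proof. unfold b; rewrite <- (rphi_poly k a n F) by trivial; symmetry; apply hF. Qed.

Lemma inv_INR_pos (j : nat) : 0 < / INR (S j).
Proof. apply Rinv_0_lt_compat, lt_0_INR; lia. Qed.

Lemma second_ge0 : 0 <= second.
Proof.
apply cond_pos_sum; intros j; apply Rmult_le_pos.
- assert (h1 := Rabs_pos (b j)); assert (h2 := Rabs_pos (b' j)); lra.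
- apply Rmult_le_pos; [apply pow2_ge_0 | apply Rlt_le, inv_INR_pos].
Qed.

(** Averaging the rotations by al and -al multiplies the j-th coefficient by cos(j al), so the
    first-order term disappears; only finitely many j occur. *)
Lemma rphi_symmetric (al : R) : N - second * al ^ 2 <= rphi k (fmid (rot al F) (rot (- al) F)).
Proof.
rewrite (rphi_poly k a n) by (trivial; apply holo_fmid; now apply holo_rot).
rewrite phi_norm_sum; unfold second; rewrite Rmult_comm, scal_sum, <- minus_sum.
apply sum_Rle; intros j _.
assert (hj : fst (pcoef a (fmid (rot al F) (rot (- al) F)) j) = b j * cos (INR j * al)).
{ unfold b, pcoef, fmid; rewrite coef_lcomb, !coef_rot by (trivial; now apply holo_rot).
  replace (INR j * - al) with (- (INR j * al)) by ring.
  unfold Cmul, Cadd, Cconj, pt; simpl; rewrite cos_neg, sin_neg; field. }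
rewrite hj; assert (hi := inv_INR_pos j); unfold Rdiv.
destruct (one_minus_cos (INR j * al)) as [h1 h2].
assert (h3 : b j * (1 - cos (INR j * al)) <= (Rabs (b j) + Rabs (b' j)) * (INR j * al) ^ 2).
{ assert (k1 := Rle_abs (b j)); assert (k2 := Rabs_pos (b j)); assert (k3 := Rabs_pos (b' j)).
  apply Rle_trans with (Rabs (b j) * (INR j * al) ^ 2); [| nra].
  apply Rle_trans with (Rabs (b j) * (1 - cos (INR j * al))); [apply Rmult_le_compat_r; lra | now apply Rmult_le_compat_l]. }
assert (h4 := Rmult_le_compat_r _ _ _ (Rlt_le _ _ hi) h3); nra.
Qed.

(* Since [F] maximizes against [k], the symmetrized rotation cannot lose more
   than second order; this controls the angular derivative of [F]. *)
Lemma rot_gap_bound : exists C, 0 <= C /\ forall th x, 0 <= x < 1 ->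
  area (gapf p (rot th F) F) x <= C * th ^ 2.
Proof.
exists (p / N * second / 4); split.
{ assert (h := second_ge0); assert (0 < p / N) by now apply Rdiv_lt_0_compat.
  apply Rmult_le_pos; [apply Rmult_le_pos |]; lra. }
(* Rotation by th/2 carries the symmetric pair of rotations by th/2 and -th/2 to the rotation by th
   and F itself, without changing integrals over discs. *)
intros th x hx; set (al := th / 2).
assert (hA1 := Ap_rot p al F hp0 hFA); assert (hA2 := Ap_rot p (- al) F hp0 hFA).
assert (h1 := gapf_area_le p _ _ x hp hA1 hA2 hx).
rewrite !mass_rot, hm1 in h1 by trivial.
assert (h2 := rphi_symmetric al).
assert (h3 := rphi_extremal_bound p q hp hq k F _ hk hn (Ap_lcomb p (/ 2, 0) (/ 2, 0) _ _ hp0 hA1 hA2)).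
fold (fmid (rot al F) (rot (- al) F)) in h3; fold N in h3.
set (m := mass p (fmid (rot al F) (rot (- al) F))) in *.
assert (h4 : 1 - m <= p / N * second * al ^ 2).
{ apply (Rmult_le_reg_l (N / p)); [now apply Rdiv_lt_0_compat |].
  replace (N / p * (p / N * second * al ^ 2)) with (second * al ^ 2) by (field; lra).
  replace (N / p * (1 - m)) with (N - N * (1 + (m - 1) / p)) by (field; lra); lra. }
assert (hrot : area (gapf p (rot th F) F) x = area (gapf p (rot al F) (rot (- al) F)) x).
{ rewrite <- (area_rot (gapf p (rot al F) (rot (- al) F)) al); trivial.
  - f_equal; apply functional_extensionality; intros w; unfold gapf.
    change (rot al F (Cmul (pt 1 al) w)) with (rot al (rot al F) w).
    change (rot (- al) F (Cmul (pt 1 al) w)) with (rot al (rot (- al) F) w).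
    rewrite !rot_rot; replace (al + al) with th by (unfold al; field).
    replace (al + - al) with 0 by ring; now rewrite rot_0.
  - apply gapf_dcont; trivial; now apply holo_rot. }
rewrite hrot; unfold al in *; lra.
Qed.

(* [F - i (F(e^{i th} w) - F(w))], which is [F((1+th) w) + O(th^2)] inside the disc *)
Definition tilt (th : R) : Cx -> Cx := lcomb (1, 1) (0, -1) F (rot th F).

Lemma Ap_tilt (th : R) : Ap p (tilt th).
Proof. apply Ap_lcomb; trivial; now apply Ap_rot. Qed.

(** With x = j th, tilting multiplies the j-th coefficient by 1 + sin x + i (1 - cos x), which is 1
    + x up to order x^2. *)
Lemma rphi_tilt (th : R) : N + th * radial_slope - second * th ^ 2 <= rphi k (tilt th).
Proof.
rewrite (rphi_poly k a n) by (trivial; apply Ap_tilt).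
rewrite phi_norm_sum; unfold second, radial_slope.
rewrite (Rmult_comm (sum_f_R0 (fun j => (Rabs (b j) + Rabs (b' j)) * (INR j ^ 2 / INR (S j))) n)).
rewrite !scal_sum, <- plus_sum, <- minus_sum.
apply sum_Rle; intros j _.
assert (hj : fst (pcoef a (tilt th) j) = b j * (1 + sin (INR j * th)) - b' j * (1 - cos (INR j * th))).
{ unfold b, b', pcoef, tilt; rewrite coef_lcomb, !coef_rot by (trivial; now apply holo_rot).
  unfold Cmul, Cadd, Cconj, pt; simpl; ring. }
rewrite hj; assert (hi := inv_INR_pos j); unfold Rdiv.
fold (b j); set (x := INR j * th).
destruct (one_minus_cos x) as [h1 h2]; assert (h3 := sin_minus_id x).
assert (h4 : b j * (x - sin x) + b' j * (1 - cos x) <= (Rabs (b j) + Rabs (b' j)) * x ^ 2).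
{ rewrite Rmult_plus_distr_r; apply Rplus_le_compat.
  - apply Rle_trans with (1 := Rle_abs _); rewrite Rabs_mult, (Rabs_minus_sym x).
    apply Rmult_le_compat_l; [apply Rabs_pos | exact h3].
  - apply Rle_trans with (1 := Rle_abs _); rewrite Rabs_mult, (Rabs_pos_eq (1 - cos x)) by lra.
    apply Rmult_le_compat_l; [apply Rabs_pos | exact h2]. }
assert (h5 := Rmult_le_compat_r _ _ _ (Rlt_le _ _ hi) h4); unfold x in *; nra.
Qed.

Lemma tilt_mass_ge (th : R) : p * (th * radial_slope - second * th ^ 2) / N <= mass p (tilt th) - 1.
Proof.
assert (h1 := rphi_tilt th).
assert (h2 := rphi_extremal_bound p q hp hq k F _ hk hn (Ap_tilt th)); fold N in h2.
apply (Rmult_le_reg_l (N / p)); [now apply Rdiv_lt_0_compat |].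
replace (N / p * (p * (th * radial_slope - second * th ^ 2) / N)) with (th * radial_slope - second * th ^ 2) by (field; lra).
replace (N / p * (mass p (tilt th) - 1)) with (N * (1 + (mass p (tilt th) - 1) / p) - N) by (field; lra); lra.
Qed.

Lemma tilt_sub_le (th : R) (w : Cx) : Cmod (Csub (tilt th w) (F w)) <= Cmod (Csub (rot th F w) (F w)).
Proof.
replace (Csub (tilt th w) (F w)) with (Cmul (0, -1) (Csub (rot th F w) (F w))).
- rewrite Cmod_mul; replace (Cmod (0, -1)) with 1; [lra |].
  symmetry; unfold Cmod; simpl; replace (0 * (0 * 1) + -1 * (-1 * 1)) with 1 by ring; apply sqrt_1.
- unfold tilt, lcomb, Csub, Cadd, Copp, Cmul; simpl; f_equal; ring.
Qed.

(** The tilt moves F by the same distance as the rotation does. With W the maximum of |F| and its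
    rotation, that distance is at most 2 W, so the tilt is at most 3 W, whence 3^(p-1); then
    [gap_first_order] applies. *)
Lemma tilt_pointwise : exists C, 0 < C /\ forall l th w, 0 < l ->
  pm p (tilt th) w <= pm p F w + C * (l * gapf p (rot th F) F w + (pm p (rot th F) w + pm p F w) / l).
Proof.
destruct (gap_first_order p hp) as [C [hC H]].
set (D := p * rpow 3 (p - 1)).
assert (hD : 0 < D) by (apply Rmult_lt_0_compat; [| apply rpow_gt0]; lra).
exists (D * C + D); split; [assert (0 < D * C) by (now apply Rmult_lt_0_compat); lra |].
intros l th w hl.
assert (h1 := H l (rot th F w) (F w) hl); assert (h2 := tilt_sub_le th w).
destruct (Rmax_Cmod p (rot th F w) (F w)) as [hW [hd hs]].
assert (hW2 := Rmax_r (Cmod (rot th F w)) (Cmod (F w))).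
assert (hg := gap_ge0 p (rot th F w) (F w) hp).
set (W := Rmax (Cmod (rot th F w)) (Cmod (F w))) in *; set (d := Cmod (Csub (rot th F w) (F w))) in *.
assert (ht := Cmod_tri_sub (tilt th w) (F w)).
assert (hd0 : 0 <= d) by apply Cmod_ge0.
assert (hsum : 0 <= (pm p (rot th F) w + pm p F w) / l).
{ apply Rmult_le_pos; [| apply Rlt_le, Rinv_0_lt_compat, hl].
  assert (k1 := pm_ge0 p (rot th F) w); assert (k2 := pm_ge0 p F w); lra. }
assert (hlg : 0 <= l * gapf p (rot th F) F w) by (apply Rmult_le_pos; [lra | exact hg]).
assert (h3 : pm p (tilt th) w - pm p F w <= D * (d * rpow W (p - 1))).
{ apply Rle_trans with (1 := rpow_diff_le p (Cmod (F w)) (Cmod (tilt th w)) ltac:(lra) (Cmod_ge0 _) (Cmod_ge0 _)).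
  assert (k1 := rpow_ge0 (Cmod (tilt th w)) (p - 1)).
  assert (k2 : rpow (Cmod (tilt th w)) (p - 1) <= rpow 3 (p - 1) * rpow W (p - 1)).
  { rewrite <- rpow_mult by lra; apply rpow_le; [lra |]; split; [apply Cmod_ge0 | lra]. }
  replace (D * (d * rpow W (p - 1))) with (p * (rpow 3 (p - 1) * rpow W (p - 1)) * d) by (unfold D; ring).
  apply Rle_trans with (p * rpow (Cmod (tilt th w)) (p - 1) * d).
  - apply Rmult_le_compat_l; [apply Rmult_le_pos; lra | lra].
  - apply Rmult_le_compat_r; trivial; apply Rmult_le_compat_l; lra. }
assert (h4 := Rmult_le_compat_l D _ _ (Rlt_le _ _ hD) h1).
change (gap p (rot th F w) (F w)) with (gapf p (rot th F) F w) in h4.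
change (rpow (Cmod (rot th F w)) p) with (pm p (rot th F) w) in h4.
change (rpow (Cmod (F w)) p) with (pm p F w) in h4.
assert (k3 := Rmult_le_pos _ _ (Rlt_le _ _ hD) hlg).
assert (k4 := Rmult_le_pos _ _ (Rlt_le _ _ (Rmult_lt_0_compat _ _ hD hC)) hsum).
replace ((D * C + D) * (l * gapf p (rot th F) F w + (pm p (rot th F) w + pm p F w) / l)) with
  (D * (l * C * gapf p (rot th F) F w + (pm p (rot th F) w + pm p F w) / l) + D * (l * gapf p (rot th F) F w)
   + D * C * ((pm p (rot th F) w + pm p F w) / l)) by ring.
lra.
Qed.

(** The pointwise bound is used with weight l / th: the gap integrates to O(th^2) and contributes
    O(th l), while the tail of |F|^p enters with the factor th / l. *)
Lemma tilt_outer : exists C, 0 < C /\ forall l th r, 0 < l -> 0 < th -> 0 <= r < 1 ->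
  mass p (tilt th) <= area (pm p (tilt th)) r + (1 - area (pm p F) r) +
    th * (C * (l + (1 - area (pm p F) r) / l)).
Proof.
destruct tilt_pointwise as [C [hC H]]; destruct rot_gap_bound as [C0 [hC0 H0]].
exists (C * C0 + 2 * C); split; [assert (0 <= C * C0) by (apply Rmult_le_pos; lra); lra |].
intros l th r hl hth hr.
assert (hA : area (pm p F) r <= 1) by (rewrite <- hm1; now apply mass_ub).
set (A := area (pm p F) r) in *.
assert (hX : 0 <= (1 - A) / l) by (apply Rmult_le_pos; [lra | apply Rlt_le, Rinv_0_lt_compat, hl]).
assert (hE : 0 <= th * ((C * C0 + 2 * C) * (l + (1 - A) / l))).
{ apply Rmult_le_pos; [lra |]; apply Rmult_le_pos; [| lra].
  assert (0 <= C * C0) by (apply Rmult_le_pos; lra); lra. }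
assert (hth2 : 0 < l / th) by now apply Rdiv_lt_0_compat.
assert (hRh : holo (rot th F)) by now apply holo_rot.
assert (hTh : holo (tilt th)) by apply Ap_tilt.
apply mass_le; trivial; [apply Ap_tilt |]; intros x hx.
destruct (Rle_or_lt x r) as [hxr | hxr].
{ assert (h := pm_area_incr p (tilt th) x r hp0 hTh ltac:(lra) ltac:(lra)); lra. }
assert (d1 := pm_dcont p F hp0 hFh); assert (d2 := pm_dcont p _ hp0 hRh).
assert (d3 := gapf_dcont p _ _ hp0 hRh hFh).
set (h := fun w => C * (l / th) * gapf p (rot th F) F w + (C * (th / l) * (pm p (rot th F) w + pm p F w) + 1 * pm p F w)).
assert (dh1 : dcont (fun w => C * (th / l) * (pm p (rot th F) w + pm p F w)))
  by now apply dcont_cmul, dcont_add.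
assert (dh2 : dcont (fun w => C * (th / l) * (pm p (rot th F) w + pm p F w) + 1 * pm p F w))
  by (apply dcont_add; trivial; now apply dcont_cmul).
assert (dh : dcont h) by (apply (dcont_add (fun w => C * (l / th) * gapf p (rot th F) F w)); trivial; now apply dcont_cmul).
assert (ha : forall y, 0 <= y < 1 -> area h y = C * (l / th) * area (gapf p (rot th F) F) y +
  (C * (th / l) * (area (pm p F) y + area (pm p F) y) + 1 * area (pm p F) y)).
{ intros y hy; unfold h.
  rewrite (area_add (fun w => C * (l / th) * gapf p (rot th F) F w)
     (fun w => C * (th / l) * (pm p (rot th F) w + pm p F w) + 1 * pm p F w))
    by (trivial; now apply dcont_cmul).
  rewrite area_lin3, area_cmul, pm_area_rot by trivial; reflexivity. }
assert (ht := area_tail_le (pm p (tilt th)) h r x (pm_dcont p _ hp0 hTh) dh ltac:(lra) ltac:(lra)).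
rewrite !ha in ht by lra.
assert (hpt : forall w, Cmod w < 1 -> pm p (tilt th) w <= h w).
{ intros w _; apply Rle_trans with (1 := H (l / th) th w hth2); right; unfold h; field; lra. }
specialize (ht hpt).
assert (hg0 := area_ge0 (gapf p (rot th F) F) r d3 ltac:(intros; now apply gap_ge0) hr).
assert (hg1 := H0 th x ltac:(lra)).
assert (hAx : area (pm p F) x <= 1) by (rewrite <- hm1; apply mass_ub; trivial; lra).
fold A in ht.
assert (k1 : C * (l / th) * (area (gapf p (rot th F) F) x - area (gapf p (rot th F) F) r) <= th * (C * C0 * l)).
{ apply Rle_trans with (C * (l / th) * (C0 * th ^ 2)).
  - apply Rmult_le_compat_l; [apply Rmult_le_pos |]; lra.
  - right; field; lra. }
assert (hthl : 0 < th / l) by now apply Rdiv_lt_0_compat.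
assert (k2 : C * (th / l) * (2 * (area (pm p F) x - A)) <= th * (2 * C * ((1 - A) / l))).
{ apply Rle_trans with (C * (th / l) * (2 * (1 - A))).
  - apply Rmult_le_compat_l; [apply Rmult_le_pos |]; lra.
  - right; field; lra. }
assert (k3 : 0 <= th * (C * C0 * ((1 - A) / l))).
{ apply Rmult_le_pos; [lra |]; apply Rmult_le_pos; trivial; apply Rmult_le_pos; lra. }
assert (k4 : 0 <= th * (2 * C * l)) by (apply Rmult_le_pos; [lra |]; apply Rmult_le_pos; lra).
replace (th * ((C * C0 + 2 * C) * (l + (1 - A) / l))) with
  (th * (C * C0 * l) + th * (2 * C * ((1 - A) / l)) + th * (C * C0 * ((1 - A) / l)) + th * (2 * C * l)) by ring.
lra.
Qed.

(** * The tilt inside a smaller disc and the bound on the slope *)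

Variable Hs : R.
Hypothesis hHs : forall r, 0 <= r < 1 -> mean (pm p F) r <= Hs.

Lemma Cmod_exp_minus (th : R) : Cmod (Csub (Csub (pt 1 th) Cone) (Cmul (0, 1) (th, 0))) <= 2 * th ^ 2.
Proof.
apply Rle_trans with (1 := Cmod_le_abs _).
destruct (one_minus_cos th) as [h1 h2]; assert (h3 := sin_minus_id th).
set (z := Csub (Csub (pt 1 th) Cone) (Cmul (0, 1) (th, 0))).
replace (fst z) with (- (1 - cos th)) by (unfold z, Csub, Cadd, Copp, Cmul, pt, Cone; simpl; ring).
replace (snd z) with (sin th - th) by (unfold z, Csub, Cadd, Copp, Cmul, pt, Cone; simpl; ring).
rewrite Rabs_Ropp, (Rabs_pos_eq (1 - cos th)) by lra; lra.
Qed.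

(** The increments of F at e^{i th} w and (1 + th) w have linear parts L (i th w) and L (th w) up to
    order th^2, and the factor -i in the tilt makes them agree. The bound on th keeps both points in
    |z| <= (1 + r)/2. *)
Lemma tilt_dilation (r : R) : 0 <= r < 1 -> exists C, 0 <= C /\ forall th w,
  0 < th <= (1 - r) / 2 -> Cmod w <= r ->
  pm p (tilt th) w <= pm p F (Cmul (1 + th, 0) w) + C * th ^ 2.
Proof.
intros hr; set (rho := (1 + r) / 2).
destruct (holo_taylor_bound F rho hFh ltac:(unfold rho; lra)) as [C [hC HC]].
exists (p * rpow (3 * C) (p - 1) * (7 * C)); split.
{ apply Rmult_le_pos; [apply Rmult_le_pos; [lra | apply rpow_ge0] | lra]. }
intros th w hth hw; assert (hw0 := Cmod_ge0 w).
destruct (HC w ltac:(unfold rho; lra)) as [hFw [L [hL HL]]].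
set (h1 := Cmul (Csub (pt 1 th) Cone) w); set (h2 := Cmul (th, 0) w).
assert (e1 : Cadd w h1 = Cmul (pt 1 th) w) by (unfold h1; ring).
assert (e2 : Cadd w h2 = Cmul (1 + th, 0) w).
{ unfold h2, Cadd, Cmul; simpl; f_equal; ring. }
assert (hm1' : Cmod (Cadd w h1) <= rho) by (rewrite e1, Cmod_rot; unfold rho; lra).
assert (hm2' : Cmod (Cadd w h2) <= rho).
{ rewrite e2, Cmod_scal, Rabs_pos_eq by lra; unfold rho; nra. }
assert (T1 := HL h1 hm1'); assert (T2 := HL h2 hm2'); rewrite e1 in T1; rewrite e2 in T2.
assert (hR : Cmod (rot th F w) <= C) by (apply (HC (Cmul (pt 1 th) w)); rewrite <- e1; trivial).
assert (hh1 : Cmod h1 <= 2 * th).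
{ unfold h1; rewrite Cmod_mul.
  assert (kk := pt_lipschitz 1 1 th 0); rewrite Rminus_diag, Rabs_R0, Rminus_0_r, Rabs_R1, (Rabs_pos_eq th) in kk by lra.
  replace (pt 1 0) with Cone in kk by (unfold pt, Cone; rewrite cos_0, sin_0; f_equal; ring).
  assert (k0 := Cmod_ge0 (Csub (pt 1 th) Cone)); nra. }
assert (hh2 : Cmod h2 <= th) by (unfold h2; rewrite Cmod_scal, Rabs_pos_eq by lra; nra).
assert (hh10 := Cmod_ge0 h1); assert (hh20 := Cmod_ge0 h2).
set (R1 := Csub (Csub (F (Cmul (pt 1 th) w)) (F w)) (Cmul L h1)) in *.
set (R2 := Csub (Csub (F (Cmul (1 + th, 0) w)) (F w)) (Cmul L h2)) in *.
set (X := Csub (Csub (pt 1 th) Cone) (Cmul (0, 1) (th, 0))).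
assert (hX : Cmod X <= 2 * th ^ 2) by apply Cmod_exp_minus.
assert (hdiff : Csub (tilt th w) (F (Cmul (1 + th, 0) w)) =
  Csub (Cmul (0, -1) (Cadd R1 (Cmul L (Cmul X w)))) R2).
{ unfold tilt, lcomb, rot, R1, R2, X, h1, h2.
  replace (((1, 1) : Cx)) with (Csub Cone (0, -1)) by (unfold Csub, Cadd, Copp, Cone; simpl; f_equal; ring).
  replace (((0, 1) : Cx)) with (Copp (0, -1)) by (unfold Copp; simpl; f_equal; ring).
  assert (hi : Cmul (0, -1) (0, -1) = Copp Cone) by (unfold Cmul, Copp, Cone; simpl; f_equal; ring).
  set (I := ((0, -1) : Cx)) in *.
  (* The last summand is 0, since I^2 + 1 = 0. With it inserted, the identity holds for an
     indeterminate I and [ring] proves it. *)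
  transitivity (Cadd (Csub (Cadd (F w) (Cmul I (Csub (F (Cmul (pt 1 th) w)) (F w))))
    (F (Cmul (1 + th, 0) w))) (Cmul (Cadd (Cmul I I) Cone) (Cmul L (Cmul (th, 0) w)))).
  - rewrite hi; ring.
  - ring. }
assert (hI : Cmod (0, -1) = 1).
{ unfold Cmod; simpl; replace (0 * (0 * 1) + -1 * (-1 * 1)) with 1 by ring; apply sqrt_1. }
(* 7 = 4 + 2 + 1: the Taylor remainder at the rotated point, where the increment is at most 2 th;
   the error of e^{i th} - 1 - i th; the remainder at the dilated point. *)
assert (hd : Cmod (Csub (tilt th w) (F (Cmul (1 + th, 0) w))) <= 7 * C * th ^ 2).
{ rewrite hdiff; apply Rle_trans with (1 := Cmod_sub_le _ _); rewrite Cmod_mul, hI, Rmult_1_l.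
  assert (k1 := Cmod_tri R1 (Cmul L (Cmul X w))); rewrite !Cmod_mul in k1.
  assert (k2 : C * Cmod h1 ^ 2 <= C * (4 * th ^ 2)) by (apply Rmult_le_compat_l; nra).
  assert (k3 : C * Cmod h2 ^ 2 <= C * th ^ 2) by (apply Rmult_le_compat_l; nra).
  assert (hX0 := Cmod_ge0 X).
  assert (k4 : Cmod L * (Cmod X * Cmod w) <= C * (2 * th ^ 2 * 1)).
  { apply Rmult_le_compat; trivial; [apply Cmod_ge0 | apply Rmult_le_pos; trivial | apply Rmult_le_compat; lra]. }
  lra. }
assert (ht : Cmod (tilt th w) <= 3 * C).
{ assert (k1 := Cmod_tri_sub (tilt th w) (F w)); assert (k2 := tilt_sub_le th w).
  assert (k3 := Cmod_sub_le (rot th F w) (F w)); lra. }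
assert (hfin := rpow_diff_le p (Cmod (F (Cmul (1 + th, 0) w))) (Cmod (tilt th w)) ltac:(lra) (Cmod_ge0 _) (Cmod_ge0 _)).
assert (hsub := Cmod_tri_sub (tilt th w) (F (Cmul (1 + th, 0) w))).
assert (k5 : rpow (Cmod (tilt th w)) (p - 1) <= rpow (3 * C) (p - 1)) by (apply rpow_le; [lra | split; [apply Cmod_ge0 | trivial]]).
assert (k6 := rpow_ge0 (Cmod (tilt th w)) (p - 1)).
assert (k7 : p * rpow (Cmod (tilt th w)) (p - 1) * (Cmod (tilt th w) - Cmod (F (Cmul (1 + th, 0) w))) <=
  p * rpow (3 * C) (p - 1) * (7 * C) * th ^ 2).
{ rewrite (Rmult_assoc (p * rpow (3 * C) (p - 1))).
  apply Rle_trans with (p * rpow (Cmod (tilt th w)) (p - 1) * (7 * C * th ^ 2)).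
  - apply Rmult_le_compat_l; [apply Rmult_le_pos; lra | lra].
  - apply Rmult_le_compat_r.
    + apply Rle_trans with (2 := hd); apply Cmod_ge0.
    + apply Rmult_le_compat_l; lra. }
unfold pm; lra.
Qed.

(** By change of variables the dilated function has (1 + th)^-2 times the mass of F in |z| < (1 +
    th) r. The annulus gained has area at most 2 th + th^2 and means at most Hs. *)
Lemma tilt_inner (r : R) : 0 <= r < 1 -> exists C, 0 <= C /\ forall th, 0 < th <= (1 - r) / 2 ->
  area (pm p (tilt th)) r <= area (pm p F) r + th * (2 * Hs - 2 * area (pm p F) r) + C * th ^ 2.
Proof.
intros hr; destruct (tilt_dilation r hr) as [C [hC H]].
assert (hd := pm_dcont p F hp0 hFh).
assert (hHs0 : 0 <= Hs) by (apply Rle_trans with (2 := hHs 0 ltac:(lra)); apply pm_mean_ge0; trivial; lra).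
set (A := area (pm p F) r).
assert (hA0 : 0 <= A) by (apply area_ge0; trivial; intros; apply pm_ge0).
(* The coefficients of th^2: 3 A from expanding (1 + th)^-2, Hs from the annulus, C from the Taylor
   error. *)
exists (3 * A + Hs + C); split; [lra |]; intros th hth.
assert (hs : (1 + th) * r < 1) by nra.
assert (hTh : holo (tilt th)) by apply Ap_tilt.
assert (hm : forall x, 0 <= x <= r -> mean (pm p (tilt th)) x <= mean (pm p F) ((1 + th) * x) + C * th ^ 2).
{ intros x hx; rewrite <- (mean_dil (pm p F) (1 + th) x).
  assert (hc : circ (fun w => pm p F (Cmul (1 + th, 0) w)) x).
  { intros t; apply (rcont_ccomp (pm p F) (fun w => Cmul (1 + th, 0) w)).
    - apply ccont_mul; [apply ccont_const | apply ccont_id].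
    - apply hd; rewrite pt_scal, Cmod_pt, Rabs_pos_eq by nra; nra. }
  rewrite <- (mean_const (C * th ^ 2) x) at 1.
  rewrite <- mean_add by (trivial; apply circ_const).
  apply mean_le.
  - apply dcont_circ'; [now apply pm_dcont | lra].
  - apply circ_add; trivial; apply circ_const.
  - intros t; apply H; trivial; rewrite Cmod_pt, Rabs_pos_eq; lra. }
assert (h1 : area (pm p (tilt th)) r <= / (1 + th) ^ 2 * area (pm p F) ((1 + th) * r) + C * th ^ 2 * (r ^ 2 - 0 ^ 2)).
{ rewrite <- area_dil by (trivial; lra); unfold area.
  assert (hex : ex_RInt (fun x => 2 * x * mean (fun w => pm p F (Cmul (1 + th, 0) w)) x) 0 r).
  { apply ex_RInt_cont; [lra |]; intros x hx; apply continuity_pt_filterlim, continuity_pt_mult.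
    - apply continuity_pt_scal, continuity_pt_id.
    - apply continuity_pt_ext with (fun x => mean (pm p F) ((1 + th) * x)); [intros; symmetry; apply mean_dil |].
      apply (continuity_pt_comp (fun x => (1 + th) * x) (mean (pm p F))).
      + apply continuity_pt_scal, continuity_pt_id.
      + apply dcont_mean_continuous; trivial; nra. }
  rewrite <- RInt_2r_cmul, <- RInt_add by (trivial; try apply ex_RInt_2r; lra).
  apply RInt_le; [lra | | |].
  - apply area_ex_RInt; [now apply pm_dcont | lra | lra].
  - apply ex_RInt_add; trivial; apply ex_RInt_2r; lra.
  - intros x hx; rewrite <- Rmult_plus_distr_l, mean_dil; apply Rmult_le_compat_l; [lra | apply hm; lra]. }
assert (h2 := area_tail_le_const (pm p F) r ((1 + th) * r) Hs hd ltac:(nra) hs ltac:(intros; apply hHs; lra)).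
fold A in h2.
assert (h3 : area (pm p F) ((1 + th) * r) <= A + Hs * (2 * th + th ^ 2)).
{ assert (Hs * (((1 + th) * r) ^ 2 - r ^ 2) <= Hs * (2 * th + th ^ 2)); [| lra].
  apply Rmult_le_compat_l; trivial.
  replace (((1 + th) * r) ^ 2 - r ^ 2) with ((2 * th + th ^ 2) * r ^ 2) by ring.
  rewrite <- (Rmult_1_r (2 * th + th ^ 2)) at 2; apply Rmult_le_compat_l; [assert (0 <= th ^ 2) by apply pow2_ge_0; lra | nra]. }
assert (h4 : / (1 + th) ^ 2 <= 1 - 2 * th + 3 * th ^ 2).
{ apply (Rmult_le_reg_l ((1 + th) ^ 2)); [apply pow_lt; lra |]; rewrite Rinv_r by (apply pow_nonzero; lra).
  assert (0 < th ^ 3) by (apply pow_lt; lra); assert (0 < th ^ 4) by (apply pow_lt; lra).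
  replace ((1 + th) ^ 2 * (1 - 2 * th + 3 * th ^ 2)) with (1 + 4 * th ^ 3 + 3 * th ^ 4) by ring; lra. }
assert (h5 : 0 < / (1 + th) ^ 2 <= 1).
{ split; [apply Rinv_0_lt_compat, pow_lt; lra |]; rewrite <- Rinv_1; apply Rinv_le_contravar; nra. }
assert (h6 : / (1 + th) ^ 2 * area (pm p F) ((1 + th) * r) <= A * (1 - 2 * th + 3 * th ^ 2) + Hs * (2 * th + th ^ 2)).
{ apply Rle_trans with (/ (1 + th) ^ 2 * (A + Hs * (2 * th + th ^ 2))); [apply Rmult_le_compat_l; lra |].
  rewrite Rmult_plus_distr_l; apply Rplus_le_compat.
  - rewrite Rmult_comm; apply Rmult_le_compat_l; lra.
  - rewrite <- (Rmult_1_l (Hs * (2 * th + th ^ 2))) at 2; apply Rmult_le_compat_r; [apply Rmult_le_pos; [trivial | assert (0 <= th ^ 2) by apply pow2_ge_0; lra] | lra]. }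
assert (h7 : C * th ^ 2 * (r ^ 2 - 0 ^ 2) <= C * th ^ 2).
{ rewrite <- (Rmult_1_r (C * th ^ 2)) at 2; apply Rmult_le_compat_l; [apply Rmult_le_pos; [lra | apply pow2_ge_0] | nra]. }
lra.
Qed.

Lemma le_of_quadratic (x y C t0 : R) : 0 < t0 -> (forall t, 0 < t <= t0 -> t * x <= t * y + C * t ^ 2) -> x <= y.
Proof.
intros ht0 h; apply Rnot_lt_le; intros hxy.
set (t := Rmin t0 ((x - y) / (2 * (Rabs C + 1)))).
assert (hC := Rabs_pos C); assert (hC' := Rle_abs C).
assert (ht : 0 < t) by (apply Rmin_pos; trivial; apply Rdiv_lt_0_compat; lra).
assert (ht1 : t <= t0) by apply Rmin_l.
assert (ht2 : t * (2 * (Rabs C + 1)) <= x - y).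
{ apply Rle_trans with ((x - y) / (2 * (Rabs C + 1)) * (2 * (Rabs C + 1))).
  - apply Rmult_le_compat_r; [lra | apply Rmin_r].
  - right; field; lra. }
specialize (h t (conj ht ht1)).
assert (h' : t * x <= t * (y + C * t)) by nra.
apply Rmult_le_reg_l in h'; trivial; nra.
Qed.

(** The order of limits matters: th -> 0 for fixed l and r, then r so close to 1 that the tail of F
    is below l^2, which makes the outer error at most 2 C l, and finally l -> 0. *)
Lemma radial_slope_le : p * radial_slope / N <= 2 * Hs - 2.
Proof.
destruct tilt_outer as [C [hC HO]].
assert (h1 : forall l r, 0 < l -> 0 <= r < 1 ->
  p * radial_slope / N <= 2 * Hs - 2 * area (pm p F) r + C * (l + (1 - area (pm p F) r) / l)).
{ intros l r hl hr; destruct (tilt_inner r hr) as [C1 [hC1 HI]].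
  apply le_of_quadratic with (C := C1 + p * second / N) (t0 := (1 - r) / 2); [lra |].
  intros th hth; assert (k1 := tilt_mass_ge th); assert (k2 := HO l th r hl ltac:(lra) hr).
  assert (k3 := HI th hth).
  replace (p * (th * radial_slope - second * th ^ 2) / N) with
    (th * (p * radial_slope / N) - p * second / N * th ^ 2) in k1 by (field; lra).
  lra. }
apply Rnot_lt_le; intros hlt.
set (e := p * radial_slope / N - (2 * Hs - 2)).
(* The total error is at most 2 l^2 + 2 C l <= (2 + 2 C) l, that is at most e / 2. *)
set (l := Rmin 1 (e / (2 * (2 + 2 * C)))).
assert (he : 0 < e) by (unfold e; lra).
assert (hl : 0 < l) by (apply Rmin_pos; [lra | apply Rdiv_lt_0_compat; lra]).
assert (hl1 : l <= 1) by apply Rmin_l.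
assert (hl2 : l * (2 * (2 + 2 * C)) <= e).
{ apply Rle_trans with (e / (2 * (2 + 2 * C)) * (2 * (2 + 2 * C))).
  - apply Rmult_le_compat_r; [lra | apply Rmin_r].
  - right; field; lra. }
destruct (mass_lim p F hp0 hFA (l ^ 2) ltac:(apply pow_lt; lra)) as [d [hd Hd]].
set (r := 1 - Rmin d 1 / 2).
assert (hmin : 0 < Rmin d 1) by (apply Rmin_pos; lra).
assert (hmin1 := Rmin_l d 1); assert (hmin2 := Rmin_r d 1).
specialize (Hd r ltac:(unfold r; lra)); rewrite hm1 in Hd; apply Rabs_def2 in Hd.
specialize (h1 l r hl ltac:(unfold r; lra)).
set (A := area (pm p F) r) in *.
assert (k1 : (1 - A) / l <= l).
{ apply (Rmult_le_reg_r l); trivial; unfold Rdiv; rewrite Rmult_assoc, Rinv_l by lra; lra. }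
unfold e in *; nra.
Qed.
End Lower.

(** * Norm convergence *)

Section NormConvergence.
Variables (p q : R).
Hypothesis hp : 1 < p.
Hypothesis hq : q = p / (p - 1).
Variables (kn : nat -> Cx -> Cx) (k : Cx -> Cx) (Fn : nat -> Cx -> Cx) (F : Cx -> Cx).
Hypothesis hkn : forall n, Hp q (kn n).
Hypothesis hk : Hp q k.
Hypothesis hk0 : not_zero k.
Hypothesis hconv : forall eta, 0 < eta -> exists N, forall n, (n >= N)%nat ->
  forall r, 0 <= r < 1 -> mean (pm q (fsub (kn n) k)) r <= eta.
Hypothesis hFn : forall n, is_extremal p (kn n) (Fn n).
Hypothesis hF : is_extremal p k F.
Variables (a : nat -> Cx) (d : nat).
Hypothesis hka : is_poly_of k a d.

Let hq1 : 1 < q := q_gt1 p q hp hq.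
Let hkh : holo k := proj1 hk.
Let hknh (n : nat) : holo (kn n) := proj1 (hkn n).
Let hFh : holo F := proj1 (proj1 hF).
Let hFnh (n : nat) : holo (Fn n) := proj1 (proj1 (hFn n)).

(** The change of kernel is controlled by Young's inequality, with small weight on the bounded means
    of F_n. The change of function is seen by the polynomial k only through finitely many
    coefficients, which converge by Cauchy's estimate on |z| <= 1/2; hence uniformity up to the
    boundary. *)
Lemma pair_uniform_conv (eta : R) : 0 < eta -> exists N, forall n, (n >= N)%nat ->
  forall r, 0 < r < 1 -> mean (pair (kn n) (Fn n)) r <= mean (pair k F) r + eta.
Proof.
intros heta.
destruct (extremal_uniform_bound p q hp hq kn k Fn F hkn hk hk0 hconv hFn hF) as [B [N1 hB]].
assert (hB0 : 0 <= Rabs B) by apply Rabs_pos; assert (hBB := Rle_abs B).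
destruct (young_exists p q hp hq (eta / (4 * (Rabs B + 1))) ltac:(apply Rdiv_lt_0_compat; lra)) as [K hK].
assert (hK0 : 0 <= K) by apply hK.
destruct (hconv (eta / (4 * (K + 1)))) as [N2 h2]; [apply Rdiv_lt_0_compat; lra |].
set (S := sum_f_R0 (fun j => 2 ^ j * Cmod (a j)) d).
assert (hS : 0 <= S).
{ apply cond_pos_sum; intros; apply Rmult_le_pos; [apply pow_le; lra | apply Cmod_ge0]. }
assert (heS : 0 < eta / (2 * (S + 1))) by (apply Rdiv_lt_0_compat; lra).
destruct (extremal_loc_unif p q hp hq kn k Fn F hkn hk hk0 hconv hFn hF (1 / 2) _ ltac:(lra) heS) as [N3 h3].
exists (max N1 (max N2 N3)); intros n hn r hr.
assert (hr0 : 0 <= r < 1) by lra.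
assert (hs1 : holo (fsub (kn n) k)) by now apply holo_fsub.
assert (hs2 : holo (fsub (Fn n) F)) by now apply holo_fsub.
assert (c1 := dcont_circ' _ r (pair_dcont _ _ hs1 (hFnh n)) hr0).
assert (c2 := dcont_circ' _ r (pair_dcont _ _ hkh hs2) hr0).
assert (c3 := dcont_circ' _ r (pair_dcont _ _ hkh hFh) hr0).
rewrite (mean_ext (pair (kn n) (Fn n)) (fun w => pair (fsub (kn n) k) (Fn n) w + (pair k (fsub (Fn n) F) w + pair k F w))).
2: { intros t; unfold pair, fsub, Csub, Cadd, Copp, Cmul, Cconj; simpl; ring. }
rewrite (mean_add (pair (fsub (kn n) k) (Fn n)) (fun w => pair k (fsub (Fn n) F) w + pair k F w)), mean_add
  by (trivial; now apply circ_add).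
assert (k1 : mean (pair (fsub (kn n) k) (Fn n)) r <= eta / 2).
{ apply Rle_trans with (1 := Rle_abs _).
  apply Rle_trans with (1 := pair_mean_young p q hp hq _ K _ _ r hK hs1 (hFnh n) hr0).
  assert (k1 := hB n ltac:(lia) r hr0); assert (k2 := h2 n ltac:(lia) r hr0).
  assert (k3 : eta / (4 * (Rabs B + 1)) * mean (pm p (Fn n)) r <= eta / 4).
  { apply Rle_trans with (eta / (4 * (Rabs B + 1)) * (Rabs B + 1)).
    - apply Rmult_le_compat_l; [apply Rlt_le, Rdiv_lt_0_compat |]; lra.
    - right; field; lra. }
  assert (k4 : K * mean (pm q (fsub (kn n) k)) r <= eta / 4).
  { apply Rle_trans with ((K + 1) * (eta / (4 * (K + 1)))).
    - apply Rmult_le_compat; try lra; apply pm_mean_ge0; trivial; lra.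
    - right; field; lra. }
  lra. }
assert (k2 : mean (pair k (fsub (Fn n) F)) r <= eta / 2).
{ rewrite (pair_poly_mean' k a d) by trivial.
  apply Rle_trans with (sum_f_R0 (fun j => 2 ^ j * Cmod (a j) * (eta / (2 * (S + 1)))) d).
  - apply sum_Rle; intros j _.
    assert (hc : Cmod (coef (fsub (Fn n) F) j) <= eta / (2 * (S + 1)) * 2 ^ j).
    { apply coef_bound; trivial; [lra |]; intros w hw; apply (h3 n); trivial; lia. }
    destruct (one_minus_pow j (r ^ 2) ltac:(nra)) as [hx _].
    apply Rle_trans with (Cmod (pcoef a (fsub (Fn n) F) j)).
    + apply Rle_trans with (1 := Rle_abs _); rewrite Rabs_mult, (Rabs_pos_eq ((r ^ 2) ^ j)) by lra.
      rewrite <- (Rmult_1_r (Cmod (pcoef a (fsub (Fn n) F) j))); apply Rmult_le_compat; try lra; [apply Rabs_pos | apply Cre_le].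
    + unfold pcoef; rewrite Cmod_mul, Cmod_conj.
      replace (2 ^ j * Cmod (a j) * (eta / (2 * (S + 1)))) with (eta / (2 * (S + 1)) * 2 ^ j * Cmod (a j)) by ring.
      apply Rmult_le_compat_r; trivial; apply Cmod_ge0.
  - rewrite <- scal_sum; fold S.
    apply Rle_trans with (eta / (2 * (S + 1)) * (S + 1)); [apply Rmult_le_compat_l; lra | right; field; lra]. }
lra.
Qed.

(** The uniform estimate of means is integrated over t < |z| < 1, whose normalized area is 1 - t^2;
    thus the error survives division by 1 - t. *)
Lemma pair_tail_conv (eta : R) : 0 < eta -> exists N, forall n, (n >= N)%nat ->
  forall t, 0 < t < 1 ->
    rphi (kn n) (Fn n) - area (pair (kn n) (Fn n)) t <= rphi k F - area (pair k F) t + eta * (1 - t ^ 2).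
Proof.
intros heta; destruct (pair_uniform_conv eta heta) as [N hN]; exists N; intros n hn t ht.
specialize (hN n hn).
assert (c1 := pair_dcont _ _ (hknh n) (hFnh n)); assert (c2 := pair_dcont _ _ hkh hFh).
assert (l1 := pair_lim p q hp hq (kn n) (Fn n) (hkn n) (proj1 (hFn n))).
assert (l2 := pair_lim p q hp hq k F hk (proj1 hF)).
assert (l3 := lim1_add _ _ _ _ (lim1_add _ _ _ _ l2 (lim1_sq eta)) (lim1_cmul (-1) _ _ l1)).
assert (h := lim1_ge _ _ (area (pair k F) t + eta * t ^ 2 - area (pair (kn n) (Fn n)) t) t l3 ltac:(lra)).
simpl in h; enough (area (pair k F) t + eta * t ^ 2 - area (pair (kn n) (Fn n)) t <=
  rphi k F + eta + -1 * rphi (kn n) (Fn n)) by lra.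
apply h; intros x hx.
assert (hd : dcont (fun w => pair (kn n) (Fn n) w - pair k F w)).
{ intros z hz; apply rcont_minus; [apply c1 | apply c2]; trivial. }
assert (k1 := area_tail_le_const (fun w => pair (kn n) (Fn n) w - pair k F w) t x eta hd ltac:(lra) ltac:(lra)).
rewrite !area_sub in k1 by (trivial; lra).
specialize (k1 ltac:(intros r hr; rewrite mean_sub by (apply dcont_circ'; trivial; lra);
  assert (k2 := hN r ltac:(lra)); lra)); lra.
Qed.

(** The limit of the circle means of the pairing as the radius tends to 1, hence the density of its
    tail at the boundary. *)
Let c1 : R := sum_f_R0 (fun j => fst (pcoef a F j)) d.
Let C1 : R := sum_f_R0 (fun j => Rabs (fst (pcoef a F j)) * INR (S j)) d.

Lemma pair_tail_poly (t : R) : 0 < t < 1 ->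
  rphi k F - area (pair k F) t <= (1 - t ^ 2) * c1 + C1 * (1 - t ^ 2) ^ 2.
Proof.
intros ht; rewrite (rphi_poly k a d), (pair_poly_area k a d) by (trivial; lra).
unfold c1, C1; rewrite (Rmult_comm (sum_f_R0 (fun j => Rabs (fst (pcoef a F j)) * INR (S j)) d)).
rewrite !scal_sum, <- plus_sum, <- minus_sum; apply sum_Rle; intros j _.
set (b := fst (pcoef a F j)).
assert (hi := lt_0_INR (S j) ltac:(lia)).
destruct (one_minus_pow (S j) (t ^ 2) ltac:(nra)) as [_ [h1 h2]].
set (u := 1 - t ^ 2) in *; set (m := INR (S j)) in *; set (y := 1 - (t ^ 2) ^ S j) in *.
assert (hy : Rabs (y - m * u) <= m ^ 2 * u ^ 2) by (apply Rabs_le; assert (0 <= m ^ 2 * u ^ 2) by (apply Rmult_le_pos; apply pow2_ge_0); lra).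
replace (b / m - b / m * (t ^ 2) ^ S j) with (b * u + b * (y - m * u) / m) by (unfold y; field; lra).
apply Rplus_le_compat_l.
apply (Rmult_le_reg_r m); trivial.
replace (b * (y - m * u) / m * m) with (b * (y - m * u)) by (field; lra).
apply Rle_trans with (1 := Rle_abs _); rewrite Rabs_mult.
apply Rle_trans with (Rabs b * (m ^ 2 * u ^ 2)); [apply Rmult_le_compat_l; trivial; apply Rabs_pos |].
right; ring.
Qed.

(** The dilation inequality is divided by u = 1 - t^2, with r fixed and u -> 0. The factors 2 come
    from 1 - t^4, which is 2 u to first order; the tail of the pairing contributes c1 + eta. *)
Lemma extremal_mean_upper (eta : R) : 0 < eta -> exists N, forall n, (n >= N)%nat ->
  forall r, 0 <= r < 1 -> 2 * phi_norm p (kn n) * mean (pm p (Fn n)) r / p <=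
    2 * phi_norm p (kn n) / p - phi_norm p (kn n) + c1 + eta.
Proof.
intros heta; destruct (pair_tail_conv eta heta) as [N0 h0].
assert (hpos := phi_norm_k_pos p q hp hq k F hk hk0 hF).
destruct (phi_norm_conv p q hp hq kn k F hkn hk hconv hF (phi_norm p k / 2) ltac:(lra)) as [N2 h2].
exists (max N0 N2); intros n hn r hr.
specialize (h0 n ltac:(lia)); specialize (h2 n ltac:(lia)); apply Rabs_le_between in h2.
assert (hrN : rphi (kn n) (Fn n) = phi_norm p (kn n)) by apply (hFn n).
rewrite hrN in h0; set (Nn := phi_norm p (kn n)) in *.
assert (hNn : 0 < Nn) by lra.
set (M := mean (pm p (Fn n)) r).
assert (hM0 : 0 <= M) by (apply pm_mean_ge0; trivial; lra).
(* This C collects the coefficients of u^2; the terms in -eta u^2 and -C1 u^3 have a favourable sign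
   and are dropped. *)
apply le_of_quadratic with (C := Nn * M / p - Nn / p + Nn - c1 + C1) (t0 := (1 - r) / 2); [lra |].
intros u hu; set (x := 1 - u); assert (hx : r <= x < 1) by (unfold x; lra).
assert (hx0 : 0 < x) by (unfold x; lra).
set (t := sqrt x).
assert (ht2 : t ^ 2 = x) by (apply pow2_sqrt; lra).
assert (ht : 0 < t < 1).
{ split; [apply sqrt_lt_R0; lra |]; rewrite <- sqrt_1; apply sqrt_lt_1_alt; lra. }
assert (hE := extremal_dil p q hp hq (kn n) (Fn n) t (hkn n) (hFn n) ht); fold Nn in hE.
specialize (h0 t ht); assert (h1 := pair_tail_poly t ht).
assert (hM := mass_tail_ge p hp (Fn n) x (proj1 (hFn n)) ltac:(lra)).
rewrite (normalized_mass p hp (Fn n) (extremal_normalized p (kn n) (Fn n) (hFn n))) in hM.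
replace (t ^ 4) with (x ^ 2) in hE by (rewrite <- ht2; ring).
rewrite ht2 in *.
assert (hMx : M <= mean (pm p (Fn n)) x) by (apply pm_mean_monotone; trivial; lra).
set (P := area (pair (kn n) (Fn n)) t) in *; set (A := area (pm p (Fn n)) x) in *.
assert (hMA : M * (1 - x ^ 2) <= 1 - A).
{ apply Rle_trans with (2 := hM); apply Rmult_le_compat_r; [nra | trivial]. }
assert (hL : Nn / p * (M * (1 - x ^ 2)) <= Nn * (1 - A) / p).
{ replace (Nn * (1 - A) / p) with (Nn / p * (1 - A)) by (field; lra).
  apply Rmult_le_compat_l; trivial; apply Rlt_le, Rdiv_lt_0_compat; lra. }
replace (1 - x) with u in * by (unfold x; ring).
assert (hT : Nn - P <= u * (c1 + C1 * u + eta)) by lra.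
assert (hT' : x * (Nn - P) <= x * (u * (c1 + C1 * u + eta))) by (apply Rmult_le_compat_l; lra).
assert (hCu : 0 <= C1 * u ^ 3).
{ apply Rmult_le_pos; [| apply pow_le; lra].
  apply cond_pos_sum; intros; apply Rmult_le_pos; [apply Rabs_pos | apply pos_INR]. }
assert (heu : 0 <= eta * u ^ 2) by (apply Rmult_le_pos; [lra | apply pow2_ge_0]).
set (s := Nn / p) in *.
replace (2 * Nn * M / p) with (2 * (s * M)) by (unfold s; field; lra).
replace (Nn * M / p) with (s * M) by (unfold s; field; lra).
replace (2 * Nn / p) with (2 * s) by (unfold s; field; lra).
replace (Nn * (1 - x ^ 2) / p) with (s * (1 - x ^ 2)) in hE by (unfold s; field; lra).
assert (hx2 : 1 - x ^ 2 = u * (2 - u)) by (unfold x; ring).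
rewrite hx2 in *.
replace (x ^ 2) with (1 - u * (2 - u)) in hE by lra.
unfold x in *; nra.
Qed.

(** Local uniform convergence makes the midpoint of F_n and F as large as F on one circle of radius
    r0 < 1, hence on every larger circle, while neither function has means above Hs + e. Uniform
    convexity then applies on the circle of radius max(r0, r). *)
Lemma extremal_norm_convergence (eps : R) : 0 < eps -> exists N, forall n, (n >= N)%nat ->
  forall r, 0 <= r < 1 -> mean (pm p (fsub (Fn n) F)) r <= eps.
Proof.
intros heps.
assert (hFH := extremal_in_Hp p q hp hq k F hk hk0 hF).
destruct (proj1 (Hp_iff p F ltac:(lra)) hFH) as [_ [B hB]].
destruct (completeness (fun y => exists r, 0 <= r < 1 /\ y = mean (pm p F) r)) as [Hs [hHs1 hHs2]].
{ exists B; intros y [r [hr ->]]; auto. }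
{ exists (mean (pm p F) 0), 0; split; trivial; lra. }
assert (hHs : forall r, 0 <= r < 1 -> mean (pm p F) r <= Hs) by (intros r hr; apply hHs1; now exists r).
assert (hHs0 : 0 <= Hs) by (apply Rle_trans with (2 := hHs 0 ltac:(lra)); apply pm_mean_ge0; trivial; lra).
assert (hpos := phi_norm_k_pos p q hp hq k F hk hk0 hF).
assert (hslope := radial_slope_le p q hp hq k F a d hka hk hk0 hF Hs hHs).
set (N := phi_norm p k) in *.
(* Termwise this is 1/(j + 1) + j/(j + 1) = 1. It identifies the upper bound with the quantity that
   [radial_slope_le] controls. *)
assert (hc1 : c1 = N + radial_slope F a d).
{ unfold N; rewrite (phi_norm_sum p q k F a d hka hk hF); unfold radial_slope, c1.
  rewrite <- plus_sum; apply sum_eq; intros j _.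
  rewrite S_INR; assert (h := pos_INR j); field; lra. }
destruct (mean_uniform_convexity p (eps / (8 * (Hs + 1))) hp) as [K [hK HK]]; [apply Rdiv_lt_0_compat; lra |].
set (e := Rmin 1 (eps / (8 * (K + 1)))).
assert (he : 0 < e) by (apply Rmin_pos; [lra | apply Rdiv_lt_0_compat; lra]).
assert (he1 : e <= 1) by apply Rmin_l.
assert (he2 : K * e <= eps / 8).
{ apply Rle_trans with ((K + 1) * (eps / (8 * (K + 1)))).
  - apply Rmult_le_compat; try lra; apply Rmin_r.
  - right; field; lra. }
assert (hup : exists N1, forall n, (n >= N1)%nat -> forall r, 0 <= r < 1 -> mean (pm p (Fn n)) r <= Hs + e).
(* The first bound keeps the norms of the functionals above N / 2. The second makes eta (Hs + 1 +
   p), the sum of all errors, at most e N / 4. *)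
{ set (eta := Rmin (N / 2) (e * N / (4 * (Hs + 1 + p)))).
  assert (heta : 0 < eta).
  { apply Rmin_pos; [lra |]; apply Rdiv_lt_0_compat; [now apply Rmult_lt_0_compat | lra]. }
  assert (heta1 : eta <= N / 2) by apply Rmin_l.
  assert (heta2 : eta * (4 * (Hs + 1 + p)) <= e * N).
  { apply Rle_trans with (e * N / (4 * (Hs + 1 + p)) * (4 * (Hs + 1 + p))).
    - apply Rmult_le_compat_r; [lra | apply Rmin_r].
    - right; field; lra. }
  destruct (extremal_mean_upper eta heta) as [N1 h1].
  destruct (phi_norm_conv p q hp hq kn k F hkn hk hconv hF eta heta) as [N2 h2].
  exists (max N1 N2); intros n hn r hr.
  specialize (h1 n ltac:(lia) r hr); specialize (h2 n ltac:(lia)); apply Rabs_le_between in h2; fold N in h2.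
  set (Nn := phi_norm p (kn n)) in *; set (M := mean (pm p (Fn n)) r) in *.
  assert (hQ : radial_slope F a d <= N * (2 * Hs - 2) / p).
  { apply (Rmult_le_reg_l (p / N)); [apply Rdiv_lt_0_compat; lra |].
    replace (p / N * (N * (2 * Hs - 2) / p)) with (2 * Hs - 2) by (field; lra).
    replace (p / N * radial_slope F a d) with (p * radial_slope F a d / N) by (field; lra); exact hslope. }
  apply (Rmult_le_compat_l (p / 2)) in h1; [| lra].
  replace (p / 2 * (2 * Nn * M / p)) with (Nn * M) in h1 by (field; lra).
  apply (Rmult_le_compat_l p) in hQ; [| lra].
  replace (p * (N * (2 * Hs - 2) / p)) with (N * (2 * Hs - 2)) in hQ by (field; lra).
  assert (h3 : p / 2 * (2 * Nn / p - Nn + c1 + eta) = Nn + p / 2 * (N - Nn + eta) + p * radial_slope F a d / 2)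
    by (rewrite hc1; field; lra).
  rewrite h3 in h1.
  assert (h4 : p / 2 * (N - Nn + eta) <= p / 2 * (2 * eta)) by (apply Rmult_le_compat_l; lra).
  assert (h5 : Nn * M <= Nn + p * eta + N * (Hs - 1)) by lra.
  assert (h6 : (N - Nn) * (Hs - 1) <= eta * (Hs + 1)).
  { apply Rle_trans with (1 := Rle_abs _); rewrite Rabs_mult; apply Rmult_le_compat; try apply Rabs_pos; apply Rabs_le; lra. }
  assert (h7 : e * (N / 2) <= e * Nn) by (apply Rmult_le_compat_l; lra).
  apply (Rmult_le_reg_l Nn); [lra |]; nra. }
destruct hup as [N1 h1].
assert (hr0 : exists r0, 0 <= r0 < 1 /\ Hs - e < mean (pm p F) r0).
{ apply NNPP; intros hn; assert (Hs <= Hs - e); [| lra].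
  apply hHs2; intros y [r [hr ->]]; apply Rnot_lt_le; intros h; apply hn; now exists r. }
destruct hr0 as [r0 [hr0 hr0e]].
destruct (holo_taylor_bound F r0 hFh hr0) as [C [hC HC]].
set (D := p * rpow C (p - 1)).
assert (hD : 0 <= D) by (apply Rmult_le_pos; [lra | apply rpow_ge0]).
destruct (extremal_loc_unif p q hp hq kn k Fn F hkn hk hk0 hconv hFn hF r0 (e / (D + 1)) hr0
  ltac:(apply Rdiv_lt_0_compat; lra)) as [N2 h2].
exists (max N1 N2); intros n hn r hr.
specialize (h1 n ltac:(lia)); specialize (h2 n ltac:(lia)).
assert (hmh : holo (fmid (Fn n) F)) by now apply holo_fmid.
assert (hmid : Hs - 2 * e <= mean (pm p (fmid (Fn n) F)) r0).
{ assert (cF := dcont_circ' _ r0 (pm_dcont p F ltac:(lra) hFh) hr0).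
  assert (cM := dcont_circ' _ r0 (pm_dcont p _ ltac:(lra) hmh) hr0).
  enough (mean (pm p F) r0 <= mean (pm p (fmid (Fn n) F)) r0 + e) by lra.
  rewrite <- (mean_const e r0) at 1; rewrite <- mean_add by (trivial; apply circ_const).
  apply mean_le; trivial; [apply circ_add; trivial; apply circ_const |].
  intros t; set (w := pt r0 t).
  assert (hw : Cmod w <= r0) by (unfold w; rewrite Cmod_pt, Rabs_pos_eq; lra).
  assert (k1 := rpow_diff_le p (Cmod (fmid (Fn n) F w)) (Cmod (F w)) ltac:(lra) (Cmod_ge0 _) (Cmod_ge0 _)).
  assert (k2 : Cmod (F w) - Cmod (fmid (Fn n) F w) <= e / (D + 1)).
  { assert (k3 := Cmod_tri_sub (F w) (fmid (Fn n) F w)).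
    replace (Csub (F w) (fmid (Fn n) F w)) with (Cmul (- / 2, 0) (Csub (Fn n w) (F w))) in k3.
    - rewrite Cmod_scal, Rabs_left in k3 by lra; specialize (h2 w hw).
      assert (k4 := Cmod_ge0 (Csub (Fn n w) (F w))); lra.
    - unfold fmid, lcomb, Csub, Cadd, Copp, Cmul; simpl; f_equal; field. }
  assert (hFw : rpow (Cmod (F w)) (p - 1) <= rpow C (p - 1)).
  { apply rpow_le; [lra |]; split; [apply Cmod_ge0 | now apply HC]. }
  assert (k5 := rpow_ge0 (Cmod (F w)) (p - 1)).
  assert (hed : 0 < e / (D + 1)) by (apply Rdiv_lt_0_compat; lra).
  assert (k6 : p * rpow (Cmod (F w)) (p - 1) * (Cmod (F w) - Cmod (fmid (Fn n) F w)) <= D * (e / (D + 1))).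
  { apply Rle_trans with (p * rpow (Cmod (F w)) (p - 1) * (e / (D + 1))).
    - apply Rmult_le_compat_l; [apply Rmult_le_pos |]; lra.
    - apply Rmult_le_compat_r; [lra | apply Rmult_le_compat_l; lra]. }
  assert (k7 : D * (e / (D + 1)) <= e).
  { apply Rle_trans with ((D + 1) * (e / (D + 1))); [apply Rmult_le_compat_r; lra | right; field; lra]. }
  unfold pm; lra. }
set (s := Rmax r0 r).
assert (hs : 0 <= s < 1) by (unfold s; apply Rmax_case; trivial).
assert (hs1 : r0 <= s) by apply Rmax_l; assert (hs2 : r <= s) by apply Rmax_r.
apply Rle_trans with (1 := pm_mean_monotone p _ r s ltac:(lra) (holo_fsub _ _ (hFnh n) hFh) ltac:(lra) ltac:(lra)).
apply Rle_trans with (1 := HK (Fn n) F s (hFnh n) hFh hs).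
assert (k1 := h1 s hs); assert (k2 := hHs s hs).
assert (k3 := pm_mean_monotone p _ r0 s ltac:(lra) hmh ltac:(lra) ltac:(lra)).
set (ep := eps / (8 * (Hs + 1))) in *.
assert (hep : 0 < ep) by (apply Rdiv_lt_0_compat; lra).
assert (k4 : (ep + K / 2) * (mean (pm p (Fn n)) s + mean (pm p F) s) <= (ep + K / 2) * (2 * Hs + e))
  by (apply Rmult_le_compat_l; lra).
assert (k5 : K * (Hs - 2 * e) <= K * mean (pm p (fmid (Fn n) F)) s) by (apply Rmult_le_compat_l; lra).
assert (k6 : ep * (2 * Hs + e) <= eps / 4).
{ apply Rle_trans with (ep * (2 * (Hs + 1))); [apply Rmult_le_compat_l; lra | right; unfold ep; field; lra]. }
lra.
Qed.
End NormConvergence.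

Lemma Hp_norm_cv_iff (p : R) (fn : nat -> Cx -> Cx) (f : Cx -> Cx) : 0 < p ->
  (forall n, Hp p (fn n)) -> Hp p f ->
  Un_cv (fun n => Hp_norm p (fun z => Csub (fn n z) (f z))) 0 <->
  (forall eta, 0 < eta -> exists N, forall n, (n >= N)%nat ->
    forall r, 0 <= r < 1 -> mean (pm p (fsub (fn n) f)) r <= eta).
Proof.
intros hp hfn hf.
assert (hs : forall n, Hp p (fsub (fn n) f)) by (intros; now apply Hp_fsub).
split; intros h eta heta.
- destruct (h (rpow eta (/ p))) as [N hN]; [now apply rpow_gt0 |].
  exists N; intros n hn r hr; specialize (hN n hn).
  unfold Rdist in hN; rewrite Rminus_0_r in hN.
  change (fun z => Csub (fn n z) (f z)) with (fsub (fn n) f) in hN.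
  assert (h0 := Hp_norm_ge0 p _ hp (hs n)); rewrite Rabs_pos_eq in hN by trivial.
  apply Rle_trans with (1 := Hp_norm_ub p _ r hp (hs n) hr).
  rewrite <- (rpow_inv' eta p) by lra; apply rpow_le; lra.
- destruct (h (rpow (eta / 2) p)) as [N hN]; [apply rpow_gt0; lra |].
  exists N; intros n hn; specialize (hN n hn).
  unfold Rdist; rewrite Rminus_0_r.
  change (fun z => Csub (fn n z) (f z)) with (fsub (fn n) f).
  assert (h0 := Hp_norm_ge0 p _ hp (hs n)); rewrite Rabs_pos_eq by trivial.
  assert (k := Hp_norm_le p _ _ hp (hs n) hN); rewrite rpow_inv in k; lra.
Qed.

Theorem theorem2p3 (p q : R) (hp : 1 < p) (hq : q = p / (p - 1))
  (kn : nat -> Cx -> Cx) (k : Cx -> Cx) (Fn : nat -> Cx -> Cx) (F : Cx -> Cx) :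
  (forall n, Hp q (kn n) /\ not_zero (kn n)) ->
  Hp q k -> not_zero k ->
  Un_cv (fun n => Hp_norm q (fun z => Csub (kn n z) (k z))) 0 ->
  (forall n, is_extremal p (kn n) (Fn n)) ->
  is_extremal p k F ->
  (forall n, Hp p (Fn n)) /\ Hp p F /\ weak_conv_Hp p Fn F /\
  ((is_poly k /\ forall n, is_poly (kn n)) ->
     Un_cv (fun n => Hp_norm p (fun z => Csub (Fn n z) (F z))) 0).
Proof.
intros hkn hk hk0 hcv hFn hF.
assert (hq1 := q_gt1 p q hp hq).
assert (hkn' : forall n, Hp q (kn n)) by apply hkn.
assert (hconv := proj1 (Hp_norm_cv_iff q kn k ltac:(lra) hkn' hk) hcv).
assert (hFnH : forall n, Hp p (Fn n)).
{ intros n; apply (extremal_in_Hp p q hp hq (kn n)); trivial; apply hkn. }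
assert (hFH : Hp p F) by now apply (extremal_in_Hp p q hp hq k).
split; [exact hFnH |]; split; [exact hFH |]; split.
- apply bounded_loc_unif_weak; trivial.
  + now apply (extremal_uniform_bound p q hp hq kn k Fn F).
  + now apply (extremal_loc_unif p q hp hq kn k Fn F).
- intros [[d [a hka]] _].
  apply Hp_norm_cv_iff; trivial; [lra |].
  now apply (extremal_norm_convergence p q hp hq kn k Fn F) with (a := a) (d := d).
Qed.
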